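(* Let $n\ge 1$ and $N\ge 0$ be integers and let $a,b_1,\dots,b_{n+2},c,d,e,z_1,\dots,z_n$ be nonzero complex numbers with $a^3q^{2+N}=b_1\cdots b_{n+2}\,cde\,z_1\cdots z_n$. Put $\lambda=a^2q/cde$. Then $$\sum_{\substack{y_1+\dots+y_n\leq N\\ y_1,\dots,y_n\geq 0}} \Bigg(\frac{\Delta(zq^y)}{\Delta(z)}\prod_{k=1}^n\frac{\theta(az_kq^{y_k+|y|})} {\theta(az_k)}\cdot\frac{(q^{-N},c,d)_{|y|} \prod_{j=1}^n(az_j)_{|y|}}{(aq/e)_{|y|} \prod_{j=1}^{n+2}(aq/b_j)_{|y|}}\,q^{|y|}$$ $$\times\prod_{k=1}^n\frac{(ez_k)_{y_k}\prod_{j=1}^{n+2}(b_jz_k)_{y_k}} {(aq^{1+N}z_k,aqz_k/c,aqz_k/d)_{y_k}\prod_{j=1}^n(qz_k/z_j)_{y_k}}\Bigg)$$ $$=\left(\frac a\lambda\right)^N \left(\prod_{k=1}^n\frac{(aqz_k)_N}{(\lambda qz_k)_N}\right)\left(\prod_{j=1}^{n+2}\frac{(\lambda q/b_j)_N} {(aq/b_j)_N}\right)$$ $$\times\sum_{\substack{y_1+\dots+y_n\leq N\\ y_1,\dots,y_n\geq 0}} \Bigg(\frac{\Delta(zq^y)}{\Delta(z)}\prod_{k=1}^n\frac{\theta(\lambda z_kq^{y_k+|y|})} {\theta(\lambda z_k)}\cdot\frac{(q^{-N},\lambda c/a,\lambda d/a)_{|y|} \prod_{j=1}^n(\lambda z_j)_{|y|}}{(aq/e)_{|y|}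 \prod_{j=1}^{n+2}(\lambda q/b_j)_{|y|}}\,q^{|y|}$$ $$\times\prod_{k=1}^n\frac{(\lambda ez_k/a)_{y_k}\prod_{j=1}^{n+2}(b_jz_k)_{y_k}} {(\lambda q^{1+N}z_k,aqz_k/c,aqz_k/d)_{y_k}\prod_{j=1}^n(qz_k/z_j)_{y_k}}\Bigg),$$ the sums being over integers $y_1,\dots,y_n$.
   Context: Fix $p\in\mathbb C$ with $|p|<1$ and $q\in\mathbb C\setminus\{0\}$. For $x\neq 0$ put $\theta(x)=\prod_{j=0}^\infty(1-p^jx)(1-p^{j+1}/x)$ (so $\theta(x)=1-x$ when $p=0$). The elliptic Pochhammer symbol is $(a)_k=\theta(a)\theta(aq)\cdots\theta(aq^{k-1})$ for integers $k\ge 0$, with $(a)_0=1$, and $(a_1,\dots,a_r)_k=(a_1)_k\cdots(a_r)_k$. Everything after a slash is in the denominator, e.g. $a^2q/cde$ means $a^2q/(cde)$. For $z=(z_1,\dots,z_n)$, the elliptic Vandermonde determinant is $\Delta(z)=\prod_{1\le j<k\le n}z_j\,\theta(z_k/z_j)$, and $zq^y=(z_1q^{y_1},\dots,z_nq^{y_n})$, $|y|=y_1+\dots+y_n$. Standing assumption: all expressions are well-defined, i.e. the parameters are such that no denominator occurring on either side vanishes. *)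

(* Defs.v *)
From mathcomp Require Import all_boot all_order all_algebra.
From mathcomp Require Import complex.
From mathcomp Require Import all_classical all_reals all_analysis.
Set Implicit Arguments.
Unset Strict Implicit.
Unset Printing Implicit Defensive.
Import Order.TTheory GRing.Theory Num.Theory numFieldNormedType.Exports.
Local Open Scope ring_scope.
Local Open Scope complex_scope.

(* The limit is taken in [R[i]^o], whose topology is the one of the modulus;
   the partial products converge for |p| < 1 and x != 0. *)
Definition theta (R : realType) (p x : R[i]) : R[i] :=
  limn (fun m : nat =>
    (\prod_(0 <= j < m) ((1 - p ^+ j * x) * (1 - p ^+ j.+1 / x)) : R[i]^o)).

Definition epoch (R : realType) (p q a : R[i]) (k : nat) : R[i] :=
  \prod_(0 <= i < k) theta p (a * q ^+ i).

Definition eDelta (R : realType) (p : R[i]) (n : nat) (z : 'I_n -> R[i]) : R[i] :=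
  \prod_(j < n) \prod_(k < n | (j < k)%N) (z j * theta p (z k / z j)).

(* Multi-indices are bounded entrywise by N, which loses nothing in sums over
   y_1 + ... + y_n <= N. *)
Definition multi_index (n N : nat) : Type := {ffun 'I_n -> 'I_N.+1}.

Definition msize (n N : nat) (y : multi_index n N) : nat := (\sum_(k < n) y k)%N.

Definition qshift (R : realType) (q : R[i]) (n N : nat) (z : 'I_n -> R[i])
    (y : multi_index n N) : 'I_n -> R[i] := fun k => z k * q ^+ y k.

(* Main.v *)
(* The sums are first put in a symmetric form: a sum over the compositions of N
   into n+1 parts, with the extra variable z_0 = q^-N / a.  Partial fractions
   for theta functions give this symmetric sum a two-term recursion in N.  The
   map exchanging the two sides acts on the symmetric form only by changing z_0
   and one numerator parameter; it is compatible with the recursion, so the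
   identity follows by induction on N whenever no theta value met on the way
   vanishes.  Partial fractions reduce to the Weierstrass identity, which comes
   from the Jacobi triple product: theta(xy) theta(x/y) has rank two as a
   function of (x, y), and a 4 x 4 skew-symmetric matrix of rank less than 4
   has Pfaffian zero.  Finally, the parameters allowed by the theorem but not
   generic are reached by multiplying them with powers of a factor tending
   to 1. *)
Require Import Defs.
From mathcomp Require Import all_boot all_order all_algebra.
From mathcomp Require Import complex.
From mathcomp Require Import all_classical all_reals all_analysis.
From mathcomp Require Import ring lra zify.
Set Implicit Arguments.
Unset Strict Implicit.
Unset Printing Implicit Defensive.
Import Order.TTheory GRing.Theory Num.Theory numFieldNormedType.Exports.
Local Open Scope ring_scope.
Local Open Scope complex_scope.

(** * The transformation for generic parameters *)

(** Why the recursion respects the exchange: in the symmetric form both sides share [f = a*q/c],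
    [g = a*q/d], the [b_j] and the [z_k]; only [z_0 = w] and [e] become [w'] and [e']. One step
    lowers N by one and multiplies one [b] and either [f] or [g] by [q]. Since [w'] and [e'] depend
    on [f], [g] and N only through [f*g*q^N], they serve unchanged at the next level, and what
    remains is an identity between coefficients. The price is division by values such as
    [theta(f/g) = theta(d/c)], about which the theorem assumes nothing; hence the genericity and the
    final limit. The [z_k] and [q] stay fixed in that limit, because the denominators
    [(q*z_k/z_j)_{y_k}] and Delta(z) already give what is required of them. The algebra holds over
    any field with a function [th] having four properties; [th_div0], closure of the zeros under
    division, is all it uses about their location. *)

Section GenericTransformation.
Variables (F : fieldType) (th : F -> F).
Hypothesis th1 : th 1 = 0.
Hypothesis thV : forall x : F, x != 0 -> th x^-1 = - (th x / x).
Hypothesis th_div0 :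
  forall x y : F, x != 0 -> y != 0 -> th x = 0 -> th y = 0 -> th (x / y) = 0.
Hypothesis weierstrass : forall be x u v w : F,
  be != 0 -> x != 0 -> u != 0 -> v != 0 -> w != 0 ->
  u / v * (th (x / u) * th (x * u / be)) * (th (v / w) * th (v * w / be)) =
  th (x / v) * th (x * v / be) * (th (u / w) * th (u * w / be)) -
  th (x / w) * th (x * w / be) * (th (u / v) * th (u * v / be)).

(** An algebraic form of the vanishing of the sum of residues of an elliptic function. Induction on
    the number of points: Weierstrass writes [th (x / b1) * th (x / b2)] as a combination of
    [th (x / a i) * th (x * a i / (b1 * b2))] and the same with [j]. The first factor removes the
    point [a i], and [b1], [b2] give way to the single [b1 * b2 / a i], which keeps the products
    balanced. *)
Lemma partial_fractions (T : finType) (a : T -> F) (A : {set T}) (bs : seq F) :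
  (forall i, a i != 0) -> all (predC1 0) bs ->
  #|A| = size bs -> \prod_(i in A) a i = \prod_(b <- bs) b ->
  {in A &, forall i j, i != j -> th (a i / a j) != 0} ->
  \sum_(k in A) \prod_(b <- bs) th (a k / b) /
                \prod_(j in A | j != k) th (a k / a j) = 0.
Proof.
move=> a0; move: {2}(size bs) (erefl (size bs)) => n.
elim: n A bs => [|n IH] A bs.
  by move=> -> _ /eqP; rewrite cards_eq0 => /eqP -> _ _; rewrite big_set0.
case: bs => [//|b1 [|b2 bs]] /= [sz].
  move=> /andP [b10 _] /eqP /cards1P [i ->].
  rewrite finset.big_set1 big_seq1 => <- _; rewrite finset.big_set1 big_seq1 divff // th1.
  by rewrite mul0r.
move=> /and3P [b10 b20 bs0] cA pA dA.
set be := b1 * b2; have be0 : be != 0 by rewrite mulf_neq0.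
have step i : i \in A -> \sum_(k in A)
   (th (a k / a i) * th (a k * a i / be) * \prod_(b <- bs) th (a k / b)) /
       \prod_(j in A | j != k) th (a k / a j) = 0.
  move=> iA; rewrite (bigD1 i) //= divff // th1 !mul0r add0r.
  rewrite -[RHS](IH (A :\ i) (be / a i :: bs)) //=; first last.
  - by move=> j k /setD1P [_ jA] /setD1P [_ kA]; apply: dA.
  - move: pA; rewrite (big_setD1 i) //= !big_cons => pA.
    by apply: (mulfI (a0 i)); rewrite pA /be; field.
  - by move: cA; rewrite (cardsD1 i) iA => -[].
  - by rewrite mulf_neq0 ?invr_neq0.
  apply: eq_big => [k|k /andP [kA ki]]; first by rewrite in_setD1 andbC.
  rewrite big_cons [X in _ / X](bigD1 i) ?iA 1?eq_sym //=.
  have -> : \prod_(j in A :\ i | j != k) th (a k / a j) =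
      \prod_(i0 | ((i0 \in A) && (i0 != k)) && (i0 != i)) th (a k / a i0).
    by apply: eq_bigl => j; rewrite in_setD1 [in RHS]andbC andbA.
  have -> : a k / (be / a i) = a k * a i / be by field; rewrite a0 be0.
  by rewrite -(mulrA (th (a k / a i))) [(th _ * _)^-1]invfM mulrACA divff ?mul1r // dA.
(* Weierstrass will be divided by [th (a i * a j / be)]. If this vanishes for [j] and also for a
   third point [k], then [th_div0] yields [th (a j / a k) = 0], against separation. *)
have [i [j [iA jA ij nz]]] : exists i j, [/\ i \in A, j \in A, i != j &
    (bs == [::]) || (th (a i * a j / be) != 0)].
  have : (1 < #|A|)%N by rewrite cA.
  case/card_gt1P => i [j [iA jA ij]].
  have [bsn|bsn] := eqVneq bs [::]; first by exists i, j; split.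
  have : (0 < #|A :\ i :\ j|)%N.
    move: cA; rewrite (cardsD1 i) (cardsD1 j (A :\ i)) iA in_setD1 eq_sym ij jA.
    rewrite /= !add1n => -[->]; by case: (bs) bsn.
  case/card_gt0P => k; rewrite !in_setD1 => /and3P [kj ki kA].
  have [E|?] := eqVneq (th (a i * a j / be)) 0; last by exists i, j; split.
  exists i, k; split => //; first by rewrite eq_sym.
  apply/negP => /eqP E'; have := dA _ _ jA kA; rewrite eq_sym => /(_ kj) /negP; apply.
  have -> : a j / a k = (a i * a j / be) / (a i * a k / be).
    by field; rewrite !a0 be0.
  by rewrite th_div0 // !(mulf_neq0, invr_neq0).
(* With two points [a i * a j = be], so that division is impossible; here the two terms cancel by
   inversion. *)
have [bsn|bsn] := eqVneq bs [::].
  move: cA pA; rewrite bsn => cA.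
  have -> : A = [set i; j].
    apply/esym/eqP; rewrite eqEcard finset.subUset !finset.sub1set iA jA cards2 ij cA //.
  rewrite !big_cons !big_nil mulr1 => pA.
  rewrite !(big_setU1 _ (A := [set j])) ?finset.in_set1 //= !finset.big_set1 in pA *.
  rewrite !big_cons !big_nil !mulr1.
  rewrite (_ : \prod_(k in [set i; j] | k != i) th (a i / a k) = th (a i / a j)); last first.
    rewrite (big_pred1 j) // => k; rewrite !inE.
    by have [->|ki] := eqVneq k i; rewrite ?andbF //= ?andbT // (negbTE ij).
  rewrite (_ : \prod_(k in [set i; j] | k != j) th (a j / a k) = th (a j / a i)); last first.
    rewrite (big_pred1 i) // => k; rewrite !inE.
    by have [->|ki] := eqVneq k j; rewrite ?andbF //= ?andbT ?orbF // eq_sym (negbTE ij).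
  have E1 : a j / b1 = (a i / b2)^-1.
    by rewrite invf_div; apply/eqP; rewrite eqr_div // mulrC pA mulrC.
  have E2 : a j / b2 = (a i / b1)^-1.
    by rewrite invf_div; apply/eqP; rewrite eqr_div // mulrC pA.
  have E3 : a j / a i = (a i / a j)^-1 by rewrite invf_div.
  rewrite E1 E2 E3 !thV ?mulf_neq0 ?invr_neq0 //.
  have t0 : th (a i / a j) != 0 by apply: dA.
  have E4 : a j = b1 * b2 / a i by rewrite -pA; field.
  move: t0; move: (th (a i / a j)) (th (a i / b1)) (th (a i / b2)) => t u v t0.
  by rewrite E4; field; rewrite oppr_eq0 !mulf_neq0 ?a0 ?b10 ?b20 ?t0.
have {}nz : th (a i * a j / be) != 0 by move: nz; rewrite (negbTE bsn).
have tij : th (a i / a j) != 0 by apply: dA.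
(* The coefficients come from [weierstrass] at [u = b1], [v = a i], [w = a j], where [x * b1 / be]
   is [x / b2]. *)
pose al := th (b1 / a j) * th (b1 * a j / be) /
  (b1 / a i * (th (a i / a j) * th (a i * a j / be))).
pose ga := th (b1 / a i) * th (b1 * a i / be) /
  (b1 / a i * (th (a i / a j) * th (a i * a j / be))).
have key x : x != 0 -> th (x / b1) * th (x / b2) =
    al * (th (x / a i) * th (x * a i / be)) - ga * (th (x / a j) * th (x * a j / be)).
  move=> x0; have := weierstrass be0 x0 b10 (a0 i) (a0 j).
  have -> : x * b1 / be = x / b2 by rewrite /be; field; rewrite b10 b20.
  rewrite /al /ga; move: nz tij.
  move: (th (a i / a j)) (th (a i * a j / be)) => t t' nz tij E.
  have d0 : b1 / a i * (t' * t) != 0 by rewrite !mulf_neq0 ?invr_neq0.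
  apply: (mulfI d0); rewrite mulrBr !mulrA.
  transitivity (b1 / a i * (th (x / b1) * th (x / b2)) * (t * t')); first by ring.
  by rewrite E; field; rewrite !a0 b10 nz tij.
under eq_bigr => k kA do rewrite !big_cons mulrA key // mulrBl -!mulrA mulrBl -!mulrA.
rewrite big_split /= sumrN -!mulr_sumr.
have E i' : i' \in A -> \sum_(k in A)
     th (a k / a i') * (th (a k * (a i' / be)) * ((\prod_(b <- bs) th (a k / b)) /
        \prod_(i0 in A | i0 != k) th (a k / a i0))) = 0.
  by move=> /step; under eq_bigr => k _ do rewrite -!mulrA.
rewrite !E // !mulr0 subr0 //.
Qed.

Definition fcons (m : nat) (x0 : F) (x : 'I_m -> F) : 'I_m.+1 -> F :=
  fun i => oapp x x0 (unlift ord0 i).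

Lemma fcons0 m x0 (x : 'I_m -> F) : fcons x0 x ord0 = x0.
Proof. by rewrite /fcons unlift_none. Qed.

Lemma fconsS m x0 (x : 'I_m -> F) i : fcons x0 x (lift ord0 i) = x i.
Proof. by rewrite /fcons liftK. Qed.

Lemma prod_ord_neq0 m (G : 'I_m.+1 -> F) :
  \prod_(j | j != ord0) G j = \prod_(j < m) G (lift ord0 j).
Proof. by rewrite big_mkcond big_ord_recl eqxx /= mul1r; apply: eq_bigr. Qed.

Lemma prod_ord_neqS m (G : 'I_m.+1 -> F) (i : 'I_m) :
  \prod_(j | j != lift ord0 i) G j = G ord0 * \prod_(j | j != i) G (lift ord0 j).
Proof.
rewrite big_mkcond big_ord_recl /=; congr (_ * _); rewrite [RHS]big_mkcond.
by apply: eq_bigr => j _; rewrite (inj_eq (@lift_inj _ ord0)).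
Qed.

Lemma th_div_sym x y : x != 0 -> y != 0 -> (th (x / y) != 0) = (th (y / x) != 0).
Proof.
move=> x0 y0; rewrite -[x / y]invf_div thV ?mulf_neq0 ?invr_neq0 //.
by rewrite oppr_eq0 mulf_eq0 invr_eq0 (negbTE (mulf_neq0 _ _)) ?invr_neq0 ?orbF.
Qed.

Lemma partial_fractions_cons m x0 (x : 'I_m -> F) (bs : seq F) :
  x0 != 0 -> (forall i, x i != 0) -> all (predC1 0) bs -> size bs = m.+1 ->
  x0 * \prod_i x i = \prod_(b <- bs) b ->
  (forall i, th (x0 / x i) != 0) ->
  (forall i j, i != j -> th (x i / x j) != 0) ->
  \sum_i \prod_(b <- bs) th (x i / b) /
         (th (x i / x0) * \prod_(j | j != i) th (x i / x j)) =
  - (\prod_(b <- bs) th (x0 / b) / \prod_i th (x0 / x i)).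
Proof.
move=> x00 xn0 bs0 sz px d0 dx.
have := @partial_fractions _ (fcons x0 x) [set: 'I_m.+1] bs.
have big_all (R : Type) (idx : R) op (G : 'I_m.+1 -> R) P :
    \big[op/idx]_(i in [set: 'I_m.+1] | P i) G i = \big[op/idx]_(i | P i) G i.
  by apply: eq_bigl => i; rewrite finset.in_setT.
have big_all' (R : Type) (idx : R) op (G : 'I_m.+1 -> R) :
    \big[op/idx]_(i in [set: 'I_m.+1]) G i = \big[op/idx]_i G i.
  by apply: eq_bigl => i; rewrite finset.in_setT.
rewrite !big_all' cardsT card_ord => /(_ _ bs0 (esym sz)) H.
have {}H : \sum_(k < m.+1) \prod_(b <- bs) th (fcons x0 x k / b) /
   \prod_(j | j != k) th (fcons x0 x k / fcons x0 x j) = 0.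
  rewrite -[RHS]H; first by apply: eq_bigr => k _; rewrite big_all.
  - by move=> i; case: (unliftP ord0 i) => [j|] ->; rewrite ?fcons0 ?fconsS.
  - rewrite big_ord_recl fcons0 -px; congr (_ * _).
    by apply: eq_bigr => i _; rewrite fconsS.
  - move=> i j _ _; case: (unliftP ord0 i) => [i'|] ->;
      case: (unliftP ord0 j) => [j'|] ->; rewrite ?fcons0 ?fconsS ?eqxx //.
      by rewrite (inj_eq (@lift_inj _ ord0)); apply: dx.
    by rewrite th_div_sym.
apply/eqP; rewrite -subr_eq0 opprK addrC; apply/eqP; rewrite -[RHS]H.
rewrite big_ord_recl fcons0 prod_ord_neq0; congr (_ / _ + _).
  by apply: eq_bigr => i _; rewrite fconsS.
apply: eq_bigr => i _; rewrite prod_ord_neqS fcons0 fconsS.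
by congr (_ / (_ * _)); apply: eq_bigr => j _; rewrite fconsS.
Qed.

(** The two distinguished points will be [1/f] and [1/g]; they are the source of the two terms of
    the recursion. *)
Lemma partial_fractions_cons2 m x0 x1 (x : 'I_m -> F) (bs : seq F) :
  x0 != 0 -> x1 != 0 -> (forall i, x i != 0) -> all (predC1 0) bs ->
  size bs = m.+2 -> x0 * x1 * \prod_i x i = \prod_(b <- bs) b ->
  th (x0 / x1) != 0 -> (forall i, th (x0 / x i) != 0) ->
  (forall i, th (x1 / x i) != 0) ->
  (forall i j, i != j -> th (x i / x j) != 0) ->
  \sum_i \prod_(b <- bs) th (x i / b) /
         (th (x i / x0) * th (x i / x1) * \prod_(j | j != i) th (x i / x j)) =
  - (\prod_(b <- bs) th (x0 / b) / (th (x0 / x1) * \prod_i th (x0 / x i)))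
  - (\prod_(b <- bs) th (x1 / b) / (th (x1 / x0) * \prod_i th (x1 / x i))).
Proof.
move=> x00 x10 xn0 bs0 sz px d01 d0 d1 dx.
have := @partial_fractions_cons m.+1 x0 (fcons x1 x) bs x00.
rewrite !big_ord_recl !fcons0 => H.
have {}H := H _ bs0 sz.
have : \prod_(b <- bs) th (x1 / b) / (th (x1 / x0) * \prod_i th (x1 / x i)) +
  \sum_i \prod_(b <- bs) th (x i / b) /
         (th (x i / x0) * th (x i / x1) * \prod_(j | j != i) th (x i / x j)) =
  - (\prod_(b <- bs) th (x0 / b) / (th (x0 / x1) * \prod_i th (x0 / x i))).
  have -> : \prod_i th (x0 / x i) = \prod_i th (x0 / fcons x1 x (lift ord0 i)).
    by apply: eq_bigr => i _; rewrite fconsS.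
  rewrite -H.
  - congr (_ + _).
      rewrite prod_ord_neq0; congr (_ / (_ * _)).
      by apply: eq_bigr => i _; rewrite fconsS.
    apply: eq_bigr => i _; rewrite prod_ord_neqS fcons0 fconsS mulrA.
    by congr (_ / (_ * _)); apply: eq_bigr => j _; rewrite fconsS.
  - by move=> i; case: (unliftP ord0 i) => [j|] ->; rewrite ?fcons0 ?fconsS.
  - rewrite -px mulrA; congr (_ * _).
    by apply: eq_bigr => i _; rewrite fconsS.
  - by move=> i; case: (unliftP ord0 i) => [j|] ->; rewrite ?fcons0 ?fconsS.
  - move=> i j; case: (unliftP ord0 i) => [i'|] ->;
      case: (unliftP ord0 j) => [j'|] ->; rewrite ?fcons0 ?fconsS ?eqxx //.
      by rewrite (inj_eq (@lift_inj _ ord0)); apply: dx.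
    by rewrite th_div_sym.
by move=> <-; rewrite addrAC addrN add0r.
Qed.

(** * Terms of the symmetric sum and their two-term recursion *)

Variable q : F.

Definition poch a k := \prod_(0 <= i < k) th (a * q ^+ i).

Definition vdm m (z : 'I_m -> F) :=
  \prod_(j < m) \prod_(k < m | (j < k)%N) (z j * th (z k / z j)).

(** Only the pairs containing [i] change, and inversion gives a pair with [i] in first place the
    same quotient as one with [i] in second place. *)
Lemma vdm_step m (x x' : 'I_m -> F) (i : 'I_m) :
  q != 0 -> (forall l, x l != 0) -> (forall l, l != i -> th (x i / x l) != 0) ->
  (forall l, l != i -> x' l = x l) -> x' i = q * x i ->
  vdm x' = vdm x * \prod_(l | l != i) (th (q * x i / x l) / th (x i / x l)).
Proof.
move=> q0 x0 d x'l x'i; rewrite /vdm.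
pose r l := th (q * x i / x l) / th (x i / x l).
have E (j k : 'I_m) : (j < k)%N -> x' j * th (x' k / x' j) = x j * th (x k / x j) *
    ((if k == i then r j else 1) * (if j == i then r k else 1)).
  move=> jk.
  have [ki|ki] := eqVneq k i.
    have ji : j != i by apply/eqP => E; move: jk; rewrite E ki ltnn.
    rewrite (negbTE ji) ki x'i x'l // mulr1 /r -[RHS]mulrA; congr (_ * _).
    by rewrite [RHS]mulrC divfK // d.
  have [ji|nji] := eqVneq j i; last by rewrite !x'l // !mulr1.
  rewrite mul1r ji x'i x'l // /r.
  rewrite -[x k / (q * x i)]invf_div -[x k / x i]invf_div !thV ?mulf_neq0 ?invr_neq0 //.
  by have := d _ ki; move: (th _) (th _) => u v v0; field; rewrite ?q0 ?x0 ?v0.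

transitivity (\prod_(j < m) ((\prod_(k < m | (j < k)%N) (x j * th (x k / x j))) *
    ((\prod_(k < m | (j < k)%N) (if k == i then r j else 1)) *
     (\prod_(k < m | (j < k)%N) (if j == i then r k else 1))))).
  apply: eq_bigr => j _; rewrite -!big_split /=.
  by apply: eq_bigr => k jk; rewrite E.
rewrite !big_split /=; congr (_ * _).
rewrite -[RHS]big_split /= [RHS](bigID (fun l : 'I_m => (l < i)%N)) /=; congr (_ * _).
  rewrite big_mkcond [RHS]big_mkcond; apply: eq_bigr => j _.
  rewrite -big_mkcondr /=.
  have [ji|ji] := ltnP j i; last first.
    rewrite andbF big1 // => k /andP [jk /eqP E'].
    by move: jk; rewrite E' ltnNge ji.
  rewrite andbT -val_eqE /= (ltn_eqF ji) /= (big_pred1 i) // => k.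
  by rewrite /= andb_idl // => /eqP ->.
rewrite (bigD1 i) //= [X in _ * X]big1 ?mulr1; last first.
  by move=> j ji; apply: big1 => k _; rewrite (negbTE ji).
rewrite eqxx; apply: eq_bigl => k; rewrite -leqNgt ltn_neqAle -val_eqE /= eq_sym.
by [].
Qed.

Lemma pochS a k : poch a k.+1 = poch a k * th (a * q ^+ k).
Proof. by rewrite /poch big_nat_recr. Qed.

Lemma poch0 a : poch a 0 = 1.
Proof. by rewrite /poch big_geq. Qed.

Lemma pochSl a k : poch a k.+1 = th a * poch (a * q) k.
Proof.
rewrite /poch big_nat_recl // mulr1; congr (_ * _).
by apply: eq_bigr => i _; rewrite -mulrA -exprS.
Qed.

Lemma poch_shift a k : poch (a * q) k * th a = poch a k * th (a * q ^+ k).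
Proof. by rewrite mulrC -pochSl pochS. Qed.

Definition shiftq m (z : 'I_m -> F) (k : 'I_m -> nat) := fun i => z i * q ^+ k i.

(* With [z] extended by [w = (a q^N)^-1] and [k] by [N - |k|], this is the
   general term of the sums of the theorem, up to a factor independent of [k]:
   see [wterm_sterm]. *)
Definition wterm m (z : 'I_m -> F) (Bs : seq F) (f g : F) (k : 'I_m -> nat) :=
  vdm (shiftq z k) / vdm z *
  \prod_i (\prod_(B <- Bs) poch (B * z i) (k i) /
     (poch (f * z i) (k i) * poch (g * z i) (k i) *
      \prod_j poch (q * z i / z j) (k i))).

Hypothesis q0 : q != 0.

Lemma shiftq_neq0 m (z : 'I_m -> F) k : (forall i, z i != 0) ->
  forall i, shiftq z k i != 0.
Proof. by move=> z0 i; rewrite mulf_neq0 ?expf_neq0. Qed.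

Lemma shiftq_sep m (z : 'I_m -> F) (k : 'I_m -> nat) N :
  (forall i, z i != 0) -> (forall i, (k i <= N)%N) ->
  (forall i l d, (d <= N)%N -> i != l -> th (z i * q ^+ d / z l) != 0) ->
  forall i l, i != l -> th (shiftq z k i / shiftq z k l) != 0.
Proof.
move=> z0 kN dz i l il; rewrite /shiftq.
wlog kil : i l il / (k l <= k i)%N => [H|].
  have [|/ltnW] := leqP (k l) (k i); first exact: H.
  rewrite th_div_sym ?mulf_neq0 ?expf_neq0 //; apply: H.
  by rewrite eq_sym.
have -> : z i * q ^+ k i / (z l * q ^+ k l) = z i * q ^+ (k i - k l) / z l.
  rewrite -{1}(subnK kil) exprD; field; rewrite z0 expf_neq0 //.
by apply: dz => //; apply: leq_trans (leq_subr _ _) (kN i).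
Qed.

Lemma wterm_step m (z : 'I_m -> F) Bs f g (k k' : 'I_m -> nat) i :
  (forall i, z i != 0) ->
  (forall l, l != i -> th (shiftq z k i / shiftq z k l) != 0) ->
  k' i = (k i).+1 -> (forall l, l != i -> k' l = k l) ->
  wterm z Bs f g k' = wterm z Bs f g k *
    \prod_(l | l != i) (th (q * shiftq z k i / shiftq z k l) /
                        th (shiftq z k i / shiftq z k l)) *
    (\prod_(B <- Bs) th (B * shiftq z k i) /
      (th (f * shiftq z k i) * th (g * shiftq z k i) *
       \prod_l th (q * shiftq z k i / z l))).
Proof.
move=> z0 dx k'i k'l; rewrite /wterm.
rewrite (@vdm_step _ (shiftq z k) (shiftq z k') i) //; first last.
- by rewrite /shiftq k'i exprS mulrCA.
- by move=> l li; rewrite /shiftq k'l.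
- exact: shiftq_neq0.
set V := vdm _; set P := \prod_(l | _) _; set V0 := vdm z.
rewrite [in LHS](bigD1 i) //= [in RHS](bigD1 i) //= k'i.
under [X in _ * (_ * X) = _]eq_bigr => l li do rewrite k'l //.
have E (J : Type) (r : seq J) (h : J -> F) : \prod_(c <- r) poch (h c) (k i).+1 =
  \prod_(c <- r) poch (h c) (k i) * \prod_(c <- r) th (h c * q ^+ k i).
  by rewrite -big_split /=; apply: eq_bigr => c _; rewrite pochS.
rewrite !E !pochS.
have -> : \prod_l th (q * shiftq z k i / z l) = \prod_l th (q * z i / z l * q ^+ k i).
  by apply: eq_bigr => l _; congr th; rewrite /shiftq mulrA mulrAC.
have -> : \prod_(B <- Bs) th (B * shiftq z k i) = \prod_(B <- Bs) th (B * z i * q ^+ k i).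
  by apply: eq_bigr => l _; rewrite /shiftq mulrA.
rewrite /shiftq !(mulrA _ (z i)) !invfM.
by ring.
Qed.

(** Makes the terms of both shifted sums of the recursion multiples of one unshifted term. *)
Lemma wterm_shift m (z : 'I_m -> F) b Bs f g (k : 'I_m -> nat) :
  (forall l, th (b * z l) != 0) -> (forall l, th (f * z l) != 0) ->
  (forall l, th (f * shiftq z k l) != 0) ->
  wterm z (b * q :: Bs) (f * q) g k = wterm z (b :: Bs) f g k *
    (\prod_l th (b * shiftq z k l) / \prod_l th (b * z l)) *
    (\prod_l th (f * z l) / \prod_l th (f * shiftq z k l)).
Proof.
move=> b0 f0 fx0; rewrite /wterm -2!(mulrA (_ / vdm z)); congr (_ * _).
rewrite -mulrA -!prodf_div.
rewrite -!big_split /=; apply: eq_bigr => l _.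
rewrite !big_cons.
have E c : th (c * z l) != 0 ->
    poch (c * q * z l) (k l) = poch (c * z l) (k l) * (th (c * shiftq z k l) / th (c * z l)).
  move=> c0; apply: (mulIf c0); rewrite mulrA divfK // [c * q * _]mulrAC poch_shift.
  by rewrite /shiftq mulrA.
rewrite !E // !invfM invrK; ring.
Qed.

Lemma wterm_shift_sym m (z : 'I_m -> F) Bs f g k : wterm z Bs f g k = wterm z Bs g f k.
Proof.
rewrite /wterm; congr (_ * _); apply: eq_bigr => i _.
by rewrite [poch (f * _) _ * _]mulrC.
Qed.

Lemma prod_shiftq m (z : 'I_m -> F) k c :
  \prod_l (c * shiftq z k l) = \prod_l (c * z l) * q ^+ (\sum_l k l)%N.
Proof.
rewrite (big_morph _ (exprD q) (expr0 q)) -big_split /=.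
by apply: eq_bigr => l _; rewrite mulrA.
Qed.

Lemma prod_thV m (z : 'I_m -> F) c : c != 0 -> (forall i, z i != 0) ->
  \prod_l th (c^-1 / z l) = \prod_l th (c * z l) / \prod_l (- c * z l).
Proof.
move=> c0 z0; rewrite -prodf_div; apply: eq_bigr => l _.
rewrite -invfM thV ?mulf_neq0 // mulNr.
by rewrite invrN mulrN mulrC.
Qed.

(** Partial fractions at the points [1/b] and [x_i = z_i q^(y_i)], with zeros [q^N/b] and [z_l].
    Divided by the right-hand side, the summands are weights of total 1, and the weight of [i]
    contains [th (x_i / z_i)], which vanishes when [y i = 0]: in the part of weight [i] the entry
    [y i] can therefore be lowered. *)
Lemma wterm_weights m (z : 'I_m -> F) b N (y : 'I_m -> nat) :
  (forall i, z i != 0) -> b != 0 -> (\sum_i y i)%N = N ->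
  (forall i l, i != l -> th (shiftq z y i / shiftq z y l) != 0) ->
  (forall i, th (b * shiftq z y i) != 0) ->
  \sum_i (\prod_l th (shiftq z y i / z l) * th (b / q ^+ N * shiftq z y i)) /
     (th (b * shiftq z y i) * \prod_(j | j != i) th (shiftq z y i / shiftq z y j)) =
  th (q ^+ N) * \prod_l th (b * z l) / \prod_l th (b * shiftq z y l).
Proof.
move=> z0 b0 yN dx bx.
have x0 := shiftq_neq0 y z0; set x := shiftq z y in x0 dx bx *.
have Q0 : q ^+ N != 0 by rewrite expf_neq0.
have := @partial_fractions_cons _ b^-1 x (q ^+ N / b :: [seq z l | l <- enum 'I_m]).
have big_map (h : F -> F) : \prod_(c <- [seq z l | l <- enum 'I_m]) h c = \prod_l h (z l).
  by rewrite big_map big_enum.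
rewrite big_cons (big_map id) invr_eq0 => /(_ b0 x0) H.
transitivity (\sum_i \prod_(b0 <- (q ^+ N / b :: [seq z l | l <- enum 'I_m])) th (x i / b0) /
    (th (x i / b^-1) * \prod_(j | j != i) th (x i / x j))).
  apply: eq_bigr => i _; rewrite big_cons big_map invrK [x i * b]mulrC.
  have -> : x i / (q ^+ N / b) = b / q ^+ N * x i by field; rewrite b0 Q0.
  by rewrite [X in X / _]mulrC.
rewrite H //.
- rewrite big_cons big_map.
  have -> : b^-1 / (q ^+ N / b) = (q ^+ N)^-1 by field; rewrite b0 Q0.
  rewrite thV // !prod_thV // prod_shiftq yN.
  have P0 : \prod_l (- b * z l) != 0.
    by apply/prodf_neq0 => l _; rewrite mulf_neq0 ?oppr_eq0.
  have P1 : \prod_l th (b * x l) != 0 by apply/prodf_neq0.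
  by field; rewrite Q0 P0 P1.
- rewrite /= mulf_neq0 ?invr_neq0 //=; apply/allP => c /mapP [l _ ->] /=; exact: z0.
- by rewrite /= size_map size_enum_ord.
- have := prod_shiftq z y 1; rewrite yN.
  under eq_bigr => l _ do rewrite mul1r.
  under [\prod_l (1 * _)]eq_bigr => l _ do rewrite mul1r.
  by rewrite -/x => ->; ring.
- move=> i; rewrite th_div_sym ?invr_eq0 // invrK mulrC; exact: bx.
Qed.

(** Partial fractions at [1/f], [1/g] and the [x_i], with zeros [q^N/b] and [1/B]; the relation
    between [f * g] and the other parameters is exactly the balance of the two products. *)
Lemma wterm_residues m (z : 'I_m -> F) b Bs f g N (k : 'I_m -> nat) :
  (forall i, z i != 0) -> b != 0 -> f != 0 -> g != 0 -> all (predC1 0) Bs ->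
  size Bs = m.+1 ->
  f * g = b * \prod_(B <- Bs) B * \prod_i z i ->
  (\sum_i k i)%N = N ->
  (forall i l, i != l -> th (shiftq z k i / shiftq z k l) != 0) ->
  (forall i, th (f * shiftq z k i) != 0) ->
  (forall i, th (g * shiftq z k i) != 0) ->
  th (f / g) != 0 ->
  \sum_i (\prod_(B <- Bs) th (B * shiftq z k i) * th (b / q ^+ N * shiftq z k i)) /
     (th (f * shiftq z k i) * th (g * shiftq z k i) *
      \prod_(j | j != i) th (shiftq z k i / shiftq z k j)) =
  - (\prod_(B <- Bs) th (B / f) * th (b / q ^+ N / f) / th (g / f) *
       (\prod_i (- f * z i) * q ^+ N) / \prod_i th (f * shiftq z k i))
  - (\prod_(B <- Bs) th (B / g) * th (b / q ^+ N / g) / th (f / g) *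
       (\prod_i (- g * z i) * q ^+ N) / \prod_i th (g * shiftq z k i)).
Proof.
move=> z0 b0 f0 g0 Bs0 sz bal kN dx fx gx fg.
have x0 := shiftq_neq0 k z0; set x := shiftq z k in x0 dx fx gx *.
have Q0 : q ^+ N != 0 by rewrite expf_neq0.
have := @partial_fractions_cons2 _ f^-1 g^-1 x (q ^+ N / b :: [seq B^-1 | B <- Bs]).
rewrite !invr_eq0 => /(_ f0 g0 x0) H.
transitivity (\sum_i \prod_(c <- (q ^+ N / b :: [seq B^-1 | B <- Bs])) th (x i / c) /
    (th (x i / f^-1) * th (x i / g^-1) * \prod_(j | j != i) th (x i / x j))).
  apply: eq_bigr => i _; rewrite big_cons big_map !invrK ![x i * _]mulrC.
  have -> : (q ^+ N / b)^-1 * x i = b / q ^+ N * x i by field; rewrite b0 Q0.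
  rewrite [X in X / _]mulrC; congr (_ * _ / _).
  by apply: eq_bigr => B _; rewrite invrK mulrC.
have side c : \prod_(c' <- [seq B^-1 | B <- Bs]) th (c^-1 / c') = \prod_(B <- Bs) th (B / c).
  by rewrite big_map; apply: eq_bigr => B _; rewrite invrK mulrC.
have qb c : c != 0 -> c^-1 / (q ^+ N / b) = b / q ^+ N / c.
  by move=> c0; field; rewrite c0 b0 Q0.
rewrite H //.
- rewrite !big_cons !side !prod_thV // !prod_shiftq kN !qb // !invrK ![_^-1 * _]mulrC.
  rewrite !invfM !invrK.
  by congr (- _ - _); ring.
- rewrite /= mulf_neq0 ?invr_neq0 //=; apply/allP => c /mapP [l lB ->] /=.
  by rewrite invr_eq0; move/allP: Bs0 => /(_ _ lB).
- by rewrite /= size_map sz.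
- have := prod_shiftq z k 1; rewrite kN.
  under eq_bigr => l _ do rewrite mul1r.
  under [\prod_l (1 * _)]eq_bigr => l _ do rewrite mul1r.
  rewrite -/x => ->; rewrite big_cons big_map prodfV -invfM bal.
  have P0 : \prod_(B <- Bs) B != 0.
    by rewrite prodf_seq_neq0; apply: sub_all Bs0.
  have Z0 : \prod_i z i != 0 by apply/prodf_neq0.
  by field; rewrite b0 P0 Z0.
- by rewrite invrK mulrC th_div_sym.
- by move=> i; rewrite th_div_sym ?invr_eq0 // invrK mulrC; exact: fx.
- by move=> i; rewrite th_div_sym ?invr_eq0 // invrK mulrC; exact: gx.
Qed.

(** The bound [K] on the entries is separate from the total [N], so that the index type stays fixed
    while [N] decreases. *)
Definition wsum K N m (z : 'I_m -> F) Bs f g :=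
  \sum_(y : {ffun 'I_m -> 'I_K.+1} | (\sum_i y i == N)%N)
    wterm z Bs f g (fun i => y i).

Lemma sum_comp_step K N m (i : 'I_m) (G : {ffun 'I_m -> 'I_K.+1} -> F) : (N < K)%N ->
  (forall y : {ffun 'I_m -> 'I_K.+1}, y i = 0%N :> nat -> G y = 0) ->
  \sum_(y : {ffun 'I_m -> 'I_K.+1} | (\sum_i y i == N.+1)%N) G y =
  \sum_(y : {ffun 'I_m -> 'I_K.+1} | (\sum_i y i == N)%N)
     G [ffun j => if j == i then inord (y i).+1 else y j].
Proof.
move=> NK G0.
pose inc (y : {ffun 'I_m -> 'I_K.+1}) := [ffun j => if j == i then inord (y i).+1 else y j].
pose dec (y : {ffun 'I_m -> 'I_K.+1}) : {ffun 'I_m -> 'I_K.+1} :=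
  [ffun j => if j == i then inord (y i).-1 else y j].
have sumD1 (y : {ffun 'I_m -> 'I_K.+1}) :
  (\sum_j y j = y i + \sum_(j | j != i) y j)%N by rewrite (bigD1 i).
rewrite (bigID (fun y : {ffun 'I_m -> 'I_K.+1} => y i == 0%N :> nat)) /=.
rewrite big1 ?add0r; last by move=> y /andP [_ /eqP]; exact: G0.
rewrite (reindex_onto inc dec) /=; last first.
  move=> y /andP [_ y0]; apply/ffunP => j; rewrite !ffunE eqxx.
  have [->|//] := eqVneq j i; rewrite (inordK (leq_ltn_trans (leq_pred _) (ltn_ord _))).
  by rewrite prednK ?lt0n // inord_val.
apply: eq_bigl => y; rewrite !sumD1 !ffunE eqxx.
rewrite [X in (_ + X)%N](eq_bigr (fun j => val (y j))); last first.
  by move=> j /negbTE ji; rewrite ffunE ji.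
have [yK|yK] := ltnP (y i) K.
  rewrite inordK // addSn eqSS andbT; apply: andb_idr => _.
  apply/eqP/ffunP => j; rewrite !ffunE eqxx.
  have [->|//] := eqVneq j i.
  by apply/val_inj; rewrite /= !inordK //= ltnS ltnW.
(* Here [y i = K]. The total [N < K] excludes this on the right; on the left [inord] of [K.+1] falls
   back to [ord0], which is excluded there. *)
have -> : (y i + \sum_(j | j != i) y j == N)%N = false.
  by apply/negbTE; rewrite eqn_leq negb_and -!ltnNge (leq_trans NK (leq_trans yK (leq_addr _ _))).
have yi : y i = K :> nat by apply/eqP; rewrite eqn_leq yK -ltnS ltn_ord.
rewrite (_ : (inord (y i).+1 : 'I_K.+1) = ord0) ?andbF //.
by rewrite yi /inord /insubd insubN ?ltnn.
Qed.

Definition wcoef m (z : 'I_m -> F) b Bs f g N :=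
  \prod_(B <- Bs) th (B / f) * th (b / q ^+ N / f) / th (g / f) *
  (\prod_i (- f * z i) * q ^+ N) / (th (q ^+ N.+1) * \prod_i th (f * z i)).

(** Each term is split by the weights of [wterm_weights], the part of weight [i] is reindexed by
    lowering the entry [i], and the parts that meet at one composition are summed again by
    [wterm_residues]. *)
Lemma wsum_rec K N m (z : 'I_m -> F) b Bs f g : (N < K)%N ->
  (forall i, z i != 0) -> b != 0 -> f != 0 -> g != 0 -> all (predC1 0) Bs ->
  size Bs = m.+1 ->
  f * g = b * \prod_(B <- Bs) B * \prod_i z i ->
  th (q ^+ N.+1) != 0 -> th (f / g) != 0 ->
  (forall i l d, (d <= N.+1)%N -> (i != l) || (0 < d)%N -> th (z i * q ^+ d / z l) != 0) ->
  (forall i d, (d <= N.+1)%N -> th (b * z i * q ^+ d) != 0) ->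
  (forall i d, (d <= N.+1)%N -> th (f * z i * q ^+ d) != 0) ->
  (forall i d, (d <= N.+1)%N -> th (g * z i * q ^+ d) != 0) ->
  wsum K N.+1 z (b :: Bs) f g =
  - (wcoef z b Bs f g N * wsum K N z (b * q :: Bs) (f * q) g)
  - (wcoef z b Bs g f N * wsum K N z (b * q :: Bs) f (g * q)).
Proof.
move=> NK z0 b0 f0 g0 Bs0 sz bal tq fg dz dbz dfz dgz.
have dz' : forall i l d, (d <= N.+1)%N -> i != l -> th (z i * q ^+ d / z l) != 0.
  by move=> i l d dN il; apply: dz; rewrite ?il.
pose x (y : {ffun 'I_m -> 'I_K.+1}) := shiftq z (fun i => y i).
have le_sum (y : {ffun 'I_m -> 'I_K.+1}) i : (y i <= \sum_i y i)%N.
  by rewrite (bigD1 i) //= leq_addr.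
have nz c (y : {ffun 'I_m -> 'I_K.+1}) :
    (forall i d, (d <= N.+1)%N -> th (c * z i * q ^+ d) != 0) ->
    (\sum_i y i <= N.+1)%N -> forall i, th (c * x y i) != 0.
  by move=> cz yN i; rewrite /x /shiftq mulrA cz // (leq_trans (le_sum y i)).
have nz0 c : (forall i d, (d <= N.+1)%N -> th (c * z i * q ^+ d) != 0) ->
    forall i, th (c * z i) != 0.
  by move=> cz i; have := cz i 0%N isT; rewrite mulr1.
have sep (y : {ffun 'I_m -> 'I_K.+1}) : (\sum_i y i <= N.+1)%N ->
    forall i l, i != l -> th (x y i / x y l) != 0.
  move=> yN; apply: (@shiftq_sep _ _ _ N.+1) => // i.
  by rewrite (leq_trans (le_sum y i)).
pose D (y : {ffun 'I_m -> 'I_K.+1}) i := wterm z (b :: Bs) f g (fun i => y i) *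
  (\prod_l th (b * x y l) / (th (q ^+ N.+1) * \prod_l th (b * z l))) *
  ((\prod_l th (x y i / z l) * th (b / q ^+ N.+1 * x y i)) /
     (th (b * x y i) * \prod_(j | j != i) th (x y i / x y j))).
rewrite /wsum.
transitivity (\sum_(y : {ffun 'I_m -> 'I_K.+1} | (\sum_i y i == N.+1)%N) \sum_i D y i).
  apply: eq_bigr => y /eqP yN; rewrite /D -mulr_sumr.
  rewrite (wterm_weights z0 b0 yN); first last.
  - by apply: nz; rewrite ?yN.
  - by apply: sep; rewrite yN.
  have P0 : \prod_l th (b * x y l) != 0 by apply/prodf_neq0 => l _; apply: nz; rewrite ?yN.
  have P1 : \prod_l th (b * z l) != 0 by apply/prodf_neq0 => l _; apply: nz0.
  by rewrite -/(x y); field; rewrite P0 P1 tq.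
rewrite exchange_big /=.
under eq_bigr => i _.
  rewrite (@sum_comp_step _ _ _ i) //; last first.
    move=> y yi; rewrite /D [\prod_l th (x y i / z l)](bigD1 i) //=.
    rewrite {2}/x /shiftq yi mulr1 divff // th1.
    by rewrite !mul0r mulr0.
  over.
rewrite exchange_big /= !mulr_sumr -!sumrN -big_split /=.
apply: eq_bigr => k /eqP kN.
have kN' : (\sum_i k i <= N.+1)%N by rewrite kN.
have := @wterm_residues _ z b Bs f g N (fun i => k i) z0 b0 f0 g0 Bs0 sz bal kN
   (sep _ kN') (nz _ _ dfz kN') (nz _ _ dgz kN') fg.
rewrite -/(x k) => res.
rewrite [wterm z (b * q :: Bs) f _ _]wterm_shift_sym.
rewrite !wterm_shift //; try by [apply: nz0 | apply: nz].
rewrite [wterm z _ g f _]wterm_shift_sym -/(x k).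
have Pf0 : \prod_l th (f * z l) != 0 by apply/prodf_neq0 => l _; apply: nz0.
have Pg0 : \prod_l th (g * z l) != 0 by apply/prodf_neq0 => l _; apply: nz0.
have Pfx : \prod_l th (f * x k l) != 0 by apply/prodf_neq0 => l _; apply: nz.
have Pgx : \prod_l th (g * x k l) != 0 by apply/prodf_neq0 => l _; apply: nz.
have Pb0 : \prod_l th (b * z l) != 0 by apply/prodf_neq0 => l _; apply: nz0.
have gf : th (g / f) != 0 by rewrite th_div_sym.
transitivity (wterm z (b :: Bs) f g (fun i => k i) *
  (\prod_l th (b * x k l) / (th (q ^+ N.+1) * \prod_l th (b * z l))) *
  (\sum_i (\prod_(B <- Bs) th (B * x k i) * th (b / q ^+ N * x k i)) /
     (th (f * x k i) * th (g * x k i) *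
      \prod_(j | j != i) th (x k i / x k j)))); last first.
  rewrite res /wcoef.
  by field; rewrite Pf0 Pg0 Pfx Pgx Pb0 gf fg tq.
rewrite mulr_sumr; apply: eq_bigr => i _.
set k' := [ffun j => _]; rewrite /D.
have ki : (k i < K)%N by rewrite (leq_ltn_trans (le_sum k i)) ?kN.
have k'i : k' i = (k i).+1 :> nat by rewrite ffunE eqxx inordK.
have k'l l : l != i -> k' l = k l by move=> /negbTE li; rewrite ffunE li.
rewrite (@wterm_step _ z (b :: Bs) f g (fun i => k i) (fun i => k' i) i) //; first last.
- by move=> l li; rewrite k'l.
- by move=> l li; apply: sep => //; rewrite eq_sym.
have xi : x k' i = q * x k i by rewrite /x /shiftq k'i exprS mulrCA.
have xl l : l != i -> x k' l = x k l by move=> li; rewrite /x /shiftq k'l.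
rewrite -/(x k) [\prod_l th (b * x k' l)](bigD1 i) //= [\prod_l th (b * x k l)](bigD1 i) //=.
rewrite [\prod_(l | l != i) th (b * x k' l)](eq_bigr (fun l => th (b * x k l))); last first.
  by move=> l li; rewrite xl.
rewrite [\prod_(l | l != i) th (x k' i / x k' l)](eq_bigr (fun l => th (q * x k i / x k l))); last first.
  by move=> l li; rewrite (xl l li) xi.
rewrite prodf_div !xi big_cons.
have -> : b / q ^+ N.+1 * (q * x k i) = b / q ^+ N * x k i.
  by rewrite exprS; field; rewrite q0 expf_neq0.
have xne0 := shiftq_neq0 (fun i => k i) z0; rewrite -/(x k) in xne0.
have q1 : th (b * (q * x k i)) != 0.
  have -> : b * (q * x k i) = b * z i * q ^+ (k i).+1 by rewrite /x /shiftq exprS; ring.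
  by apply: dbz; rewrite ltnS -kN le_sum.
have q2 : \prod_l th (q * x k i / z l) != 0.
  apply/prodf_neq0 => l _; have := dz i l (k i).+1; rewrite ltnS orbT -kN le_sum => /(_ isT isT).
  by rewrite exprS mulrCA.
have q3 : \prod_(j | j != i) th (q * x k i / x k j) != 0.
  apply/prodf_neq0 => l li; rewrite -xi -(xl l li).
  apply: sep; last by rewrite eq_sym.
  have -> : (\sum_j k' j = (\sum_j k j).+1)%N; last by rewrite kN.
  rewrite (bigD1 i) //= [in RHS](bigD1 i) //= k'i addSn; congr (_ + _).+1.
  by apply: eq_bigr => j ji; rewrite k'l.
have q4 : \prod_(j | j != i) th (x k i / x k j) != 0.
  by apply/prodf_neq0 => l li; apply: sep => //; rewrite eq_sym.
have q5 : th (f * x k i) != 0 by apply: nz.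
have q6 : th (g * x k i) != 0 by apply: nz.
by field; rewrite q1 q2 q3 q4 q5 q6 tq Pb0.
Qed.

(** * The transformation of symmetric sums *)

Definition q_separated N m (z : 'I_m -> F) := forall i l d,
  (d <= N)%N -> (i != l) || (0 < d)%N -> th (z i * q ^+ d / z l) != 0.

Definition poch_nz N c := forall d, (d <= N)%N -> th (c * q ^+ d) != 0.

Lemma poch_nzS N c : poch_nz N.+1 c -> poch_nz N (c * q).
Proof. by move=> cN d dN; rewrite -mulrA -exprS; apply: cN. Qed.

Lemma poch_nzW N c : poch_nz N.+1 c -> poch_nz N c.
Proof. by move=> cN d dN; apply: cN; apply: leqW. Qed.

(** The quotient of the two symmetric sums. In the theorem [f / e] and [g / e] are [lam * d / a] and
    [lam * c / a], while the symbols of [f * w] and [g * w] are those of [c] and [d] read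
    backwards. *)
Definition bailey_coef w e f g N :=
  (w * e) ^+ N * (poch (f / e) N * poch (g / e) N) / (poch (f * w) N * poch (g * w) N).

Lemma bailey_coef_sym w e f g N : bailey_coef w e f g N = bailey_coef w e g f N.
Proof. by rewrite /bailey_coef [poch (f / e) N * _]mulrC [poch (f * w) N * _]mulrC. Qed.

Lemma prod_fcons n (z : 'I_n -> F) w (h : F -> F) :
  \prod_i h (fcons w z i) = h w * \prod_i h (z i).
Proof.
by rewrite big_ord_recl fcons0; congr (_ * _); apply: eq_bigr => i _; rewrite fconsS.
Qed.

(** The recursion coefficients of the two sides differ only in the factors of [e] and of [w]. Since
    [e' / f = g * w * q ^+ N], and [f * w'] is the inverse of [g / e * q ^+ N], these are the first
    or last factors of the Pochhammer symbols in [bailey_coef]. *)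
Lemma wcoef_bailey n (z : 'I_n -> F) w w' e e' b Bs f g N :
  w != 0 -> w' != 0 -> e != 0 -> e' != 0 -> f != 0 -> g != 0 ->
  w' * (f * g * q ^+ N.+1) = e * q -> e' * q = w * (f * g * q ^+ N.+1) ->
  poch_nz N (f * w) -> poch_nz N (g * w) ->
  poch_nz N (f * w') -> poch_nz N (g * w') ->
  wcoef (fcons w z) b (e :: Bs) f g N * bailey_coef w e (f * q) g N =
  bailey_coef w e f g N.+1 * wcoef (fcons w' z) b (e' :: Bs) f g N.
Proof.
move=> w0 w'0 e0 e'0 f0 g0 Hw' He' nf ng nf' ng'.
have Q0 : q ^+ N != 0 by rewrite expf_neq0.
have {}He' : e' = w * f * g * q ^+ N.
  by apply: (mulIf q0); rewrite He' exprS; ring.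
have {}Hw' : w' = e / (f * g * q ^+ N).
  have D0 : f * g * q ^+ N.+1 != 0 by rewrite !mulf_neq0 ?expf_neq0.
  by apply: (mulIf D0); rewrite Hw' exprS; field; rewrite f0 g0 Q0.
rewrite /wcoef /bailey_coef !(prod_fcons _ _ (fun u => - f * u)).
rewrite !(prod_fcons _ _ (fun u => th (f * u))) !big_cons.
have -> : e' / f = g * w * q ^+ N by rewrite He'; field.
have fe0 : f / e != 0 by rewrite mulf_neq0 ?invr_neq0.
have E1 : th (e / f) = - (th (f / e) / (f / e)) by rewrite -thV // invf_div.
have ge0 : g / e * q ^+ N != 0 by rewrite !mulf_neq0 ?invr_neq0.
have E2 : th (f * w') = - (th (g / e * q ^+ N) / (g / e * q ^+ N)).
  by rewrite -thV // Hw'; congr th; field; rewrite f0 g0 e0 Q0.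
have n1 : th (g / e * q ^+ N) != 0.
  have := nf' 0%N isT; rewrite mulr1 E2 oppr_eq0 mulf_eq0 invr_eq0 (negbTE ge0).
  by rewrite orbF.
have n2 : th (f * w) != 0 by have := nf 0%N isT; rewrite mulr1.
have n3 : th (g * w * q ^+ N) != 0 by apply: ng.
have -> : f * q / e = f / e * q by rewrite mulrAC.
have -> : f * q * w = f * w * q by rewrite mulrAC.
rewrite [poch (f / e) N.+1]pochSl [poch (g / e) N.+1]pochS.
rewrite [poch (f * w) N.+1]pochSl [poch (g * w) N.+1]pochS.
rewrite E1 E2 !invfM !invrN !invfM !invrK Hw' !exprS !invfM.
move: (\prod_i th (f * z i))^-1 (th (q * q ^+ N))^-1 (th (g / f))^-1.
move: (poch (f * w * q) N)^-1 (poch (g * w) N)^-1 => ? ? ? ? ?.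
by field; rewrite e0 f0 g0 Q0 n1 n2 n3.
Qed.

(** Induction on [N] with [b], [f], [g] arbitrary. The condition on [f / g] has two indices because
    [f] and [g] are shifted independently along the recursion. *)
Lemma bailey_wsum K N n (z : 'I_n -> F) w w' e e' b Bs f g : (N <= K)%N ->
  (forall i, z i != 0) -> all (predC1 0) Bs -> size Bs = n.+1 ->
  w != 0 -> w' != 0 -> b != 0 -> e != 0 -> e' != 0 -> f != 0 -> g != 0 ->
  f * g = b * (e * \prod_(B <- Bs) B) * (w * \prod_i z i) ->
  w' * (f * g * q ^+ N) = e * q -> e' * q = w * (f * g * q ^+ N) ->
  (forall d, (0 < d <= N)%N -> th (q ^+ d) != 0) ->
  (forall i j, (i <= N)%N -> (j <= N)%N -> th ((f * q ^+ i) / (g * q ^+ j)) != 0) ->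
  q_separated N (fcons w z) -> q_separated N (fcons w' z) ->
  (forall i, poch_nz N (b * fcons w z i)) -> (forall i, poch_nz N (b * fcons w' z i)) ->
  (forall i, poch_nz N (f * fcons w z i)) -> (forall i, poch_nz N (f * fcons w' z i)) ->
  (forall i, poch_nz N (g * fcons w z i)) -> (forall i, poch_nz N (g * fcons w' z i)) ->
  wsum K N (fcons w z) [:: b, e & Bs] f g =
  bailey_coef w e f g N * wsum K N (fcons w' z) [:: b, e' & Bs] f g.
Proof.
move=> + z0 Bs0 sz w0 w'0 + e0 e'0.
elim: N b f g => [|N IH] b f g NK b0 f0 g0 bal Hw' He' tq fg dz dz' bz bz' fz fz' gz gz'.
  rewrite /bailey_coef expr0 !poch0 !mulr1 divr1 mul1r; apply: eq_bigr => y.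
  rewrite sum_nat_eq0 => /forallP y0; rewrite /wterm.
  have vdmE (u : 'I_n.+1 -> F) : q_separated 0 u -> (forall i, u i != 0) ->
      vdm (shiftq u (fun i => y i)) / vdm u = 1.
    move=> du u0; rewrite /vdm -prodf_div big1 // => j _.
    rewrite -prodf_div big1 // => k jk; rewrite /shiftq !(eqP (y0 _)) !mulr1 divff //.
    rewrite mulf_neq0 //; have := du k j 0%N isT; rewrite orbF mulr1; apply.
    by apply/eqP => E; rewrite E ltnn in jk.
  have fc0 u : u != 0 -> forall i, fcons u z i != 0.
    by move=> u0 i; case: (unliftP ord0 i) => [j|] ->; rewrite ?fcons0 ?fconsS.
  rewrite !vdmE //; try exact: fc0.
  congr (_ * _); apply: eq_bigr => i _; rewrite !(eqP (y0 _)) !poch0.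
  rewrite !big1 // => *; by rewrite poch0.
have z0' u : u != 0 -> forall i, fcons u z i != 0.
  by move=> u0 i; case: (unliftP ord0 i) => [j|] ->; rewrite ?fcons0 ?fconsS.
have tN : th (q ^+ N.+1) != 0 by apply: tq; rewrite ltnSn.
have fgn : th (f / g) != 0 by have := fg 0%N 0%N isT isT; rewrite !mulr1.
have rec u v : u != 0 -> v != 0 -> b * (v * \prod_(B <- Bs) B) * (u * \prod_i z i) = f * g ->
    q_separated N.+1 (fcons u z) -> (forall i, poch_nz N.+1 (b * fcons u z i)) ->
    (forall i, poch_nz N.+1 (f * fcons u z i)) -> (forall i, poch_nz N.+1 (g * fcons u z i)) ->
    wsum K N.+1 (fcons u z) [:: b, v & Bs] f g =
  - (wcoef (fcons u z) b (v :: Bs) f g N * wsum K N (fcons u z) [:: b * q, v & Bs] (f * q) g)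
  - (wcoef (fcons u z) b (v :: Bs) g f N * wsum K N (fcons u z) [:: b * q, v & Bs] f (g * q)).
  move=> u0 v0 balu du bu fu gu; rewrite wsum_rec //=.
  - exact: z0'.
  - by rewrite v0.
  - by rewrite sz.
  - by rewrite big_cons (prod_fcons _ _ id) balu.
(* This makes the balancing condition of the recursion the same on both sides. *)
have we : w' * e' = w * e.
  by apply: (mulIf q0); rewrite -mulrA He' mulrCA Hw' mulrA.
rewrite (rec w e) // (rec w' e') //; last first.
  by rewrite bal; transitivity (b * \prod_(B <- Bs) B * \prod_i z i * (w' * e'));
    [ring | rewrite we; ring].
have NK' : (N <= K)%N by apply: ltnW.
have sepW u : q_separated N.+1 (fcons u z) -> q_separated N (fcons u z).
  by move=> du i l d dN; apply: du; apply: leqW.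
have shiftb c u : (forall i, poch_nz N.+1 (c * fcons u z i)) ->
    forall i, poch_nz N (c * q * fcons u z i).
  by move=> cu i; rewrite mulrAC; apply: poch_nzS.
have keep c u : (forall i, poch_nz N.+1 (c * fcons u z i)) ->
    forall i, poch_nz N (c * fcons u z i).
  by move=> cu i; apply: poch_nzW.
have tq' d : (0 < d <= N)%N -> th (q ^+ d) != 0.
  by move=> /andP [d0 dN]; apply: tq; rewrite d0 leqW.
have at0 c u : (forall i, poch_nz N.+1 (c * fcons u z i)) -> poch_nz N (c * u).
  by move=> /keep /(_ ord0); rewrite fcons0.
rewrite (IH (b * q) (f * q) g) //; first last; try by [apply: shiftb | apply: keep | apply: sepW].
- move=> i j iN jN; rewrite -(mulrA f) -exprS; apply: fg => //; exact: leqW.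
- by rewrite He' exprS; ring.
- by rewrite -Hw' exprS; ring.
- by rewrite mulrAC bal; ring.
- by rewrite mulf_neq0.
- by rewrite mulf_neq0.
rewrite (IH (b * q) f (g * q)) //; first last; try by [apply: shiftb | apply: keep | apply: sepW].
- move=> i j iN jN; rewrite -(mulrA g) -exprS; apply: fg => //; exact: leqW.
- by rewrite He' exprS; ring.
- by rewrite -Hw' exprS; ring.
- by rewrite mulrA bal; ring.
- by rewrite mulf_neq0.
- by rewrite mulf_neq0.
rewrite mulrBr !mulrN; congr (- _ - _).
all: rewrite (mulrA (wcoef _ _ _ _ _ _)) (mulrA (bailey_coef _ _ _ _ N.+1)); congr (_ * _).
  by apply: wcoef_bailey => //; apply: at0.
rewrite bailey_coef_sym [bailey_coef _ _ f g _]bailey_coef_sym.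
by apply: wcoef_bailey; rewrite // ?[g * f]mulrC //; apply: at0.
Qed.

(** * From symmetric sums to the sums of the theorem *)

Definition qtri N := \prod_(0 <= i < N) q ^+ i.+1.

Lemma qtri_neq0 N : qtri N != 0.
Proof. by rewrite /qtri big_mkord; apply/prodf_neq0 => i _; rewrite expf_neq0. Qed.

Lemma qtri_sqr N : qtri N ^+ 2 = (q ^+ N.+1) ^+ N.
Proof.
rewrite -exprM; elim: N => [|N IH]; first by rewrite /qtri big_geq ?expr1n.
rewrite /qtri big_nat_recr //= -/(qtri N) exprMn IH -exprM -exprD.
by congr (q ^+ _); lia.
Qed.

(** What inversion leaves when a Pochhammer symbol is read backwards, see [poch_reflect]; [qtri N]
    is [q^(N(N+1)/2)]. *)
Definition reflect_factor (c : F) N := (- c) ^+ N / qtri N.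

Lemma poch_reflect u M : u != 0 -> poch (u / q ^+ M) M = poch (q / u) M * reflect_factor u M.
Proof.
move=> u0; rewrite /poch /reflect_factor /qtri big_nat_rev /= add0n.
have -> : (- u) ^+ M = \prod_(0 <= i < M) (- u) by rewrite prodr_const_nat subn0.
rewrite -prodf_div -big_split /=; apply: eq_big_nat => i /andP [_ iM].
have Q0 k : q ^+ k != 0 by rewrite expf_neq0.
have -> : u / q ^+ M * q ^+ (M - i.+1) = (q / u * q ^+ i)^-1.
  by rewrite -{1}(subnK iM) exprD exprS; field; rewrite !Q0 q0 u0.
by rewrite thV ?mulf_neq0 ?invr_neq0 // exprS; field; rewrite !Q0 q0 u0.
Qed.

Lemma poch_split u N M : (M <= N)%N ->
  poch u N = poch u (N - M) * poch (u * q ^+ (N - M)) M.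
Proof.
move=> MN; rewrite /poch (@big_cat_nat _ _ _ (N - M)) ?leq_subr //=; congr (_ * _).
rewrite -{1}[(N - M)%N]add0n big_addn subKn //; apply: eq_bigr => i _.
by rewrite addnC exprD mulrA.
Qed.

Lemma vdm_recl m w (z : 'I_m -> F) :
  vdm (fcons w z) = \prod_k (w * th (z k / w)) * vdm z.
Proof.
rewrite /vdm big_ord_recl; congr (_ * _).
  rewrite fcons0 big_mkcond big_ord_recl /= mul1r; apply: eq_bigr => k _.
  by rewrite fconsS.
apply: eq_bigr => j _; rewrite big_mkcond big_ord_recl /= mul1r [RHS]big_mkcond /=.
by apply: eq_bigr => k _; rewrite !fconsS.
Qed.

(** [b ord0] stands first as the parameter shifted by the recursion, [e] second as the one replaced
    by the exchange, to match [[:: b, e & Bs]] in [bailey_wsum]. *)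
Definition numerators n (b : 'I_n.+2 -> F) e : seq F :=
  [:: b ord0, e & [seq b (lift ord0 i) | i <- enum 'I_n.+1]].

Lemma big_numerators n (b : 'I_n.+2 -> F) e (h : F -> F) :
  \prod_(B <- numerators b e) h B = h e * \prod_j h (b j).
Proof. by rewrite !big_cons big_map big_enum mulrCA [in RHS]big_ord_recl. Qed.

(** The right-hand side of the theorem is the instance at [lam], [lam*c/a], [lam*d/a], [lam*e/a],
    because this substitution leaves [a*q/c], [a*q/d] and [a*q/e] invariant. *)
Definition sterm n N (z : 'I_n -> F) (b : 'I_n.+2 -> F) a c d e (y : 'I_n -> nat) :=
  let M := (\sum_k y k)%N in
  vdm (shiftq z y) / vdm z *
  (\prod_(k < n) (th (a * z k * q ^+ (y k + M)) / th (a * z k))) *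
  ((poch (q ^- N) M * poch c M * poch d M * \prod_(j < n) poch (a * z j) M)
   / (poch (a * q / e) M * \prod_(j < n.+2) poch (a * q / b j) M)) *
  q ^+ M *
  \prod_(k < n)
    ((poch (e * z k) (y k) * \prod_(j < n.+2) poch (b j * z k) (y k))
     / (poch (a * q ^+ (1 + N) * z k) (y k) * poch (a * q * z k / c) (y k)
        * poch (a * q * z k / d) (y k) * \prod_(j < n) poch (q * z k / z j) (y k))).

Definition ncons n (u : nat) (y : 'I_n -> nat) : 'I_n.+1 -> nat :=
  fun i => oapp y u (unlift ord0 i).

(** The factor of index 0 in [wterm], for [z_0 = w] with exponent [u], without the Vandermonde part;
    [poch q u] is its diagonal symbol. *)
Definition whead n (z : 'I_n -> F) b e f g w u :=
  (poch (e * w) u * \prod_(j < n.+2) poch (b j * w) u) /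
  (poch (f * w) u * poch (g * w) u * (poch q u * \prod_l poch (q / z l * w) u)).

Lemma wterm_ncons n (z : 'I_n -> F) (b : 'I_n.+2 -> F) e f g w u (y : 'I_n -> nat) :
  w != 0 ->
  wterm (fcons w z) (numerators b e) f g (ncons u y) =
  (\prod_k (w * q ^+ u * th (shiftq z y k / (w * q ^+ u))) * vdm (shiftq z y)) /
  (\prod_k (w * th (z k / w)) * vdm z) *
  (whead z b e f g w u *
   \prod_k ((poch (e * z k) (y k) * \prod_(j < n.+2) poch (b j * z k) (y k)) /
     (poch (f * z k) (y k) * poch (g * z k) (y k) *
       (poch (q * z k / w) (y k) * \prod_j poch (q * z k / z j) (y k))))).
Proof.
move=> w0; rewrite /wterm.
have -> : vdm (shiftq (fcons w z) (ncons u y)) = vdm (fcons (w * q ^+ u) (shiftq z y)).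
  rewrite /vdm; apply: eq_bigr => j _; apply: eq_bigr => k _.
  have E i : shiftq (fcons w z) (ncons u y) i = fcons (w * q ^+ u) (shiftq z y) i.
    by rewrite /shiftq /fcons /ncons; case: unlift.
  by rewrite !E.
rewrite !vdm_recl; congr (_ * _).
rewrite big_ord_recl {1 2 3 4 5}/ncons unlift_none /= !fcons0 big_numerators.
congr (_ * _).
  rewrite /whead [X in _ / (_ * X) = _]big_ord_recl fcons0 mulfK //; congr (_ / (_ * (_ * _))).
  by apply: eq_bigr => l _; rewrite fconsS mulrAC.
apply: eq_bigr => i _; rewrite /ncons liftK /= fconsS big_numerators.
congr (_ / (_ * _)); rewrite big_ord_recl fcons0; congr (_ * _).
by apply: eq_bigr => l _; rewrite fconsS.
Qed.

Lemma prod_reflect_factor (I : finType) (u : I -> F) M :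
  \prod_i reflect_factor (u i) M = (\prod_i - u i) ^+ M / qtri M ^+ #|I|.
Proof. by rewrite /reflect_factor prodf_div -prodrXl prodr_const. Qed.

Lemma balance_reflect_factor n (z : 'I_n -> F) (b : 'I_n.+2 -> F) a c d e N M :
  a != 0 -> c != 0 -> d != 0 -> e != 0 -> (forall j, b j != 0) -> (forall k, z k != 0) ->
  a ^+ 3 * q ^+ (2 + N) = (\prod_(j < n.+2) b j) * (c * d * e) * \prod_(k < n) z k ->
  (q ^+ M)^-1 ^+ n * (reflect_factor (a * q / c / a) M * reflect_factor (a * q / d / a) M *
     (reflect_factor (q ^+ N.+1) M * \prod_l reflect_factor (q / z l / a) M)) =
  q ^+ M * (reflect_factor (e / a) M * \prod_j reflect_factor (b j / a) M).
Proof.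
move=> a0 c0 d0 e0 b0 z0 bal; rewrite !prod_reflect_factor !card_ord /reflect_factor.
have T0 := qtri_neq0 M; set T := qtri M in T0 *.
have -> : \prod_i - (q / z i / a) = (- (q / a)) ^+ n / \prod_i z i.
  rewrite -[X in _ ^+ X](card_ord n) -prodr_const -prodf_div; apply: eq_bigr => i _.
  by field; rewrite a0 z0.
have -> : \prod_i - (b i / a) = (- a^-1) ^+ n.+2 * \prod_i b i.
  rewrite -[X in _ ^+ X](card_ord n.+2) -prodr_const -big_split /=; apply: eq_bigr => i _.
  by ring.
have Z0 : \prod_k z k != 0 by apply/prodf_neq0.
have P0 : \prod_j b j != 0 by apply/prodf_neq0.
set Z := \prod_i z i in bal Z0 *; set P := \prod_i b i in bal P0 *.
have key : (q^-1 ^+ n) * (- (a * q / c / a) * - (a * q / d / a) *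
   (- q ^+ N.+1 * ((- (q / a)) ^+ n / Z))) =
   q * (- (e / a) * ((- a^-1) ^+ n.+2 * P)).
  have -> : - (q / a) = q * - a^-1 by rewrite mulrN.
  rewrite exprMn exprVn !exprS.
  have qn : q ^+ n != 0 by rewrite expf_neq0.
  have an : (- a^-1) ^+ n != 0 by rewrite expf_neq0 // oppr_eq0 invr_eq0.
  have {}bal : a ^+ 3 * (q ^+ 2 * q ^+ N) / (c * d * Z) = P * e.
    by rewrite -exprD bal; field; rewrite c0 d0 Z0.
  move: (q ^+ n) ((- a^-1) ^+ n) qn an bal => u v u0 v0 bal.
  transitivity (- (q / a ^+ 3) * v * (a ^+ 3 * (q ^+ 2 * q ^+ N) / (c * d * Z))).
    by field; rewrite Z0 c0 d0 a0 u0.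
  by rewrite bal; field.
have -> : (q ^+ M)^-1 ^+ n = (q^-1 ^+ n) ^+ M by rewrite -exprVn -!exprM mulnC.
move: key.
move: (q^-1 ^+ n) (- (a * q / c / a)) (- (a * q / d / a)) (- q ^+ N.+1).
move: ((- (q / a)) ^+ n / Z) (- (e / a)) ((- a^-1) ^+ n.+2 * P) => D E G U A B C key.
have := congr1 (fun u => u ^+ M) key; rewrite !exprMn => K.
transitivity (U ^+ M * (A ^+ M * B ^+ M * (C ^+ M * D ^+ M)) / (T * T * T * T ^+ n)).
  by field; rewrite T0 expf_neq0.
by rewrite K !exprS; field; rewrite T0 expf_neq0.
Qed.

(** The last [M] factors of [(c w)_N], with [w = 1/(a q^N)], are read backwards. In this way the
    exponent [N - |y|] of [z_0] produces symbols of length [|y|]. *)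
Lemma poch_top a N c M : a != 0 -> c != 0 -> (M <= N)%N ->
  poch (c * (a * q ^+ N)^-1) N =
  poch (c * (a * q ^+ N)^-1) (N - M) * (poch (a * q / c) M * reflect_factor (c / a) M).
Proof.
move=> a0 c0 MN; rewrite (poch_split _ MN); congr (_ * _).
have Q0 k : q ^+ k != 0 by rewrite expf_neq0.
have -> : c * (a * q ^+ N)^-1 * q ^+ (N - M) = c / a / q ^+ M.
  by rewrite -{1}(subnK MN) exprD; field; rewrite a0 !Q0.
rewrite poch_reflect ?mulf_neq0 ?invr_neq0 //; congr (poch _ _ * _).
by field; rewrite a0 c0.
Qed.

(** Normalised by the term where [z_0] carries all of [N]. The Vandermonde pairs with [z_0] become
    [th (a * z k * q ^+ (y k + M))], and the symbols of [z_0] become those of length [M]. *)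
Lemma wterm_sterm n N (z : 'I_n -> F) (b : 'I_n.+2 -> F) a c d e (y : 'I_n -> nat) :
  let w := (a * q ^+ N)^-1 in let M := (\sum_k y k)%N in
  let f := a * q / c in let g := a * q / d in
  a != 0 -> c != 0 -> d != 0 -> e != 0 -> (forall j, b j != 0) -> (forall k, z k != 0) ->
  a ^+ 3 * q ^+ (2 + N) = (\prod_(j < n.+2) b j) * (c * d * e) * \prod_(k < n) z k ->
  (M <= N)%N -> vdm z != 0 -> (forall k, th (a * z k) != 0) ->
  poch (f * w) N != 0 -> poch (g * w) N != 0 -> poch q N != 0 ->
  (forall l, poch (q / z l * w) N != 0) ->
  poch (a * q / e) M != 0 -> (forall j, poch (a * q / b j) M != 0) ->
  wterm (fcons w z) (numerators b e) f g (ncons (N - M) y) =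
  wterm (fcons w z) (numerators b e) f g (ncons N (fun=> 0%N)) * sterm N z b a c d e y.
Proof.
move=> w M f g a0 c0 d0 e0 b0 z0 bal MN V0 az0 fw gw qN lw ae ab.
have Q0 k : q ^+ k != 0 by rewrite expf_neq0.
have w0 : w != 0 by rewrite invr_eq0 mulf_neq0.
have cst u : u ^+ n = \prod_(k < n) u by rewrite prodr_const card_ord.
rewrite !wterm_ncons //.
have vz : vdm (shiftq z (fun=> 0%N)) = vdm z.
  by apply: eq_bigr => j _; apply: eq_bigr => k _; rewrite /shiftq !mulr1.
have -> : \prod_k (w * q ^+ (N - M) * th (shiftq z y k / (w * q ^+ (N - M)))) =
    (a * q ^+ M)^-1 ^+ n * \prod_k th (a * z k * q ^+ (y k + M)).
  rewrite cst -big_split /=; apply: eq_bigr => k _.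
  have -> : w * q ^+ (N - M) = (a * q ^+ M)^-1.
    by rewrite /w -{1}(subnK MN) exprD; field; rewrite a0 !Q0.
  by rewrite invrK /shiftq exprD; congr (_ * th _); ring.
have -> : \prod_k (w * q ^+ N * th (shiftq z (fun=> 0%N) k / (w * q ^+ N))) =
    a^-1 ^+ n * \prod_k th (a * z k).
  rewrite cst -big_split /=; apply: eq_bigr => k _.
  have -> : w * q ^+ N = a^-1 by rewrite /w; field; rewrite a0 !Q0.
  by rewrite invrK /shiftq mulr1; congr (_ * th _); ring.
rewrite vz [X in _ = _ * (_ * X) * _]big1 ?mulr1; last first.
  move=> k _; rewrite !poch0 !big1 ?mulr1 ?divr1 // => j _; exact: poch0.
rewrite /sterm -/M.
rewrite (prodf_div _ _ (fun k => th (a * z k * q ^+ (y k + M))) (fun k => th (a * z k))).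
have -> : \prod_(k < n)
    ((poch (e * z k) (y k) * \prod_(j < n.+2) poch (b j * z k) (y k))
     / (poch (a * q ^+ (1 + N) * z k) (y k) * poch (a * q * z k / c) (y k)
        * poch (a * q * z k / d) (y k) * \prod_(j < n) poch (q * z k / z j) (y k))) =
  \prod_k (poch (e * z k) (y k) * (\prod_j poch (b j * z k) (y k)) /
    (poch (f * z k) (y k) * poch (g * z k) (y k) *
     (poch (q * z k / w) (y k) * \prod_j poch (q * z k / z j) (y k)))).
  apply: eq_bigr => k _; rewrite /f /g /w invrK.
  rewrite ![a * q * z k / _]mulrAC exprD expr1.
  have -> : q * z k * (a * q ^+ N) = a * (q * q ^+ N) * z k by ring.
  by congr (_ / _); ring.
set tail := \prod_k (poch (e * z k) (y k) * _ / _).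
have {fw} [fw Ef] : poch c M * reflect_factor (f / a) M != 0 /\
    (poch (f * w) (N - M))^-1 = (poch (f * w) N)^-1 * (poch c M * reflect_factor (f / a) M).
  have := @poch_top a N f M a0; rewrite -/w => /(_ _ MN) E.
  have f0 : f != 0 by rewrite !mulf_neq0 ?invr_neq0.
  move: fw; rewrite (E f0) (_ : a * q / f = c); last by rewrite /f; field; rewrite a0 c0 q0.
  rewrite mulf_eq0 => /norP [n1 n2]; split => //.
  by rewrite invfM mulfVK.
have {gw} [gw Eg] : poch d M * reflect_factor (g / a) M != 0 /\
    (poch (g * w) (N - M))^-1 = (poch (g * w) N)^-1 * (poch d M * reflect_factor (g / a) M).
  have := @poch_top a N g M a0; rewrite -/w => /(_ _ MN) E.
  have g0 : g != 0 by rewrite !mulf_neq0 ?invr_neq0.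
  move: gw; rewrite (E g0) (_ : a * q / g = d); last by rewrite /g; field; rewrite a0 d0 q0.
  rewrite mulf_eq0 => /norP [n1 n2]; split => //.
  by rewrite invfM mulfVK.
have {qN} Eq : (poch q (N - M))^-1 = (poch q N)^-1 * (poch (q ^- N) M * reflect_factor (q ^+ N.+1) M).
  have := @poch_top a N (a * q ^+ N.+1) M a0.
  have -> : a * q ^+ N.+1 / (a * q ^+ N) = q by rewrite exprS; field; rewrite a0 Q0.
  have -> : a * q / (a * q ^+ N.+1) = q ^- N by rewrite exprS; field; rewrite a0 q0 Q0.
  have -> : a * q ^+ N.+1 / a = q ^+ N.+1 by field.
  rewrite mulf_neq0 // => /(_ isT MN) E; move: qN; rewrite E mulf_eq0 => /norP [n1 n2].
  by rewrite invfM mulfVK.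
have {lw} El : (\prod_l poch (q / z l * w) (N - M))^-1 = (\prod_l poch (q / z l * w) N)^-1 *
   (\prod_j poch (a * z j) M * \prod_l reflect_factor (q / z l / a) M).
  rewrite -!prodfV -!big_split /=; apply: eq_bigr => l _.
  have := @poch_top a N (q / z l) M a0; rewrite -/w => /(_ _ MN) E.
  have f0 : q / z l != 0 by rewrite !mulf_neq0 ?invr_neq0.
  move: (lw l); rewrite (E f0) (_ : a * q / (q / z l) = a * z l); last by field; rewrite z0 q0.
  rewrite mulf_eq0 => /norP [n1 n2].
  by rewrite invfM mulfVK.
have re0 u : u != 0 -> reflect_factor u M != 0.
  by move=> u0; rewrite mulf_neq0 ?invr_neq0 ?qtri_neq0 // expf_neq0 // oppr_eq0.
have Ee : poch (e * w) N = poch (e * w) (N - M) * (poch (a * q / e) M * reflect_factor (e / a) M).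
  exact: poch_top.
have Eb : \prod_j poch (b j * w) N = \prod_j poch (b j * w) (N - M) *
    (\prod_j poch (a * q / b j) M * \prod_j reflect_factor (b j / a) M).
  rewrite -!big_split; apply: eq_bigr => j _; exact: poch_top.
rewrite /whead Ee Eb !invfM Ef Eg Eq El.
have abp : \prod_j poch (a * q / b j) M != 0 by apply/prodf_neq0.
have rb : \prod_j reflect_factor (b j / a) M != 0.
  by apply/prodf_neq0 => j _; apply: re0; rewrite mulf_neq0 ?invr_neq0.
have re : reflect_factor (e / a) M != 0 by apply: re0; rewrite mulf_neq0 ?invr_neq0.
have A0 : \prod_k th (a * z k) != 0 by apply/prodf_neq0.
have key := balance_reflect_factor M a0 c0 d0 e0 b0 z0 bal.
rewrite exprMn.
move: ae abp rb re A0 key V0; rewrite -/f -/g.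
move: (poch (f * w) N)^-1 (poch (g * w) N)^-1 (poch q N)^-1.
move: (\prod_l poch (q / z l * w) N)^-1 (\prod_k (w * th (z k / w)))^-1.
move: (reflect_factor (f / a) M) (reflect_factor (g / a) M) (reflect_factor (q ^+ N.+1) M).
move: (\prod_l reflect_factor (q / z l / a) M) (\prod_j reflect_factor (b j / a) M) (reflect_factor (e / a) M).
move: (q ^+ M) ((q ^+ M)^-1 ^+ n) (\prod_j poch (a * q / b j) M) (poch (a * q / e) M).
move: (\prod_k th (a * z k)) (vdm z) => ta v p2 p1 p3 p4 r1 r2 r3 r4 r5 r6 i1 i2 i3 i4 i5.
move=> n1 n2 n3 n4 n5 key n6.
(* Grouped so that the left-hand side of [key] is a single factor. *)
transitivity ((p1 * (r4 * r5 * (r6 * r1))) * (a^-1 ^+ n *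
 (\prod_k th (a * z k * q ^+ (y k + M))) * vdm (shiftq z y) * i2 / v *
   (poch (e * w) (N - M) * \prod_j poch (b j * w) (N - M)) *
   (i3 * i4 * i5 * i1 * (poch c M * poch d M * poch (q ^- N) M *
  \prod_j poch (a * z j) M)) * tail)).
  by field.
rewrite key; field.
by rewrite n1 n2 n5 n6.
Qed.

Definition ssum n N (z : 'I_n -> F) (b : 'I_n.+2 -> F) a c d e :=
  \sum_(y : {ffun 'I_n -> 'I_N.+1} | (\sum_k y k <= N)%N)
    sterm N z b a c d e (fun k => y k).

Lemma eq_wterm m (z : 'I_m -> F) Bs f g (k k' : 'I_m -> nat) :
  k =1 k' -> wterm z Bs f g k = wterm z Bs f g k'.
Proof.
move=> E; rewrite /wterm /vdm /shiftq; congr (_ / _ * _).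
  by apply: eq_bigr => i _; apply: eq_bigr => j _; rewrite !E.
by apply: eq_bigr => i _; rewrite !E.
Qed.

Lemma wsum_simplex n N (z : 'I_n.+1 -> F) Bs f g :
  wsum N N z Bs f g =
  \sum_(y : {ffun 'I_n -> 'I_N.+1} | (\sum_k y k <= N)%N)
    wterm z Bs f g (ncons (N - \sum_k y k) (fun k => y k)).
Proof.
pose h (y : {ffun 'I_n -> 'I_N.+1}) : {ffun 'I_n.+1 -> 'I_N.+1} :=
  [ffun i => oapp y (inord (N - \sum_k y k)) (unlift ord0 i)].
pose h' (y : {ffun 'I_n.+1 -> 'I_N.+1}) : {ffun 'I_n -> 'I_N.+1} :=
  [ffun i => y (lift ord0 i)].
have hE y i : h y i = ncons (N - \sum_k y k) (fun k => y k) i :> nat.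
  rewrite ffunE /ncons; case: unlift => [j|] //=.
  by rewrite inordK // ltnS leq_subr.
rewrite /wsum (reindex_onto h h') /=; last first.
  move=> y; rewrite big_ord_recl => /eqP yN; apply/ffunP => i; apply/val_inj.
  rewrite /= hE /ncons; case: unliftP => [j|] -> /=; first by rewrite ffunE.
  rewrite (eq_bigr (fun k => y (lift ord0 k) : nat)) => [|k _]; last by rewrite ffunE.
  by rewrite -{1}yN addnK.
apply: eq_big => [y|y _]; last by apply: eq_wterm => i; rewrite hE.
have -> : h' (h y) == y.
  by apply/eqP/ffunP => i; rewrite ffunE; apply/val_inj; rewrite /= hE /ncons liftK.
rewrite andbT (eq_bigr _ (fun i _ => hE y i)) big_ord_recl /= {1}/ncons unlift_none /=.
rewrite [X in (_ + X)%N](eq_bigr (fun k => y k : nat)) => [|k _]; last by rewrite /ncons liftK.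
by apply/eqP/idP => [E|/subnK//]; rewrite -[leqRHS]E leq_addl.
Qed.

(** The normalising factor of [wterm_sterm] in symbols of length [N]. Its values for [a] and for
    [lam], together with [bailey_coef], make up the prefactor of the theorem. *)
Lemma wterm_corner n N (z : 'I_n -> F) (b : 'I_n.+2 -> F) a c d e :
  let w := (a * q ^+ N)^-1 in
  a != 0 -> c != 0 -> d != 0 -> e != 0 -> (forall j, b j != 0) -> (forall k, z k != 0) ->
  vdm z != 0 ->
  wterm (fcons w z) (numerators b e) (a * q / c) (a * q / d) (ncons N (fun=> 0%N)) =
  (q ^+ N) ^+ n * (\prod_k th (a * z k) / \prod_k th (a * z k * q ^+ N)) *
  ((poch (a * q / e) N * reflect_factor (e / a) N *
     (\prod_j poch (a * q / b j) N * \prod_j reflect_factor (b j / a) N)) /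
   (poch c N * reflect_factor (a * q / c / a) N * (poch d N * reflect_factor (a * q / d / a) N) *
    (poch q N * (\prod_l poch (a * z l) N * \prod_l reflect_factor (q / z l / a) N)))).
Proof.
move=> w a0 c0 d0 e0 b0 z0 V0.
have Q0 k : q ^+ k != 0 by rewrite expf_neq0.
have w0 : w != 0 by rewrite invr_eq0 mulf_neq0.
have cst u : u ^+ n = \prod_(k < n) u by rewrite prodr_const card_ord.
rewrite wterm_ncons // [X in _ * (_ * X) = _]big1 ?mulr1; last first.
  move=> k _; rewrite !poch0 !big1 ?mulr1 ?divr1 // => j _; exact: poch0.
have -> : vdm (shiftq z (fun=> 0%N)) = vdm z.
  by apply: eq_bigr => j _; apply: eq_bigr => k _; rewrite /shiftq !mulr1.
rewrite -mulf_div divff // mulr1; congr (_ * _).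
  rewrite cst -!prodf_div -big_split /=; apply: eq_bigr => k _.
  have -> : w * q ^+ N = a^-1 by rewrite /w; field; rewrite a0 Q0.
  rewrite invrK /shiftq mulr1 {2}/w invrK /w.
  have -> : z k * (a * q ^+ N) = a * z k * q ^+ N by ring.
  rewrite [z k * a]mulrC [X in _ / X]mulrC invfM invrK.
  by move: (th (a * z k * q ^+ N))^-1 => t; field; rewrite a0.
have top u : u != 0 -> poch (u * w) N = poch (a * q / u) N * reflect_factor (u / a) N.
  by move=> u0; rewrite (poch_top a0 u0 (leqnn N)) subnn poch0 mul1r.
rewrite /whead (top e) //.
have qc u : u != 0 -> a * q / (a * q / u) = u.
  by move=> u0; field; rewrite a0 q0 u0.
rewrite top ?mulf_neq0 ?invr_neq0 // qc //.
rewrite [poch (_ / d * w) N]top ?mulf_neq0 ?invr_neq0 // qc //.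
congr (_ * _ / (_ * (_ * _))).
  by rewrite -big_split; apply: eq_bigr => j _; rewrite top.
rewrite -big_split; apply: eq_bigr => l _ /=.
rewrite top ?mulf_neq0 ?invr_neq0 //; congr (poch _ _ * _).
by field; rewrite z0 q0.
Qed.

(** * The transformation under genericity assumptions *)

Lemma reflect_factorM u v N : reflect_factor (u * v) N = reflect_factor u N * v ^+ N.
Proof. by rewrite /reflect_factor -mulNr exprMn mulrAC. Qed.

Lemma leq_doubleSS N i : (i <= N)%N -> (i.+1 <= N.*2.+1)%N.
Proof. by lia. Qed.

Lemma leq_add_doubleS N i j : (i <= N)%N -> (j <= N)%N -> (i + j <= N.*2.+1)%N.
Proof. by lia. Qed.

(** The bound [N.*2.+1] used below covers [a * z_k * q^(N+i)] with [i <= N], and the factor [q] in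
    [(a*q/c) * z_k] when [N = 0]. *)
Definition generic K u := forall i j : nat, (i <= K)%N -> (j <= K)%N ->
  th (u * q ^+ i / q ^+ j) != 0.

Lemma generic_at K u v i j : generic K u -> (i <= K)%N -> (j <= K)%N ->
  v = u * q ^+ i / q ^+ j -> th v != 0.
Proof. by move=> gu iK jK ->; apply: gu. Qed.

Lemma generic_atV K u v i j : u != 0 -> generic K u -> (i <= K)%N -> (j <= K)%N ->
  v^-1 = u * q ^+ i / q ^+ j -> th v != 0.
Proof.
move=> u0 gu iK jK E; have v0 : v != 0.
  by rewrite -invr_eq0 E !mulf_neq0 ?invr_neq0 ?expf_neq0.
rewrite -[v]divr1 th_div_sym ?oner_eq0 // div1r; exact: generic_at gu iK jK E.
Qed.

Lemma generic_transformation n N (z : 'I_n -> F) (b : 'I_n.+2 -> F) a c d e lam :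
  a != 0 -> c != 0 -> d != 0 -> e != 0 -> (forall j, b j != 0) -> (forall k, z k != 0) ->
  a ^+ 3 * q ^+ (2 + N) = (\prod_(j < n.+2) b j) * (c * d * e) * \prod_(k < n) z k ->
  lam = a ^+ 2 * q / (c * d * e) ->
  vdm z != 0 ->
  (forall i, (0 < i <= N)%N -> th (q ^+ i) != 0) ->
  (forall i l k, (k <= N)%N -> (i != l) -> th (z i * q ^+ k / z l) != 0) ->
  (forall u, u \in [:: c; d; lam * c / a; lam * d / a; c / d; b ord0 / a; b ord0 / lam; a / e] ->
     generic N.*2.+1 u) ->
  (forall k u, u \in [:: a; lam; b ord0; a / c; a / d] -> generic N.*2.+1 (u * z k)) ->
  (forall j u, u \in [:: a; lam] -> generic N.*2.+1 (u / b j)) ->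
  ssum N z b a c d e =
  (a / lam) ^+ N *
  (\prod_(k < n) (poch (a * q * z k) N / poch (lam * q * z k) N)) *
  (\prod_(j < n.+2) (poch (lam * q / b j) N / poch (a * q / b j) N)) *
  ssum N z b lam (lam * c / a) (lam * d / a) (lam * e / a).
Proof.
move=> a0 c0 d0 e0 b0 z0 bal lamE V0 tq dz gen genz genb.
have Q0 k : q ^+ k != 0 by rewrite expf_neq0.
have l0 : lam != 0 by rewrite lamE !mulf_neq0 ?invr_neq0 ?expf_neq0 ?mulf_neq0.
set c' := lam * c / a; set d' := lam * d / a; set e' := lam * e / a.
have c'0 : c' != 0 by rewrite !mulf_neq0 ?invr_neq0.
have d'0 : d' != 0 by rewrite !mulf_neq0 ?invr_neq0.
have e'0 : e' != 0 by rewrite !mulf_neq0 ?invr_neq0.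
pose w := (a * q ^+ N)^-1; pose w' := (lam * q ^+ N)^-1.
have w0 : w != 0 by rewrite invr_eq0 mulf_neq0.
have w'0 : w' != 0 by rewrite invr_eq0 mulf_neq0.
pose f := a * q / c; pose g := a * q / d.
have f0 : f != 0 by rewrite !mulf_neq0 ?invr_neq0.
have g0 : g != 0 by rewrite !mulf_neq0 ?invr_neq0.
have fE : lam * q / c' = f by rewrite /f /c'; field; rewrite a0 c0 l0.
have gE : lam * q / d' = g by rewrite /g /d'; field; rewrite a0 d0 l0.
have bal' : lam ^+ 3 * q ^+ (2 + N) =
    (\prod_(j < n.+2) b j) * (c' * d' * e') * \prod_(k < n) z k.
  transitivity (lam ^+ 3 / a ^+ 3 * (a ^+ 3 * q ^+ (2 + N))).
    by rewrite mulrA divfK // expf_neq0.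
  by rewrite bal /c' /d' /e'; field.
have feE : f / e = d' by rewrite /f /d' lamE; field; rewrite a0 c0 d0 e0.
have geE : g / e = c' by rewrite /g /c' lamE; field; rewrite a0 c0 d0 e0.
have NN i : (i <= N)%N -> (i <= N.*2.+1)%N by move/leq_doubleSS/ltnW.
have gc : generic N.*2.+1 c by apply: gen; rewrite !inE eqxx.
have gd : generic N.*2.+1 d by apply: gen; rewrite !inE eqxx ?orbT.
have gc' : generic N.*2.+1 c' by apply: gen; rewrite !inE eqxx ?orbT.
have gd' : generic N.*2.+1 d' by apply: gen; rewrite !inE eqxx ?orbT.
have gcd : generic N.*2.+1 (c / d) by apply: gen; rewrite !inE eqxx ?orbT.
have gba : generic N.*2.+1 (b ord0 / a) by apply: gen; rewrite !inE eqxx ?orbT.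
have gbl : generic N.*2.+1 (b ord0 / lam) by apply: gen; rewrite !inE eqxx ?orbT.
have gae : generic N.*2.+1 (a / e) by apply: gen; rewrite !inE eqxx ?orbT.
have gaz k : generic N.*2.+1 (a * z k) by apply: genz; rewrite !inE eqxx ?orbT.
have glz k : generic N.*2.+1 (lam * z k) by apply: genz; rewrite !inE eqxx ?orbT.
have gbz k : generic N.*2.+1 (b ord0 * z k) by apply: genz; rewrite !inE eqxx ?orbT.
have gacz k : generic N.*2.+1 (a / c * z k) by apply: genz; rewrite !inE eqxx ?orbT.
have gadz k : generic N.*2.+1 (a / d * z k) by apply: genz; rewrite !inE eqxx ?orbT.
have gab j : generic N.*2.+1 (a / b j) by apply: genb; rewrite !inE eqxx ?orbT.
have glb j : generic N.*2.+1 (lam / b j) by apply: genb; rewrite !inE eqxx ?orbT.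
have pochg u v k : generic N.*2.+1 u -> (k <= N)%N ->
    (v = u \/ v = u * q) -> poch v k != 0.
  move=> gu kN; rewrite /poch big_mkord => -[] ->; apply/prodf_neq0 => i _;
    have iN := ltnW (leq_trans (ltn_ord i) kN).
    by apply: (@generic_at _ _ _ i 0 gu); rewrite ?divr1 ?NN.
  by apply: (@generic_at _ _ _ i.+1 0 gu); rewrite ?divr1 ?exprS ?mulrA ?leq_doubleSS.
have tq' i : (0 < i <= N)%N -> th (q ^+ i) != 0.
  exact: tq.
have pq : poch q N != 0.
  rewrite /poch big_mkord; apply/prodf_neq0 => i _; rewrite -exprS; apply: tq'.
  by rewrite ltn_ord.
have pw u v k : u != 0 -> generic N.*2.+1 u -> v * u * q ^+ N = q -> (k <= N)%N -> poch v k != 0.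
  move=> u0 gu E kN; rewrite /poch big_mkord; apply/prodf_neq0 => i _.
  have iN := ltnW (leq_trans (ltn_ord i) kN).
  have v0 : v != 0 by apply: contraNneq q0 => v0; rewrite -E v0 !mul0r.
  have uN : u * q ^+ N = q / v by apply: (mulIf v0); rewrite divfK // mulrC mulrA.
  apply: (@generic_atV _ u _ N i.+1 u0 gu); rewrite ?leq_doubleSS ?NN //.
  by rewrite uN exprS; field; rewrite v0 q0 Q0.
have fwE u : u != 0 -> a * q / u * w * u * q ^+ N = q.
  by move=> u0; rewrite /w; field; rewrite a0 u0 Q0.
have fwE' u : u != 0 -> lam * q / u * w' * u * q ^+ N = q.
  by move=> u0; rewrite /w'; field; rewrite l0 u0 Q0.
have fwn k : (k <= N)%N -> poch (f * w) k != 0 by apply: (pw c) => //; apply: fwE.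
have gwn k : (k <= N)%N -> poch (g * w) k != 0 by apply: (pw d) => //; apply: fwE.
have fwn' k : (k <= N)%N -> poch (f * w') k != 0.
  by apply: (pw c') => //; rewrite -fE; apply: fwE'.
have gwn' k : (k <= N)%N -> poch (g * w') k != 0.
  by apply: (pw d') => //; rewrite -gE; apply: fwE'.
have zwn l : poch (q / z l * w) N != 0.
  apply: (pw (a * z l)) => //; first by rewrite mulf_neq0.
  by rewrite /w; field; rewrite a0 z0 Q0.
have zwn' l : poch (q / z l * w') N != 0.
  apply: (pw (lam * z l)) => //; first by rewrite mulf_neq0.
  by rewrite /w'; field; rewrite l0 z0 Q0.
have th_g u : generic N.*2.+1 u -> th u != 0.
  by move=> gu; have := gu 0%N 0%N isT isT; rewrite !mulr1 divr1.
have ae' : lam * q / e' = a * q / e by rewrite /e'; field; rewrite e0 l0 a0.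
have aeS : a * q / e = a / e * q by rewrite mulrAC.
have abS j : a * q / b j = a / b j * q by rewrite mulrAC.
have lbS j : lam * q / b j = lam / b j * q by rewrite mulrAC.
(* [W1] and [W2] put both sums into symmetric form with the same [f] and [g], and [W3] relates them;
   afterwards only explicit products are compared. *)
have W1 : wsum N N (fcons w z) (numerators b e) f g =
  wterm (fcons w z) (numerators b e) f g (ncons N (fun=> 0%N)) * ssum N z b a c d e.
  rewrite wsum_simplex /ssum mulr_sumr; apply: eq_bigr => y yN.
  apply: wterm_sterm => //.
  - by move=> k; apply: th_g.
  - exact: fwn.
  - exact: gwn.
  - by rewrite aeS; apply: pochg gae yN _; right.
  - by move=> j; rewrite abS; apply: pochg (gab j) yN _; right.
have W2 : wsum N N (fcons w' z) (numerators b e') f g =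
  wterm (fcons w' z) (numerators b e') f g (ncons N (fun=> 0%N)) * ssum N z b lam c' d' e'.
  rewrite wsum_simplex /ssum mulr_sumr; apply: eq_bigr => y yN.
  rewrite -fE -gE; apply: wterm_sterm => //.
  - by move=> k; apply: th_g.
  - by rewrite fE; apply: fwn'.
  - by rewrite gE; apply: gwn'.
  - by rewrite ae' aeS; apply: pochg gae yN _; right.
  - by move=> j; rewrite lbS; apply: pochg (glb j) yN _; right.
have sep u v : v * (u * q ^+ N) = 1 -> u != 0 -> (forall k, generic N.*2.+1 (u * z k)) ->
    q_separated N (fcons v z).
  move=> vu u0 gu i l k kN; have v0 : v != 0.
    by apply: contraNneq (oner_neq0 F) => v0; rewrite -vu v0 mul0r.
  have {}vu : v = (u * q ^+ N)^-1 by apply: (mulIf (mulf_neq0 u0 (Q0 N))); rewrite vu mulVf ?mulf_neq0.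
  case: (unliftP ord0 i) => [i'|] ->; case: (unliftP ord0 l) => [l'|] ->;
    rewrite ?fcons0 ?fconsS ?eqxx //.
  - rewrite (inj_eq (@lift_inj _ ord0)) => /orP [il|k0]; first exact: dz.
    have [->|il] := eqVneq i' l'; last exact: dz.
    by rewrite mulrAC divff // mul1r tq' // k0.
  - move=> _; apply: (@generic_at _ _ _ (N + k) 0 (gu i')) => //; first exact: leq_add_doubleS.
    by rewrite vu invrK exprD divr1; ring.
  - move=> _; apply: (@generic_atV _ _ _ N k _ (gu l')); rewrite ?NN ?mulf_neq0 //.
    by rewrite vu; field; rewrite u0 z0 !Q0.
  - by move=> /= k0; rewrite mulrAC divff // mul1r tq' // k0.
have nzp u v s : v * (s * q ^+ N) = u -> s != 0 -> u != 0 -> generic N.*2.+1 (u / s) ->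
    poch_nz N v.
  move=> vu s0 u0 gu k kN; apply: (@generic_at _ _ _ k N gu); rewrite ?NN //.
  by rewrite -vu; field; rewrite s0 !Q0.
have nzpV u v : u != 0 -> v * u * q ^+ N = q -> generic N.*2.+1 u -> poch_nz N v.
  move=> u0 E gu k kN.
  have v0 : v != 0 by apply: contraNneq q0 => v0; rewrite -E v0 !mul0r.
  have uN : u * q ^+ N = q / v by apply: (mulIf v0); rewrite divfK // mulrC mulrA.
  apply: (@generic_atV _ u _ N k.+1 u0 gu); rewrite ?leq_doubleSS ?NN //.
  by rewrite uN exprS; field; rewrite v0 q0 Q0.
have nz1 u v : (v = u \/ v = u * q) -> generic N.*2.+1 u -> poch_nz N v.
  move=> [] -> gu k kN.
    by apply: (@generic_at _ _ _ k 0 gu); rewrite ?divr1 ?NN.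
  by apply: (@generic_at _ _ _ k.+1 0 gu); rewrite ?divr1 ?exprS ?mulrA ?leq_doubleSS.
have nzc v u : poch_nz N (v * u) -> (forall k, poch_nz N (v * z k)) ->
    forall i, poch_nz N (v * fcons u z i).
  by move=> vu vz i; case: (unliftP ord0 i) => [j|] ->; rewrite ?fcons0 ?fconsS.
have fzS k : f * z k = a / c * z k * q by rewrite /f; ring.
have gzS k : g * z k = a / d * z k * q by rewrite /g; ring.
have W3 : wsum N N (fcons w z) (numerators b e) f g =
    bailey_coef w e f g N * wsum N N (fcons w' z) (numerators b e') f g.
  apply: bailey_wsum => //.
  - by apply/allP => c1 /mapP [l _ ->] /=.
  - by rewrite size_map size_enum_ord.
  - rewrite (_ : b ord0 * (e * _) = \prod_(B <- numerators b e) B); last by rewrite !big_cons.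
    rewrite (big_numerators _ _ id).
    transitivity (w * (a ^+ 3 * q ^+ (2 + N)) / (c * d)).
      by rewrite /f /g /w exprD; field; rewrite a0 c0 d0 Q0.
    by rewrite bal; field; rewrite c0 d0.
  - by rewrite /w' /f /g lamE; field; rewrite a0 c0 d0 e0 q0 Q0.
  - by rewrite /w /f /g /e' lamE; field; rewrite a0 c0 d0 e0 Q0.
  - move=> i j iN jN; apply: (@generic_atV _ _ _ j i _ gcd); rewrite ?NN //.
      by rewrite mulf_neq0 ?invr_neq0.
    by rewrite /f /g; field; rewrite a0 c0 d0 q0 !Q0.
  - by apply: (sep a) => //; rewrite mulVf // mulf_neq0.
  - by apply: (sep lam) => //; rewrite mulVf // mulf_neq0.
  - apply: nzc => [|k]; last by apply: nz1 (gbz k); left.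
    by apply: nzp gba => //; rewrite /w mulfVK // mulf_neq0.
  - apply: nzc => [|k]; last by apply: nz1 (gbz k); left.
    by apply: nzp gbl => //; rewrite /w' mulfVK // mulf_neq0.
  - apply: nzc => [|k]; last by apply: nz1 (gacz k); right.
    by apply: nzpV gc => //; apply: fwE.
  - apply: nzc => [|k]; last by apply: nz1 (gacz k); right.
    by apply: nzpV gc' => //; rewrite -fE; apply: fwE'.
  - apply: nzc => [|k]; last by apply: nz1 (gadz k); right.
    by apply: nzpV gd => //; apply: fwE.
  - apply: nzc => [|k]; last by apply: nz1 (gadz k); right.
    by apply: nzpV gd' => //; rewrite -gE; apply: fwE'.
have cor := wterm_corner N a0 c0 d0 e0 b0 z0 V0; rewrite /= -/w -/f -/g in cor.
have cor' := wterm_corner N l0 c'0 d'0 e'0 b0 z0 V0; rewrite /= -/w' fE gE ae' in cor'.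
have re0 u : u != 0 -> reflect_factor u N != 0.
  by move=> u0; rewrite mulf_neq0 ?invr_neq0 ?qtri_neq0 // expf_neq0 // oppr_eq0.
have pc0 u : generic N.*2.+1 u -> poch u N != 0 by move=> gu; apply: pochg gu (leqnn N) _; left.
have pS0 u : generic N.*2.+1 u -> poch (u * q) N != 0.
  by move=> gu; apply: pochg gu (leqnn N) _; right.
have az0 : \prod_k th (a * z k) != 0 by apply/prodf_neq0 => k _; apply: th_g.
have azN0 : \prod_k th (a * z k * q ^+ N) != 0.
  by apply/prodf_neq0 => k _; apply: (@generic_at _ _ _ N 0 (gaz k)); rewrite ?divr1 ?NN.
have lzN0 : \prod_k th (lam * z k * q ^+ N) != 0.
  by apply/prodf_neq0 => k _; apply: (@generic_at _ _ _ N 0 (glz k)); rewrite ?divr1 ?NN.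
have Pz0 : \prod_l poch (a * z l) N != 0 by apply/prodf_neq0 => k _; apply: pc0.
have Pz0' : \prod_l poch (lam * z l) N != 0 by apply/prodf_neq0 => k _; apply: pc0.
have Pab0 : \prod_j poch (a * q / b j) N != 0.
  by apply/prodf_neq0 => j _; rewrite abS; apply: pS0.
have Plq0 : \prod_k poch (lam * q * z k) N != 0.
  by apply/prodf_neq0 => k _; rewrite mulrAC; apply: pS0.
have Rb0 : \prod_j reflect_factor (b j / a) N != 0.
  by apply/prodf_neq0 => j _; apply: re0; rewrite mulf_neq0 ?invr_neq0.
have Rz0 : \prod_l reflect_factor (q / z l / a) N != 0.
  by apply/prodf_neq0 => l _; apply: re0; rewrite !mulf_neq0 ?invr_neq0.
have ea0 : e / a != 0 by rewrite mulf_neq0 ?invr_neq0.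
have aen : poch (a * q / e) N != 0 by rewrite aeS; apply: pS0.
have QN : (q ^+ N) ^+ n != 0 by rewrite !expf_neq0.
have fa0 : f / a != 0 by rewrite mulf_neq0 ?invr_neq0.
have ga0 : g / a != 0 by rewrite mulf_neq0 ?invr_neq0.
have fl0 : f / lam != 0 by rewrite mulf_neq0 ?invr_neq0.
have gl0 : g / lam != 0 by rewrite mulf_neq0 ?invr_neq0.
have T0 : wterm (fcons w z) (numerators b e) f g (ncons N (fun=> 0%N)) != 0.
  rewrite cor; move: (re0 _ ea0) (re0 _ fa0) (re0 _ ga0) Rb0 Rz0.
  move: (reflect_factor (e / a) N) (reflect_factor (f / a) N) (reflect_factor (g / a) N).
  move: (\prod_j reflect_factor (b j / a) N) (\prod_l reflect_factor (q / z l / a) N) => ? ? ? ? ? ? ? ? ? ?.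
  by rewrite !(mulf_neq0, invr_neq0) ?(pc0 _ gc) ?(pc0 _ gd).
apply: (mulfI T0); rewrite -W1 W3 W2 (mulrA (bailey_coef _ _ _ _ _)) [RHS]mulrA; congr (_ * _).
rewrite cor cor' /bailey_coef feE geE.
rewrite (prodf_div _ _ (fun k => poch (a * q * z k) N) (fun k => poch (lam * q * z k) N)).
rewrite (prodf_div _ _ (fun j => poch (lam * q / b j) N) (fun j => poch (a * q / b j) N)).
have -> : poch (f * w) N = poch c N * reflect_factor (f / a) N.
  rewrite (poch_top a0 f0 (leqnn N)) subnn poch0 mul1r; congr (poch _ _ * _).
  by rewrite /f; field; rewrite a0 c0 q0.
have -> : poch (g * w) N = poch d N * reflect_factor (g / a) N.
  rewrite (poch_top a0 g0 (leqnn N)) subnn poch0 mul1r; congr (poch _ _ * _).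
  by rewrite /g; field; rewrite a0 d0 q0.
have -> : e' / lam = e / a by rewrite /e'; field; rewrite a0 l0.
(* Count of the powers of [(a / lam) ^+ N]: [n + 2] from the [b_j], minus [n] from the [z_l], minus
   one from [pow] below. One is left, as in the theorem. *)
have scale u : reflect_factor (u / lam) N = reflect_factor (u / a) N * (a / lam) ^+ N.
  by rewrite -reflect_factorM; congr (reflect_factor _ _); field; rewrite a0 l0.
have -> : \prod_j reflect_factor (b j / lam) N = \prod_j reflect_factor (b j / a) N * ((a / lam) ^+ N) ^+ n.+2.
  under eq_bigr => j _ do rewrite scale.
  by rewrite big_split /= prodr_const card_ord.
have -> : \prod_l reflect_factor (q / z l / lam) N =
    \prod_l reflect_factor (q / z l / a) N * ((a / lam) ^+ N) ^+ n.
  under eq_bigr => j _ do rewrite scale.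
  by rewrite big_split /= prodr_const card_ord.
have shift u : \prod_k poch (u * q * z k) N * \prod_k th (u * z k) =
    \prod_k poch (u * z k) N * \prod_k th (u * z k * q ^+ N).
  rewrite -!big_split; apply: eq_bigr => k _ /=.
  by rewrite [u * q * _]mulrAC poch_shift.
have shA := shift a; have shL := shift lam.
have pow : (w * e) ^+ N * (a / lam) ^+ N = reflect_factor (f / lam) N * reflect_factor (g / lam) N.
  rewrite /reflect_factor mulf_div -expr2 qtri_sqr -!exprMn -expr_div_n; congr (_ ^+ N).
  by rewrite /w /f /g lamE (exprS q N); field; rewrite a0 c0 d0 e0 q0 Q0.
have s0 : (a / lam) ^+ N != 0 by rewrite expf_neq0 // mulf_neq0 ?invr_neq0.
have rfl := re0 _ fl0; have rgl := re0 _ gl0.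
have rfa := re0 _ fa0; have rga := re0 _ ga0.
have rea := re0 _ ea0.
have pcn := pc0 _ gc; have pdn := pc0 _ gd.
have pcn' := pc0 _ gc'; have pdn' := pc0 _ gd'.
have -> : \prod_k th (lam * z k) =
    \prod_k poch (lam * z k) N * \prod_k th (lam * z k * q ^+ N) / \prod_k poch (lam * q * z k) N.
  by rewrite -shL mulrC mulKf.
have -> : \prod_k poch (a * q * z k) N =
    \prod_k poch (a * z k) N * \prod_k th (a * z k * q ^+ N) / \prod_k th (a * z k).
  by rewrite -shA mulfK.
have -> : (w * e) ^+ N = reflect_factor (f / lam) N * reflect_factor (g / lam) N / (a / lam) ^+ N.
  by rewrite -pow mulfK.
clear - s0 rfl rgl rfa rga rea pcn pdn pcn' pdn' Plq0 Pz0 Pz0' az0 azN0 lzN0 Rb0 Rz0 Pab0 pq QN aen.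
move: s0 rfl rgl rfa rga rea pcn pdn pcn' pdn' Plq0 Pz0 Pz0' az0 azN0 lzN0 Rb0 Rz0 Pab0 pq QN aen.
rewrite !exprS; move: ((a / lam) ^+ N) => s s0.
have sn0 : s ^+ n != 0 by rewrite expf_neq0.
move: (s ^+ n) sn0 => sn sn0.
move: ((q ^+ N) ^+ n) => ? => h1 h2 h3 h4 h5 h6 h7 h8 h9 i1 i2 i3 i4 i5 i6 i7 i8 i9 j1 j2 j3.
by field; rewrite ?(h1, h2, h3, h4, h5, h6, h7, h8, h9, i1, i2, i3, i4, i5, i6, i7, i8, i9, j1, j2, j3) ?s0 ?sn0.
Qed.

End GenericTransformation.

(** * Limits, series and infinite products of complex numbers *)

Section Sequences.
Variable R : realType.
Local Notation C := R[i].
Implicit Types (u v : nat -> C) (l : C).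

(** A positive element of [R[i]] is real, so this is the usual notion; [tendstoP] links it to the
    topology in which [theta] is defined. *)
Definition tendsto u l := forall eps : C, 0 < eps ->
  exists N, forall k, (N <= k)%N -> `|u k - l| < eps.

Lemma tendstoP u l :
  tendsto u l <-> ((u : nat -> R[i]^o) @ \oo --> (l : R[i]^o))%classic.
Proof.
split=> [H|/cvgrPdistC_lt H].
  apply/cvgrPdistC_lt => e e0; have [N HN] := H e e0.
  by exists N => // k /= kN; apply: HN.
by move=> e /H [N _ HN]; exists N => k kN; apply: HN.
Qed.

Lemma tendsto_uniq u l l' : tendsto u l -> tendsto u l' -> l = l'.
Proof. by move=> /tendstoP H /tendstoP H'; apply: (cvg_unique (@norm_hausdorff _ _) H H'). Qed.

Lemma tendsto_lim u l : tendsto u l -> limn (u : nat -> R[i]^o) = l.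
Proof. by move=> /tendstoP H; apply: cvg_lim. Qed.

Lemma tendsto_cst l : tendsto (fun=> l) l.
Proof. by move=> e e0; exists 0%N => k _; rewrite subrr normr0. Qed.

Lemma tendstoD u v l l' : tendsto u l -> tendsto v l' ->
  tendsto (fun k => u k + v k) (l + l').
Proof. by move=> /tendstoP H /tendstoP H'; apply/tendstoP; exact: (cvgD H H'). Qed.

Lemma tendstoM u v l l' : tendsto u l -> tendsto v l' ->
  tendsto (fun k => u k * v k) (l * l').
Proof. by move=> /tendstoP H /tendstoP H'; apply/tendstoP; exact: (cvgM H H'). Qed.

Lemma tendstoN u l : tendsto u l -> tendsto (fun k => - u k) (- l).
Proof. by move=> /tendstoP H; apply/tendstoP; exact: (cvgN H). Qed.

Lemma tendstoV u l : l != 0 -> tendsto u l -> tendsto (fun k => (u k)^-1) l^-1.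
Proof. by move=> l0 /tendstoP H; apply/tendstoP; exact: (cvgV l0 H). Qed.

Lemma eq_tendsto u v l : u =1 v -> tendsto u l -> tendsto v l.
Proof. by move=> E H e /H [N HN]; exists N => k /HN; rewrite E. Qed.

Lemma tendsto_near u v l M : (forall k, (M <= k)%N -> u k = v k) ->
  tendsto u l -> tendsto v l.
Proof.
move=> E H e /H [N HN]; exists (maxn M N) => k; rewrite geq_max => /andP [kM kN].
by rewrite -E // HN.
Qed.

Lemma tendsto_prod (I : Type) (r : seq I) (P : pred I) (u : I -> nat -> C) (l : I -> C) :
  (forall i, P i -> tendsto (u i) (l i)) ->
  tendsto (fun k => \prod_(i <- r | P i) u i k) (\prod_(i <- r | P i) l i).
Proof.
move=> H; elim: r => [|i r IH].
  by rewrite big_nil; apply: (eq_tendsto _ (tendsto_cst 1)) => k; rewrite big_nil.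
rewrite big_cons; case: ifP => Pi.
  by apply: (eq_tendsto _ (tendstoM (H i Pi) IH)) => k; rewrite big_cons Pi.
by apply: (eq_tendsto _ IH) => k; rewrite big_cons Pi.
Qed.

Lemma tendsto_sum (I : Type) (r : seq I) (P : pred I) (u : I -> nat -> C) (l : I -> C) :
  (forall i, P i -> tendsto (u i) (l i)) ->
  tendsto (fun k => \sum_(i <- r | P i) u i k) (\sum_(i <- r | P i) l i).
Proof.
move=> H; elim: r => [|i r IH].
  by rewrite big_nil; apply: (eq_tendsto _ (tendsto_cst 0)) => k; rewrite big_nil.
rewrite big_cons; case: ifP => Pi.
  by apply: (eq_tendsto _ (tendstoD (H i Pi) IH)) => k; rewrite big_cons Pi.
by apply: (eq_tendsto _ IH) => k; rewrite big_cons Pi.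
Qed.

Lemma tendstoX u l n : tendsto u l -> tendsto (fun k => u k ^+ n) (l ^+ n).
Proof.
move=> H; elim: n => [|n IH]; first exact: tendsto_cst.
by rewrite exprS; apply: (eq_tendsto _ (tendstoM H IH)) => k; rewrite exprS.
Qed.

Lemma tendsto_comp (h : nat -> nat) u l : (forall N, exists K, forall k, (K <= k)%N -> (N <= h k)%N) ->
  tendsto u l -> tendsto (fun k => u (h k)) l.
Proof.
move=> hh H e /H [N HN]; have [K HK] := hh N.
by exists K => k /HK; apply: HN.
Qed.

Lemma tendsto_bounded u l : tendsto u l -> exists2 B : C, 0 <= B & forall k, `|u k| <= B.
Proof.
move=> /(_ 1 ltr01) [N HN].
exists (\sum_(i < N) `|u i| + (`|l| + 1)).
  by rewrite addr_ge0 ?addr_ge0 ?sumr_ge0.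
move=> k; have [kN|kN] := leqP N k.
  rewrite ler_wpDl ?sumr_ge0 // -[u k](subrK l) (le_trans (ler_normD _ _)) // addrC.
  by rewrite lerD2l ltW // HN.
rewrite (bigD1 (Ordinal kN)) //= -addrA lerDl addr_ge0 ?addr_ge0 //.
by rewrite sumr_ge0.
Qed.

Lemma tendsto_far u l : l != 0 -> tendsto u l ->
  exists N, forall k, (N <= k)%N -> `|l| / 2 < `|u k|.
Proof.
move=> l0 H; have e0 : 0 < `|l| / 2 by rewrite divr_gt0 ?normr_gt0.
have [N HN] := H _ e0; exists N => k /HN; rewrite distrC => h.
have := ler_normD (l - u k) (u k); rewrite subrK => h'.
have := le_lt_trans h' (ltr_leD h (lexx _)); rewrite -subr_gt0 => h2.
rewrite -subr_gt0; move: h2; congr (0 < _).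
by rewrite {2}[`|l|]splitr; ring.
Qed.

Lemma tendsto_norm_ge u l (d : C) N : (forall k, (N <= k)%N -> d <= `|u k|) ->
  0 < d -> tendsto u l -> l != 0.
Proof.
move=> H d0 /(_ d d0) [M HM]; apply/eqP => l0.
have := HM _ (leq_maxr N M); rewrite l0 subr0 => h.
by have := le_lt_trans (H _ (leq_maxl N M)) h; rewrite ltxx.
Qed.

Lemma complex_gt0_real (e : C) : 0 < e -> exists2 r : R, 0 < r & e = r%:C.
Proof.
move=> e0; have E : (complex.Re e)%:C = e by apply: RRe_real; apply: gtr0_real.
by exists (complex.Re e); rewrite -?ltcR E.
Qed.

Lemma complex_ge0_real (e : C) : 0 <= e -> exists2 r : R, 0 <= r & e = r%:C.
Proof.
move=> e0; have E : (complex.Re e)%:C = e by apply: RRe_real; apply: ger0_real.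
by exists (complex.Re e); rewrite -?lecR E.
Qed.

Lemma tendsto_geometric (K r : C) : 0 <= r < 1 -> tendsto (fun k => K * r ^+ k) 0.
Proof.
move=> /andP [r0 r1]; have [s s0 rs] := complex_ge0_real r0.
have s1 : s < 1 by rewrite -ltcR -rs.
have H : tendsto (fun k => r ^+ k) 0.
  move=> e /complex_gt0_real [f f0 ->].
  have : (s ^+ k @[k --> \oo] --> 0)%classic by apply: cvg_expr; rewrite ger0_norm.
  move/cvgrPdistC_lt => /(_ f f0) [N _ HN]; exists N => k kN.
  have := HN k kN; rewrite /= !subr0 rs -rmorphXn /= ger0_norm ?exprn_ge0 // => h.
  by rewrite ger0_norm ?ltcR // lecR exprn_ge0.
by rewrite -(mulr0 K); apply: tendstoM H; apply: tendsto_cst.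
Qed.

Lemma tendsto_real (u : nat -> R) (l : R) : (u @ \oo --> l)%classic ->
  tendsto (fun k => (u k)%:C) l%:C.
Proof.
move=> /cvgrPdistC_lt H e /complex_gt0_real [f /H [N _ HN] ->].
exists N => k kN; rewrite -rmorphB /= normc_def /= expr0n addr0 sqrtr_sqr ltcR.
exact: HN.
Qed.

(** * Series with a geometric majorant *)

Definition csum (f : nat -> C) : C := limn (fun m => \sum_(i < m) f i : R[i]^o).

Lemma csum_eq (f : nat -> C) l : tendsto (fun m => \sum_(i < m) f i) l -> csum f = l.
Proof. exact: tendsto_lim. Qed.

Section Dominated.
Variable r : C.
Hypothesis r01 : 0 <= r < 1.

Definition dominated (K : C) (f : nat -> C) := forall n, `|f n| <= K * r ^+ n.

Let r0 : 0 <= r. Proof. by case/andP: r01. Qed.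
Let r1 : 0 < 1 - r. Proof. by case/andP: r01 => _; rewrite subr_gt0. Qed.

Let r1' : 0 <= 1 - r. Proof. exact: ltW. Qed.

Lemma real_geometric_cvg (u : nat -> R) (k s : R) : 0 <= k -> 0 <= s < 1 ->
  (forall n, `|u n| <= k * s ^+ n) -> exists l : R, tendsto (fun m => (\sum_(i < m) u i)%:C) l%:C.
Proof.
move=> k0 /andP [s0 s1] uk.
have : cvgn (series u).
  apply: normed_cvg; apply: (@series_le_cvg _ _ (geometric k s)) => //= n.
    by rewrite mulr_ge0 ?exprn_ge0.
  by apply: is_cvg_geometric_series; rewrite ger0_norm.
move=> H; exists (limn (series u)); apply: tendsto_real.
have -> : (fun m => \sum_(i < m) u i) = series u by apply/funext => m; rewrite seriesEord.
exact: H.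
Qed.

(** The real and imaginary parts are real series with the same majorant, for which absolute
    convergence is available. *)
Lemma csum_cvg K f : 0 <= K -> dominated K f ->
  tendsto (fun m => \sum_(i < m) f i) (csum f).
Proof.
move=> K0 fK; have [k k0 Ek] := complex_ge0_real K0; have [s s0 Es] := complex_ge0_real r0.
have s01 : 0 <= s < 1.
  by rewrite s0 -ltcR -Es; case/andP: r01.
have fk n : `|f n| <= (k * s ^+ n)%:C by rewrite rmorphM rmorphXn /= -Ek -Es.
have im_le (x : C) : `|complex.Im x|%:C <= `|x|.
  rewrite normc_def lecR -[X in X <= _]sqrtr_sqr ler_wsqrtr //.
  by rewrite lerDr sqr_ge0.
have [l1 H1] : exists l : R, tendsto (fun m => (\sum_(i < m) complex.Re (f i))%:C) l%:C.
  apply: (@real_geometric_cvg (fun n => complex.Re (f n)) k s) => // n.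
  by rewrite -lecR (le_trans (normc_ge_Re _)).
have [l2 H2] : exists l : R, tendsto (fun m => (\sum_(i < m) complex.Im (f i))%:C) l%:C.
  apply: (@real_geometric_cvg (fun n => complex.Im (f n)) k s) => // n.
  by rewrite -lecR (le_trans (im_le _)).
have H : tendsto (fun m => \sum_(i < m) f i) (l1%:C + 'i * l2%:C).
  apply: (eq_tendsto _ (tendstoD H1 (tendstoM (tendsto_cst 'i) H2))) => m.
  rewrite !rmorph_sum mulr_sumr -big_split /=; apply: eq_bigr => i _.
  by rewrite -complexE.
by rewrite (csum_eq H).
Qed.

Lemma psum_le K f m n : 0 <= K -> dominated K f ->
  `|\sum_(m <= i < n) f i| <= K / (1 - r) * r ^+ m.
Proof.
move=> K0 fK; have [mn|mn] := leqP m n; last first.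
  by rewrite (big_geq (ltnW mn)) normr0 !mulr_ge0 ?invr_ge0 ?exprn_ge0.
have -> : K / (1 - r) * r ^+ m = K * (r ^+ m / (1 - r)) by rewrite mulrAC -mulrA.
apply: le_trans (ler_norm_sum _ _ _) _.
apply: le_trans (ler_sum _ (fun i _ => fK i)) _.
rewrite -mulr_sumr ler_wpM2l // ler_pdivlMr // mulrC.
elim: n mn => [|n IH].
  by rewrite leqn0 => /eqP ->; rewrite big_geq // mulr0.
rewrite leq_eqVlt => /orP [/eqP <-|mn].
  by rewrite big_geq // mulr0 exprn_ge0.
suff : (1 - r) * \sum_(m <= i < n.+1) r ^+ i = r ^+ m - r ^+ n.+1.
  by move=> ->; rewrite gerBl exprn_ge0.
elim: n mn {IH} => [|n IH].
  by rewrite ltnS leqn0 => /eqP ->; rewrite big_nat1 expr0 mulr1.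
rewrite ltnS leq_eqVlt => /orP [/eqP ->|mn].
  by rewrite big_nat1 !exprS; ring.
by rewrite big_nat_recr ?mulrDr ?IH //=; [rewrite (exprS _ n.+1); ring | rewrite ltnW].
Qed.

Lemma tendsto_le u l (b : C) N : (forall k, (N <= k)%N -> `|u k| <= b) ->
  tendsto u l -> `|l| <= b.
Proof.
move=> H ul; have b0 : 0 <= b by apply: le_trans (H N (leqnn N)).
have [c c0 bE] := complex_ge0_real b0.
have [d d0 lE] := complex_ge0_real (normr_ge0 l).
rewrite lE bE lecR leNgt; apply/negP => cd.
have : 0 < (d - c)%:C by rewrite ltcR subr_gt0.
move=> /ul [M HM]; have := HM _ (leq_maxr N M); have := H _ (leq_maxl N M).
set k := maxn N M => h1 h2.
have := le_lt_trans (ler_normD (l - u k) (u k)).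
rewrite subrK lE distrC => /(_ (d%:C)) h.
have : `|u k - l| + `|u k| < d%:C.
  have -> : d%:C = (d - c)%:C + c%:C by rewrite -rmorphD subrK.
  by rewrite -bE; apply: ltr_leD.
by move=> /h; rewrite ltxx.
Qed.

Lemma csum_tail K f m : 0 <= K -> dominated K f ->
  `|csum f - \sum_(i < m) f i| <= K / (1 - r) * r ^+ m.
Proof.
move=> K0 fK; have H := csum_cvg K0 fK.
have H' := tendstoD H (tendstoN (tendsto_cst (\sum_(i < m) f i))).
apply: (tendsto_le (N := m) _ H') => k mk.
rewrite -!(big_mkord xpredT) /= (@big_cat_nat _ _ _ m) //= addrAC subrr add0r.
exact: psum_le.
Qed.

Lemma csum_le K f : 0 <= K -> dominated K f -> `|csum f| <= K / (1 - r).
Proof.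
by move=> K0 /(csum_tail 0 K0); rewrite big_ord0 subr0 expr0 mulr1.
Qed.

Lemma csumD K K' f g : 0 <= K -> 0 <= K' -> dominated K f -> dominated K' g ->
  csum (fun n => f n + g n) = csum f + csum g.
Proof.
move=> K0 K'0 fK gK; apply: csum_eq.
apply: (eq_tendsto _ (tendstoD (csum_cvg K0 fK) (csum_cvg K'0 gK))) => m.
by rewrite -big_split.
Qed.

(** Dominated convergence: the common majorant gives one index [m] beyond which all tails are below
    [e / 3], and before it there are finitely many limits. *)
Lemma tannery K (a : nat -> nat -> C) (b : nat -> C) : 0 <= K ->
  (forall k, dominated K (a k)) -> (forall n, tendsto (fun k => a k n) (b n)) ->
  tendsto (fun k => csum (a k)) (csum b).
Proof.
move=> K0 aK ab; have bK : dominated K b.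
  by move=> n; apply: (tendsto_le (N := 0) _ (ab n)) => k _; apply: aK.
move=> e e0; have e30 : 0 < e / 3%:R by rewrite divr_gt0 ?ltr0n.
have [m /(_ m (leqnn m))] := tendsto_geometric (K / (1 - r)) r01 e30.
rewrite subr0 ger0_norm; last by rewrite !mulr_ge0 ?invr_ge0 ?exprn_ge0.
move=> Hm.
have [N HN] := tendsto_sum (index_enum 'I_m) (P := xpredT) (fun i _ => ab i) e30.
exists N => k kN.
have -> : csum (a k) - csum b = (csum (a k) - \sum_(i < m) a k i) +
   (\sum_(i < m) a k i - \sum_(i < m) b i) - (csum b - \sum_(i < m) b i) by ring.
have -> : e = e / 3%:R + e / 3%:R + e / 3%:R.
  by field.
apply: le_lt_trans (ler_normB _ _) _; apply: ltrD; last first.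
  by apply: le_lt_trans Hm; apply: csum_tail.
apply: le_lt_trans (ler_normD _ _) _; apply: ltrD; last exact: HN.
by apply: le_lt_trans Hm; apply: csum_tail.
Qed.

Lemma csum_sum K (I : Type) (s : seq I) (h : I -> nat -> C) : 0 <= K ->
  (forall i, dominated K (h i)) ->
  csum (fun n => \sum_(i <- s) h i n) = \sum_(i <- s) csum (h i).
Proof.
move=> K0 hK; apply: csum_eq.
apply: (eq_tendsto _ (tendsto_sum s (P := xpredT) (fun i _ => csum_cvg K0 (hK i)))) => m.
by rewrite exchange_big.
Qed.

(** Finite sums over [m] commute with the sum over [n]; [tannery] then lets their length tend to
    infinity. *)
Lemma csum_fubini K (h : nat -> nat -> C) : 0 <= K ->
  (forall m n, `|h m n| <= K * r ^+ m * r ^+ n) ->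
  csum (fun m => csum (fun n => h m n)) = csum (fun n => csum (fun m => h m n)).
Proof.
move=> K0 hK; set K' := K / (1 - r).
have K'0 : 0 <= K' by rewrite mulr_ge0 ?invr_ge0.
have rx n : r ^+ n <= 1 by rewrite exprn_ile1 // ltW //; case/andP: r01.
have dh m : dominated K (h m).
  by move=> n; apply: le_trans (hK m n) _; rewrite ler_wpM2r ?exprn_ge0 // ler_piMr.
have dh' n : dominated (K * r ^+ n) (fun m => h m n).
  by move=> m; apply: le_trans (hK m n) _; rewrite mulrAC.
have dH : dominated K' (fun m => csum (h m)).
  move=> m; have /csum_le : dominated (K * r ^+ m) (h m) by move=> n; apply: hK.
  by rewrite mulrAC => -> //; rewrite mulr_ge0 ?exprn_ge0.
apply: (tendsto_uniq (csum_cvg K'0 dH)).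
apply: (@eq_tendsto (fun M => csum (fun n => \sum_(m < M) h m n))).
  by move=> M; exact: (@csum_sum K _ _ (fun (m : 'I_M) n => h m n) K0 (fun m => dh m)).
apply: (@tannery K') => // [M n|n]; last first.
  by apply: csum_cvg (dh' n); rewrite mulr_ge0 ?exprn_ge0.
rewrite -(big_mkord xpredT (fun m => h m n)).
have /(psum_le 0 M) : dominated (K * r ^+ n) (fun m => h m n) by exact: dh'.
by rewrite expr0 mulr1 mulrAC => -> //; rewrite mulr_ge0 ?exprn_ge0.
Qed.

(** * Infinite products *)

Lemma prod1B_ge (x : nat -> C) J m : (forall j, 0 <= x j) ->
  (forall n, \sum_(J <= j < n) x j <= 1) ->
  1 - \sum_(J <= j < m) x j <= \prod_(J <= j < m) (1 - x j).
Proof.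
move=> x0 xs; have [mJ|Jm] := leqP m J; first by rewrite !big_geq // subr0.
have x1 j : (J <= j)%N -> x j <= 1.
  move=> Jj; apply: le_trans (xs j.+1); rewrite big_nat_recr //= lerDr.
  by rewrite sumr_ge0.
elim: m {Jm} => [|m IH]; first by rewrite !big_geq // subr0.
have [mJ|Jm] := leqP m.+1 J; first by rewrite !big_geq // subr0.
rewrite !big_nat_recr //=; apply: (@le_trans _ _ ((1 - \sum_(J <= j < m) x j) * (1 - x m))).
  rewrite -subr_ge0; set S := \sum_(_ <= _ < _) _.
  have -> : (1 - S) * (1 - x m) - (1 - (S + x m)) = S * x m by ring.
  by rewrite mulr_ge0 // sumr_ge0.
by rewrite ler_wpM2r // subr_ge0 x1.
Qed.

(** The partial products [P_m] have increments [- u_m P_m]; once they are known to be bounded, they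
    are partial sums of a dominated series. The limit is nonzero because, from an index [J] where
    the remaining sum of the [|u j|] is at most 1/2, the remaining product has modulus at least
    1/2. *)
Lemma infinite_prod K (u : nat -> C) : 0 <= K -> dominated K u ->
  exists2 l, tendsto (fun m => \prod_(j < m) (1 - u j)) l &
    (forall j, u j != 1) -> l != 0.
Proof.
move=> K0 uK; have half0 : 0 < (2^-1 : C) by rewrite invr_gt0 ltr0n.
have half1 : (2^-1 : C) <= 1 by rewrite invf_le1 ?ltr0n // ler1n.
have [J /(_ J (leqnn J))] := tendsto_geometric (K / (1 - r)) r01 half0.
rewrite subr0 ger0_norm; last by rewrite !mulr_ge0 ?invr_ge0 ?exprn_ge0.
move=> /ltW HJ.
pose x j := `|u j|.
have x0 j : 0 <= x j by rewrite normr_ge0.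
have xs n : \sum_(J <= j < n) x j <= 2^-1.
  have xK : dominated K x by move=> j; rewrite /x normr_id.
  apply: le_trans HJ; apply: le_trans (psum_le J n K0 xK).
  by rewrite ger0_norm // sumr_ge0.
have lowx m : 2^-1 <= \prod_(J <= j < m) (1 - x j).
  have H := @prod1B_ge x J m x0 (fun n => le_trans (xs n) half1).
  apply: le_trans H; rewrite lerBrDr -lerBrDl; apply: le_trans (xs m) _.
  by rewrite lerBrDr (_ : (2^-1 : C) + 2^-1 = 1) //; field.
have x1 j : (J <= j)%N -> 0 <= 1 - x j.
  move=> Jj; rewrite subr_ge0; apply: le_trans half1; apply: le_trans (xs j.+1).
  by rewrite big_nat_recr //= lerDr sumr_ge0.
have low m : 2^-1 <= `|\prod_(J <= j < m) (1 - u j)|.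
  apply: le_trans (lowx m) _; rewrite normr_prod big_nat [leRHS]big_nat.
  apply: ler_prod => j /andP [Jj _]; rewrite x1 //=.
  by have := lerB_dist 1 (u j); rewrite normr1.
(* From [(1 + x j) * (1 - x j) <= 1] and the lower bound [lowx]. *)
have upx m : \prod_(J <= j < m) (1 + x j) <= 2.
  have : \prod_(J <= j < m) (1 + x j) * \prod_(J <= j < m) (1 - x j) <= 1.
    apply: (@le_trans _ _ (\prod_(J <= j < m) 1)); last by rewrite big1.
    rewrite -big_split /= big_nat [leRHS]big_nat; apply: ler_prod => j /andP [Jj _].
    rewrite mulr_ge0 ?x1 ?addr_ge0 //=.
    have -> : (1 + x j) * (1 - x j) = 1 - x j ^+ 2 by ring.
    by rewrite gerBl exprn_ge0.
  have P0 : 0 <= \prod_(J <= j < m) (1 + x j) by apply: prodr_ge0 => j _; rewrite addr_ge0.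
  move=> h; have := le_trans (ler_wpM2l P0 (lowx m)) h.
  by rewrite ler_pdivrMr ?ltr0n // mul1r.
pose A := \prod_(0 <= j < J) (1 + x j).
have A0 : 0 <= A by apply: prodr_ge0 => j _; rewrite addr_ge0.
have up m : `|\prod_(j < m) (1 - u j)| <= A * 2.
  rewrite -(big_mkord xpredT (fun j => 1 - u j)) normr_prod.
  apply: (@le_trans _ _ (\prod_(0 <= j < m) (1 + x j))).
    apply: ler_prod => j _; rewrite normr_ge0 /=.
    by have := ler_normB 1 (u j); rewrite normr1.
  apply: (@le_trans _ _ (\prod_(0 <= j < maxn J m) (1 + x j))).
    rewrite (@big_cat_nat _ _ _ m _ (maxn J m)) ?leq_maxr //= ler_peMr //.
      by apply: prodr_ge0 => j _; rewrite addr_ge0.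
    apply: (@le_trans _ _ (\prod_(m <= j < maxn J m) 1)); first by rewrite big1.
    by apply: ler_prod => j _; rewrite ler01 lerDl x0.
  rewrite (@big_cat_nat _ _ _ J _ (maxn J m)) ?leq_maxl //= ler_wpM2l //.
have dd : dominated (K * (A * 2)) (fun m => - (u m * \prod_(j < m) (1 - u j))).
  move=> m; rewrite normrN normrM mulrAC; apply: ler_pM => //; exact: uK.
have A20 : 0 <= A * 2 by rewrite mulr_ge0.
have H := csum_cvg (mulr_ge0 K0 A20) dd.
have tot m : 1 + \sum_(i < m) - (u i * \prod_(j < i) (1 - u j)) = \prod_(j < m) (1 - u j).
  elim: m => [|m IH]; first by rewrite !big_ord0 addr0.
  by rewrite !big_ord_recr /= addrA IH; ring.
have H' := eq_tendsto tot (tendstoD (tendsto_cst 1) H).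
exists (1 + csum (fun m => - (u m * \prod_(j < m) (1 - u j)))) => // un.
have AJ : 0 < `|\prod_(j < J) (1 - u j)|.
  by rewrite normr_gt0; apply/prodf_neq0 => j _; rewrite subr_eq0 eq_sym.
apply: (@tendsto_norm_ge _ _ (`|\prod_(j < J) (1 - u j)| / 2) J _ _ H'); last first.
  by rewrite mulr_gt0.
move=> m Jm; rewrite -!(big_mkord xpredT (fun j => 1 - u j)).
by rewrite (@big_cat_nat _ _ _ J _ m) //= normrM ler_wpM2l.
Qed.

(** * Series over the integers *)

Definition zsum (f : int -> C) : C := csum (fun n => f (Posz n) + f (Negz n)).

Definition zdom (K : C) (f : int -> C) := forall i : int, `|f i| <= K * r ^+ `|i|%N.

Lemma zdom_dominated K f : 0 <= K -> zdom K f ->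
  dominated (2 * K) (fun n => f (Posz n) + f (Negz n)).
Proof.
move=> K0 fK n; apply: le_trans (ler_normD _ _) _.
rewrite mulr_natl mulr2n mulrDl; apply: lerD; first exact: fK.
apply: le_trans (fK _) _; rewrite ler_wpM2l //= exprS ler_piMl ?exprn_ge0 //.
by apply: ltW; case/andP: r01.
Qed.

Lemma zsum_cvg K f : 0 <= K -> zdom K f ->
  tendsto (fun m => \sum_(n < m) (f (Posz n) + f (Negz n))) (zsum f).
Proof.
move=> K0 fK; apply: (@csum_cvg (2 * K)); first by rewrite mulr_ge0.
exact: zdom_dominated.
Qed.

Lemma zsum_eq f l : tendsto (fun m => \sum_(n < m) (f (Posz n) + f (Negz n))) l -> zsum f = l.
Proof. exact: csum_eq. Qed.

Lemma eq_zsum f g : f =1 g -> zsum f = zsum g.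
Proof. by move=> E; congr csum; apply/funext => n; rewrite !E. Qed.

Lemma zsumD K K' f g : 0 <= K -> 0 <= K' -> zdom K f -> zdom K' g ->
  zsum (fun i => f i + g i) = zsum f + zsum g.
Proof.
move=> K0 K'0 fK gK; apply: zsum_eq.
apply: (eq_tendsto _ (tendstoD (zsum_cvg K0 fK) (zsum_cvg K'0 gK))) => m.
by rewrite -big_split; apply: eq_bigr => n _; rewrite addrACA.
Qed.

Lemma zsumZ K c f : 0 <= K -> zdom K f -> zsum (fun i => c * f i) = c * zsum f.
Proof.
move=> K0 fK; apply: zsum_eq.
apply: (eq_tendsto _ (tendstoM (tendsto_cst c) (zsum_cvg K0 fK))) => m.
by rewrite mulr_sumr; apply: eq_bigr => n _; rewrite mulrDr.
Qed.

Lemma ztannery K (a : nat -> int -> C) (b : int -> C) : 0 <= K ->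
  (forall k, zdom K (a k)) -> (forall i, tendsto (fun k => a k i) (b i)) ->
  tendsto (fun k => zsum (a k)) (zsum b).
Proof.
move=> K0 aK ab; apply: (@tannery (2 * K)); first by rewrite mulr_ge0.
  by move=> k; apply: zdom_dominated.
by move=> n; apply: tendstoD.
Qed.

Lemma zdom_tends0 K f (h : nat -> int) : 0 <= K -> zdom K f ->
  (forall n, `|h n|%N = n) -> tendsto (fun n => f (h n)) 0.
Proof.
move=> K0 fK hn e e0; have [N HN] := tendsto_geometric K r01 e0.
exists N => k /HN; rewrite !subr0; apply: le_lt_trans.
by rewrite [leRHS]ger0_norm ?mulr_ge0 ?exprn_ge0 //; have := fK (h k); rewrite hn.
Qed.

(** The first [m] pairs of the right-hand series exhaust the first [2m] pairs of the left-hand one,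
    so its partial sums form a subsequence. *)
Lemma zsum_even_odd K f : 0 <= K -> zdom K f ->
  zsum f = zsum (fun i => f (2 * i) + f (2 * i + 1)).
Proof.
move=> K0 fK; apply/esym/zsum_eq.
have H : forall N, exists M, forall k, (M <= k)%N -> (N <= k.*2)%N.
  by move=> N; exists N => k; lia.
apply: (eq_tendsto _ (tendsto_comp H (zsum_cvg K0 fK))); elim=> [|m IH].
  by rewrite !big_ord0.
rewrite doubleS !big_ord_recr /= IH.
have -> : 2 * Posz m = Posz m.*2 by lia.
have -> : Posz m.*2 + 1 = Posz m.*2.+1 by lia.
have -> : 2 * Negz m = Negz m.*2.+1 by lia.
have -> : Negz m.*2.+1 + 1 = Negz m.*2 by lia.
by ring.
Qed.

Lemma zsum_fubini K (h : int -> int -> C) : 0 <= K ->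
  (forall i j, `|h i j| <= K * r ^+ `|i|%N * r ^+ `|j|%N) ->
  zsum (fun i => zsum (fun j => h i j)) = zsum (fun j => zsum (fun i => h i j)).
Proof.
move=> K0 hK.
have Kr i : 0 <= K * r ^+ `|i|%N by rewrite mulr_ge0 ?exprn_ge0.
have d1 i : dominated (2 * (K * r ^+ `|i|%N)) (fun n => h i (Posz n) + h i (Negz n)).
  by apply: zdom_dominated => // j; apply: hK.
have d2 j : dominated (2 * (K * r ^+ `|j|%N)) (fun n => h (Posz n) j + h (Negz n) j).
  by apply: (@zdom_dominated _ (fun i => h i j)) => // i; rewrite mulrAC.
have Kr2 i : 0 <= 2 * (K * r ^+ `|i|%N) by rewrite mulr_ge0.
pose H m n := h (Posz m) (Posz n) + h (Posz m) (Negz n) +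
              (h (Negz m) (Posz n) + h (Negz m) (Negz n)).
transitivity (csum (fun m => csum (fun n => H m n))).
  congr csum; apply/funext => m; rewrite -(csumD (Kr2 _) (Kr2 _) (d1 _) (d1 _)).
  by [].
transitivity (csum (fun n => csum (fun m => H m n))); last first.
  congr csum; apply/funext => n; rewrite -(csumD (Kr2 _) (Kr2 _) (d2 _) (d2 _)).
  by congr csum; apply/funext => m; rewrite /H addrACA.
apply: (@csum_fubini (2 * (2 * K))); first by rewrite !mulr_ge0.
have rS m : r ^+ m.+1 <= r ^+ m.
  by rewrite exprS ler_piMl ?exprn_ge0 // ltW //; case/andP: r01.
move=> m n; apply: le_trans (ler_normD _ _) _.
rewrite -!mulrA mulr_natl mulr2n; apply: lerD.
  apply: le_trans (d1 _ _) _; rewrite -!mulrA lexx //.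
apply: le_trans (d1 _ _) _; rewrite -!mulrA ler_wpM2l // ler_wpM2l //.
by rewrite ler_wpM2r ?exprn_ge0 //; apply: rS.
Qed.

Hypothesis rp : 0 < r.

Lemma zdom_shift1 K f : 0 <= K -> zdom K f -> zdom (K / r) (fun i => f (i + 1)).
Proof.
move=> K0 fK i; apply: le_trans (fK _) _.
rewrite -mulrA ler_wpM2l // ler_pdivlMl // -exprS.
apply: ler_wiXn2l => //; last by lia.
by apply: ltW; case/andP: r01.
Qed.

Lemma zdom_shiftN1 K f : 0 <= K -> zdom K f -> zdom (K / r) (fun i => f (i - 1)).
Proof.
move=> K0 fK i; apply: le_trans (fK _) _.
rewrite -mulrA ler_wpM2l // ler_pdivlMl // -exprS.
apply: ler_wiXn2l => //; last by lia.
by apply: ltW; case/andP: r01.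
Qed.

(** The partial sums of the two sides differ by [f m - f (- m)], which tends to zero. *)
Lemma zsum_shift1 K f : 0 <= K -> zdom K f -> zsum (fun i => f (i + 1)) = zsum f.
Proof.
move=> K0 fK; apply: zsum_eq.
have H1 : tendsto (fun n => f (Posz n)) 0 by apply: (zdom_tends0 (h := Posz) K0 fK).
have H2 : tendsto (fun n => f (- Posz n)) 0.
  by apply: (zdom_tends0 (h := fun n => - Posz n) K0 fK) => n; lia.
have := tendstoD (zsum_cvg K0 fK) (tendstoD H1 (tendstoN H2)).
rewrite oppr0 !addr0; apply: eq_tendsto; elim=> [|m IH].
  by rewrite !big_ord0 oppr0 subrr addr0.
rewrite [in RHS]big_ord_recr /= -IH big_ord_recr /=.
have -> : Posz m + 1 = Posz m.+1 by lia.
have -> : Negz m + 1 = - Posz m by lia.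
have -> : - Posz m.+1 = Negz m by lia.
by ring.
Qed.

Lemma zsum_shift K f (s : int) : 0 <= K -> zdom K f -> zsum (fun i => f (i + s)) = zsum f.
Proof.
have pos n : forall K f, 0 <= K -> zdom K f ->
    zsum (fun i => f (i + Posz n)) = zsum f /\ zsum (fun i => f (i - Posz n)) = zsum f.
  elim: n => [|n IH] {}K {}f K0 fK.
    by split; apply: eq_zsum => i; rewrite ?subr0 ?addr0.
  have Kr : 0 <= K / r by rewrite divr_ge0.
  split.
    rewrite -[RHS](zsum_shift1 K0 fK) -[RHS](IH _ _ Kr (zdom_shift1 K0 fK)).1.
    by apply: eq_zsum => i; congr f; lia.
  have fK' := zdom_shiftN1 K0 fK.
  transitivity (zsum (fun i => f (i - 1))).
    rewrite -[RHS](IH _ _ Kr fK').2.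
    by apply: eq_zsum => i; congr f; lia.
  rewrite -(zsum_shift1 Kr fK').
  by apply: eq_zsum => i; congr f; lia.
move=> K0 fK; case: s => n; first by case: (pos n K f K0 fK).
case: (pos n.+1 K f K0 fK) => _ <-; apply: eq_zsum => i; congr f; lia.
Qed.

End Dominated.

(** * Zeros of the theta function *)

Section ThetaFunction.
Variable p : C.
Hypothesis hp : `|p| < 1.

(** Strictly between [|p|] and 1, and positive even for [p = 0], since shifting a series over the
    integers divides the constant of its majorant by this radius. *)
Definition rad : C := (1 + `|p|) / 2.
Local Notation r := rad.

Lemma rad01 : 0 <= r < 1.
Proof.
rewrite /rad divr_ge0 ?addr_ge0 //= ltr_pdivrMr ?ltr0n // mul1r.
by rewrite -[ltRHS]/(1 + 1) ltrD2l.
Qed.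

Lemma rad_gt0 : 0 < r.
Proof. by rewrite /rad divr_gt0 ?ltr0n // ltr_wpDr. Qed.

Lemma norm_le_rad : `|p| <= r.
Proof.
rewrite /rad ler_pdivlMr ?ltr0n // mulrDr mulr1 lerD2r; exact: ltW.
Qed.

Lemma rad_le1 : r <= 1. Proof. by apply: ltW; case/andP: rad01. Qed.

Lemma pow_dom (c : C) : dominated r `|c| (fun j => p ^+ j * c).
Proof.
move=> j; rewrite normrM mulrC normrX ler_wpM2l // lerXn2r ?nnegrE ?norm_le_rad //.
by apply: ltW rad_gt0.
Qed.

Lemma theta_prod (x : C) : exists u v : C,
  [/\ tendsto (fun m => \prod_(0 <= j < m) ((1 - p ^+ j * x) * (1 - p ^+ j.+1 / x))) (u * v),
    (forall j, p ^+ j * x != 1) -> u != 0 & (forall j, p ^+ j.+1 / x != 1) -> v != 0].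
Proof.
have [u Hu u0] := infinite_prod rad01 (normr_ge0 x) (pow_dom x).
have d2 : dominated r `|p / x| (fun j => p ^+ j.+1 / x).
  by move=> j; rewrite exprSr -mulrA; apply: pow_dom.
have [v Hv v0] := infinite_prod rad01 (normr_ge0 _) d2.
exists u, v; split=> //; apply: (eq_tendsto _ (tendstoM Hu Hv)) => m.
by rewrite -big_split /= big_mkord.
Qed.

Lemma theta_cvg (x : C) :
  tendsto (fun m => \prod_(0 <= j < m) ((1 - p ^+ j * x) * (1 - p ^+ j.+1 / x))) (theta p x).
Proof. by have [u [v [H _ _]]] := theta_prod x; rewrite /theta (tendsto_lim H). Qed.

Lemma theta_neq0 (x : C) : (forall j, p ^+ j * x != 1) -> (forall j, p ^+ j.+1 / x != 1) ->
  theta p x != 0.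
Proof.
have [u [v [H u0 v0]]] := theta_prod x; move=> /u0 {}u0 /v0 {}v0.
by rewrite (tendsto_uniq (theta_cvg x) H) mulf_neq0.
Qed.

Lemma theta_eq0 (x : C) j : (p ^+ j * x == 1) || (p ^+ j.+1 / x == 1) -> theta p x = 0.
Proof.
move=> E; apply: (tendsto_uniq (theta_cvg x)).
apply: (@tendsto_near _ _ _ j.+1 _ (tendsto_cst 0)) => k jk; apply/esym.
rewrite (@big_cat_nat _ _ _ j.+1) //= big_nat_recr //=.
by case/orP: E => /eqP ->; rewrite subrr ?mul0r ?mulr0 mul0r.
Qed.

(** The integer powers of [p], written without inverses so as to include [p = 0], where 1 is the
    only nonzero one. *)
Definition theta_root (x : C) := exists j, p ^+ j * x = 1 \/ x = p ^+ j.

Lemma theta_rootP x : x != 0 -> theta p x = 0 <-> theta_root x.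
Proof.
move=> x0; split=> [tx|[j [E|E]]].
- apply: contrapT => nr; have /eqP := tx; apply/negP; apply: theta_neq0 => j; apply/eqP => E.
    by apply: nr; exists j; left.
  apply: nr; exists j.+1; right; apply/esym.
  by apply: (mulIf (invr_neq0 x0)); rewrite E mulfV.
- by apply: (@theta_eq0 _ j); rewrite E eqxx.
case: j E => [|j] E; first by apply: (@theta_eq0 _ 0%N); rewrite E mulr1 eqxx.
by apply: (@theta_eq0 _ j); rewrite -E divff ?eqxx ?orbT.
Qed.

Lemma theta_root_div x y : x != 0 -> y != 0 -> theta_root x -> theta_root y -> theta_root (x / y).
Proof.
move=> x0 y0 [j Ej] [l El].
have pn0 k c : p ^+ k * c = 1 -> p ^+ k != 0.
  by move=> E; apply: contra_eq_neq E => ->; rewrite mul0r eq_sym oner_eq0.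
have xV k c : p ^+ k * c = 1 -> c = (p ^+ k)^-1.
  by move=> E; apply: (mulfI (pn0 _ _ E)); rewrite E mulfV ?(pn0 _ _ E).
case: Ej => Ej; case: El => El.
- have [jl|lj] := leqP j l.
    exists (l - j)%N; right; rewrite (xV _ _ Ej) (xV _ _ El) invrK.
    apply: (mulfI (pn0 _ _ Ej)); rewrite mulrA divff ?mul1r ?(pn0 _ _ Ej) //.
    by rewrite -exprD subnKC.
  exists (j - l)%N; left; rewrite (xV _ _ Ej) (xV _ _ El) invrK mulrCA -exprD.
  by rewrite subnK 1?ltnW // mulVf // (pn0 _ _ Ej).
- exists (j + l)%N; left.
  by rewrite exprD -El mulrACA divff // mulr1 Ej.
- by exists (j + l)%N; right; rewrite exprD -Ej (xV _ _ El) invrK.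
- rewrite Ej El in x0 y0 *; have [lj|jl] := leqP l j.
    by exists (j - l)%N; right; rewrite -{1}(subnK lj) exprD mulfK.
  exists (l - j)%N; left; rewrite mulrA -exprD subnK ?divff //; exact: ltnW.
Qed.

Lemma theta_div0 x y : x != 0 -> y != 0 -> theta p x = 0 -> theta p y = 0 -> theta p (x / y) = 0.
Proof.
move=> x0 y0 /theta_rootP tx /theta_rootP ty.
by apply/theta_rootP; rewrite ?mulf_neq0 ?invr_neq0 //; apply: theta_root_div; auto.
Qed.

Lemma theta1 : theta p 1 = 0.
Proof. by apply: (@theta_eq0 _ 0%N); rewrite mulr1 eqxx. Qed.

(** Isolates the zero at 1: every other zero has modulus at most [|p|] or at least [1/|p|]. *)
Lemma theta_near1 (x : C) : `|p| < `|x| -> `|p| * `|x| < 1 -> x != 1 -> theta p x != 0.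
Proof.
move=> px px1 x1; have x0 : x != 0 by rewrite -normr_gt0 (le_lt_trans _ px).
apply/eqP => /(theta_rootP x0) [[|j] [E|E]].
- by rewrite mul1r in E; rewrite E eqxx in x1.
- by rewrite E eqxx in x1.
- have := congr1 Num.norm E; rewrite normr1 normrM normrX exprSr -mulrA => E'.
  have : `|p| ^+ j * (`|p| * `|x|) < 1.
    apply: le_lt_trans px1; rewrite ler_piMl ?mulr_ge0 //.
    by rewrite exprn_ile1 // ltW.
  by rewrite E' ltxx.
have : `|x| <= `|p|.
  by rewrite E normrX exprS ler_piMr // exprn_ile1 // ltW.
by move=> /(lt_le_trans px); rewrite ltxx.
Qed.

End ThetaFunction.
End Sequences.

(** * The Jacobi triple product *)

Section ThetaSeries.
Variable R : realType.
Local Notation C := R[i].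
Variable p : C.
Hypothesis hp : `|p| < 1.
Local Notation r := (rad p).
Let r01 := rad01 hp.
Let rp := rad_gt0 p.

(* The exponent [i (i - 1) / 2] as a natural number. *)
Definition texp (i : int) : nat :=
  match i with Posz n => 'C(n, 2) | Negz n => 'C(n.+2, 2) end.

Lemma binn2E n : ('C(n, 2) * 2 = n * n.-1)%N.
Proof. by elim: n => [|[|n] IH] //; rewrite binS mulnDl IH bin1 -mulnDr addn2 mulnC. Qed.

Lemma texpE (i : int) : (texp i)%:Z * 2 = i * i - i.
Proof.
have H n : ('C(n.+1, 2))%:Z * 2 = n.+1%:Z * n%:Z by rewrite -!PoszM binn2E.
by case: i => [[|n]|n] //=; rewrite H ?NegzE !intS; ring.
Qed.

Definition theta_coef (i : int) : C := (-1) ^+ `|i|%N * p ^+ texp i.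

Lemma texp_ge (i : int) : ('C(`|i|, 2) <= texp i)%N.
Proof. by case: i => n //=; rewrite leq_bin2l. Qed.

(** Consecutive values of [w] have ratio [s * |p|^n], eventually below 1, so [w] stops growing at
    some [J]; the sum of its values up to [J] bounds it throughout. *)
Lemma theta_coef_growth (s : C) : 0 <= s ->
  exists2 K : C, 0 <= K & forall i, `|theta_coef i| * s ^+ `|i|%N <= K.
Proof.
move=> s0; pose w n := `|p| ^+ 'C(n, 2) * s ^+ n.
have w0 n : 0 <= w n by rewrite mulr_ge0 ?exprn_ge0.
have wS n : w n.+1 = w n * (s * `|p| ^+ n).
  by rewrite /w binS bin1 exprD exprS; ring.
have p01 : 0 <= `|p| < 1 by rewrite normr_ge0.
have [J HJ] := tendsto_geometric s p01 ltr01.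
have K0 : 0 <= \sum_(n < J.+1) w n by rewrite sumr_ge0.
exists (\sum_(n < J.+1) w n) => // i.
apply: (@le_trans _ _ (w `|i|%N)).
  rewrite /w ler_wpM2r ?exprn_ge0 // /theta_coef normrM !normrX normrN1 expr1n mul1r.
  by apply: ler_wiXn2l (texp_ge i) => //; apply: ltW.
move: (`|i|%N) => n; have [nJ|Jn] := leqP n J.
  by rewrite (bigD1 (Ordinal (nJ : (n < J.+1)%N))) //= lerDl sumr_ge0.
apply: (@le_trans _ _ (w J)); last first.
  by rewrite (bigD1 ord_max) //= lerDl sumr_ge0.
elim: n Jn => // n IH; rewrite ltnS leq_eqVlt => /orP [/eqP <-|Jn].
  rewrite wS ler_piMr //; have := HJ J (leqnn J).
  by rewrite subr0 ger0_norm ?mulr_ge0 ?exprn_ge0 // => /ltW.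
apply: le_trans (IH Jn); rewrite wS ler_piMr //; have := HJ n (ltnW Jn).
by rewrite subr0 ger0_norm ?mulr_ge0 ?exprn_ge0 // => /ltW.
Qed.

Lemma norm_exprz_le (x B : C) (i : int) : x != 0 -> `|x| <= B -> `|x^-1| <= B ->
  `|x ^ i| <= B ^+ `|i|%N.
Proof.
move=> x0 xB xB'; have B0 : 0 <= B by apply: le_trans xB.
case: i => n; first by rewrite -exprnP normrX lerXn2r ?nnegrE.
by rewrite NegzE -exprnN -exprVn normrX lerXn2r ?nnegrE.
Qed.

(* The square of the radius leaves room for the double series below. *)
Lemma theta_coef_dom (B : C) : 0 <= B ->
  exists2 K : C, 0 <= K & forall (x : C) (i : int), x != 0 -> `|x| <= B -> `|x^-1| <= B ->
    `|theta_coef i * x ^ i| <= K * (r ^+ 2) ^+ `|i|%N.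
Proof.
move=> B0; have r20 : 0 < r ^+ 2 by rewrite exprn_gt0.
have [|K K0 HK] := @theta_coef_growth (B / r ^+ 2).
  by rewrite divr_ge0 // ltW.
exists K => // x i x0 xB xB'.
apply: le_trans (ler_wpM2r _ (HK i)); last by rewrite exprn_ge0 // ltW.
rewrite normrM -mulrA ler_wpM2l // expr_div_n divfK ?expf_neq0 ?gt_eqF //.
exact: norm_exprz_le.
Qed.

Lemma theta_coef_zdom (B : C) : 0 <= B ->
  exists2 K : C, 0 <= K & forall x : C, x != 0 -> `|x| <= B -> `|x^-1| <= B ->
    zdom r K (fun i => theta_coef i * x ^ i).
Proof.
move=> B0; have [K K0 HK] := theta_coef_dom B0; exists K => // x x0 xB xB' i.
apply: le_trans (HK x i x0 xB xB') _; rewrite ler_wpM2l // lerXn2r ?nnegrE ?exprn_ge0 // ?(ltW rp) //.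
by rewrite expr2 ler_piMr ?(ltW rp) ?rad_le1.
Qed.

Lemma theta_coef_zdom1 (x : C) : x != 0 ->
  exists2 K : C, 0 <= K & zdom r K (fun i => theta_coef i * x ^ i).
Proof.
move=> x0; have [|K K0 HK] := @theta_coef_zdom (`|x| + `|x^-1|); first by rewrite addr_ge0.
by exists K => //; apply: HK => //; rewrite ?lerDl ?lerDr.
Qed.

(** * The finite form of the triple product and its limit *)

Definition qfact k := \prod_(j < k) (1 - p ^+ j.+1).

Lemma onem_pow_neq0 k : 1 - p ^+ k.+1 != 0.
Proof.
rewrite subr_eq0; apply/eqP => E; have := congr1 Num.norm E; rewrite normr1 normrX => E'.
have : `|p| ^+ k.+1 < 1 by rewrite exprn_ilt1.
by rewrite -E' ltxx.
Qed.

Lemma qfactS k : qfact k.+1 = qfact k * (1 - p ^+ k.+1).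
Proof. by rewrite /qfact big_ord_recr. Qed.

Lemma qfact_cvg : exists2 l, tendsto qfact l & l != 0.
Proof.
have [||l Hl l0] := @infinite_prod _ _ r01 `|p| (fun j => p ^+ j.+1) => //.
  by move=> j; have := pow_dom hp p j; rewrite -exprSr.
exists l => //; apply: l0 => j; have := onem_pow_neq0 j.
by rewrite subr_eq0 eq_sym.
Qed.

(** The value 0 at negative integers agrees with the recurrence [inv_qfact_pred] at [k = 0]. *)
Definition inv_qfact (i : int) : C := match i with Posz n => (qfact n)^-1 | Negz _ => 0 end.

(** The Gaussian binomial coefficient of [2m] over [m + i] in base [p]. It vanishes for [|i| > m],
    so the finite sums can be written over all integers and dominated convergence applies to
    them. *)
Definition binom (m : nat) (i : int) : C := qfact m.*2 * inv_qfact (Posz m - i) * inv_qfact (Posz m + i).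

Lemma inv_qfact_pred (k : int) : 0 <= k -> inv_qfact (k - 1) = (1 - p ^+ `|k|%N) * inv_qfact k.
Proof.
case: k => // -[|n] _; first by rewrite subrr mul0r.
have -> : Posz n.+1 - 1 = Posz n by lia.
by rewrite /= qfactS invfM mulrCA mulfV ?mulr1 // onem_pow_neq0.
Qed.

Lemma inv_qfact_neg (k : int) : k < 0 -> inv_qfact k = 0.
Proof. by case: k. Qed.

Lemma theta_coef_pred m (i : int) : i <= Posz m + 1 ->
  p ^+ m * theta_coef (i - 1) = - (p ^+ absz (Posz m + 1 - i)%R * theta_coef i).
Proof.
move=> im; rewrite /theta_coef mulrCA [X in _ = - X]mulrCA -!exprD -mulNr.
congr (_ * p ^+ _).
  rewrite -signr_odd -[X in _ = - X]signr_odd -signrN; congr (_ ^+ nat_of_bool _).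
  by lia.
have := texpE i; have := texpE (i - 1); nia.
Qed.

Lemma theta_coef_succ m (i : int) : 0 <= Posz m + 1 + i ->
  p ^+ m.+1 * theta_coef (i + 1) = - (p ^+ absz (Posz m + 1 + i)%R * theta_coef i).
Proof.
move=> im; rewrite /theta_coef mulrCA [X in _ = - X]mulrCA -!exprD -mulNr.
congr (_ * p ^+ _).
  rewrite -signr_odd -[X in _ = - X]signr_odd -signrN; congr (_ ^+ nat_of_bool _).
  by lia.
have := texpE i; have := texpE (i + 1); nia.
Qed.

(** Comparison of coefficients under multiplication by [(1 - p^m x)(1 - p^(m+1)/x) = 1 + p^(2m+1) -
    p^m x - p^(m+1)/x]. *)
Lemma binom_rec m (i : int) :
  theta_coef i * binom m.+1 i = (1 + p ^+ m.*2.+1) * (theta_coef i * binom m i)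
   - p ^+ m * (theta_coef (i - 1) * binom m (i - 1))
   - p ^+ m.+1 * (theta_coef (i + 1) * binom m (i + 1)).
Proof.
have [im|im] := lerP i (Posz m + 1); last first.
  rewrite /binom !(@inv_qfact_neg (_ - _)).
  all: try lia.
  by rewrite !(mul0r, mulr0) !subr0.
have [im'|im'] := lerP 0 (Posz m + 1 + i); last first.
  have e1 : inv_qfact (Posz m.+1 + i) = 0 by apply: inv_qfact_neg; lia.
  have e2 : inv_qfact (Posz m + i) = 0 by apply: inv_qfact_neg; lia.
  have e3 : inv_qfact (Posz m + (i - 1)) = 0 by apply: inv_qfact_neg; lia.
  have e4 : inv_qfact (Posz m + (i + 1)) = 0 by apply: inv_qfact_neg; lia.
  rewrite /binom e1 e2 e3 e4.
  by rewrite !(mul0r, mulr0) !subr0.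
rewrite (mulrA (p ^+ m)) (mulrA (p ^+ m.+1)) theta_coef_pred // theta_coef_succ //.
rewrite /binom.
have -> : Posz m.+1 - i = Posz m + 1 - i by lia.
have -> : Posz m.+1 + i = Posz m + 1 + i by lia.
have -> : Posz m - (i - 1) = Posz m + 1 - i by lia.
have -> : Posz m + (i + 1) = Posz m + 1 + i by lia.
have -> : Posz m - i = Posz m + 1 - i - 1 by lia.
have -> : Posz m + i = Posz m + 1 + i - 1 by lia.
have -> : Posz m + (i - 1) = Posz m + 1 + i - 1 - 1 by lia.
have -> : Posz m - (i + 1) = Posz m + 1 - i - 1 - 1 by lia.
have ab : p ^+ absz (Posz m + 1 - i)%R * p ^+ absz (Posz m + 1 + i)%R = p ^+ m.*2.+2.
  by rewrite -exprD; congr (_ ^+ _); lia.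
(* For [k >= 1] the exponents [|l|] and [|k| - 1] add up to [2m + 1]; for [k = 0] both sides are
   zero. *)
have pred2 (k l : int) : 0 <= k -> 0 <= l -> `|k|%N + `|l|%N = m.*2.+2 :> nat ->
    p ^+ `|l|%N * inv_qfact (k - 1 - 1) = (p ^+ `|l|%N - p ^+ m.*2.+1) * inv_qfact (k - 1).
  move=> k0 l0 kl; have [k1|k1] := lerP 1 k.
    rewrite inv_qfact_pred; last by lia.
    rewrite mulrA mulrBr mulr1 -exprD; congr ((_ - p ^+ _) * _).
    by lia.
  by rewrite !inv_qfact_neg ?mulr0 //; lia.
have P1 := pred2 (Posz m + 1 + i) (Posz m + 1 - i).
have P2 := pred2 (Posz m + 1 - i) (Posz m + 1 + i).
have {}P1 : p ^+ absz (Posz m + 1 - i)%R * inv_qfact (Posz m + 1 + i - 1 - 1) =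
   (p ^+ absz (Posz m + 1 - i)%R - p ^+ m.*2.+1) * inv_qfact (Posz m + 1 + i - 1).
  by apply: P1; lia.
have {}P2 : p ^+ absz (Posz m + 1 + i)%R * inv_qfact (Posz m + 1 - i - 1 - 1) =
   (p ^+ absz (Posz m + 1 + i)%R - p ^+ m.*2.+1) * inv_qfact (Posz m + 1 - i - 1).
  by apply: P2; lia.
have E1 : inv_qfact (Posz m + 1 - i - 1) = (1 - p ^+ absz (Posz m + 1 - i)%R) * inv_qfact (Posz m + 1 - i).
  by apply: inv_qfact_pred; lia.
have E2 : inv_qfact (Posz m + 1 + i - 1) = (1 - p ^+ absz (Posz m + 1 + i)%R) * inv_qfact (Posz m + 1 + i).
  by apply: inv_qfact_pred; lia.
rewrite doubleS !qfactS -ab.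
move: P1 P2 E1 E2.
move: (p ^+ absz (_ - i)%R) (p ^+ absz (_ + i)%R) (p ^+ m.*2.+1) (qfact m.*2) (theta_coef i).
move: (inv_qfact (_ - 1 - 1)) => A.
move: (inv_qfact (_ - 1 - 1)) => B.
move: (inv_qfact (Posz m + 1 - i - 1)) (inv_qfact (Posz m + 1 + i - 1)) => A1 B1.
move: (inv_qfact (Posz m + 1 - i)) (inv_qfact (Posz m + 1 + i)) => A0 B0 u v w z c P1 P2 E1 E2.
transitivity ((1 + w) * (c * (z * A1 * B1)) + c * z * A0 * (u * A) + c * z * B0 * (v * B)).
  by rewrite P1 P2 E1 E2; ring.
by ring.
Qed.

Definition theta_partial m (x : C) := \prod_(0 <= j < m) ((1 - p ^+ j * x) * (1 - p ^+ j.+1 / x)).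

Lemma inv_qfact_bound : exists2 B : C, 0 <= B & forall i, `|inv_qfact i| <= B.
Proof.
have [l Hl l0] := qfact_cvg; have [B B0 HB] := tendsto_bounded (tendstoV l0 Hl).
by exists B => // -[n|n] /=; rewrite ?normr0.
Qed.

Lemma binom_bound : exists2 B : C, 0 <= B & forall m i, `|binom m i| <= B.
Proof.
have [l Hl _] := qfact_cvg; have [A A0 HA] := tendsto_bounded Hl.
have [B B0 HB] := inv_qfact_bound; exists (A * B * B); first by rewrite !mulr_ge0.
by move=> m i; rewrite /binom !normrM !ler_pM ?mulr_ge0.
Qed.

Lemma binom_zdom (B : C) : 0 <= B ->
  exists2 K : C, 0 <= K & forall (x : C) m, x != 0 -> `|x| <= B -> `|x^-1| <= B ->
    zdom r K (fun i => theta_coef i * binom m i * x ^ i).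
Proof.
move=> B0; have [K K0 HK] := theta_coef_zdom B0; have [A A0 HA] := binom_bound.
exists (A * K) => [|x m x0 xB xB' i]; first by rewrite mulr_ge0.
rewrite mulrAC normrM mulrC -mulrA ler_pM //; exact: HK.
Qed.

Lemma finite_triple_product m (x : C) : x != 0 ->
  theta_partial m x = zsum (fun i => theta_coef i * binom m i * x ^ i).
Proof.
move=> x0; elim: m => [|m IH].
  rewrite /theta_partial big_geq //; apply/esym/zsum_eq.
  apply: (@tendsto_near _ _ _ _ 1%N _ (tendsto_cst 1)) => -[//|k] _.
  have Q0 : qfact 0 = 1 by rewrite /qfact big_ord0.
  rewrite big_ord_recl big1 => [|i _].
    have g0 : binom 0 (Posz 0) = 1.
      transitivity (qfact 0 * (qfact 0)^-1 * (qfact 0)^-1); first by [].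
      by rewrite Q0 invr1 !mulr1.
    have g1 : binom 0 (Negz 0) = 0 by rewrite /binom (@inv_qfact_neg (Posz 0 + Negz 0)) ?mulr0.
    by rewrite [LHS]/= g0 g1 mulr0 mul0r mulr1 /theta_coef /= !expr0 expr0z !mulr1 !addr0.
  have e1 : inv_qfact (Posz 0 - Posz (lift ord0 i)) = 0 by apply: inv_qfact_neg; rewrite /= /bump /=; lia.
  have e2 : inv_qfact (Posz 0 + Negz (lift ord0 i)) = 0 by apply: inv_qfact_neg; lia.
  by rewrite /binom e1 e2 !(mul0r, mulr0) addr0.
have [K K0 HK] : exists2 K : C, 0 <= K & zdom r K (fun i => theta_coef i * binom m i * x ^ i).
  have B0 : 0 <= `|x| + `|x^-1| by rewrite addr_ge0.
  have [K K0 HK] := binom_zdom B0; exists K => //.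
  by apply: HK; rewrite ?lerDl ?lerDr.
set f := fun i => _ in IH HK.
have Kr : 0 <= K / r by rewrite divr_ge0 // ltW.
have d1 := zdom_shift1 r01 rp K0 HK; have d2 := zdom_shiftN1 r01 rp K0 HK.
have cdom (c : C) K' (h : int -> C) : zdom r K' h -> zdom r (`|c| * K') (fun i => c * h i).
  by move=> hK i; rewrite normrM -mulrA ler_wpM2l.
have ge0 (c : C) K' : 0 <= K' -> 0 <= `|c| * K' by move=> ?; rewrite mulr_ge0.
have -> : theta_partial m.+1 x = (1 + p ^+ m.*2.+1) * theta_partial m x +
   (- (p ^+ m * x) * theta_partial m x + - (p ^+ m.+1 / x) * theta_partial m x).
  rewrite /theta_partial big_nat_recr //=.
  have -> : p ^+ m.*2.+1 = p ^+ m * p ^+ m.+1 by rewrite -exprD; congr (_ ^+ _); lia.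
  by field.
have E1 : zsum (fun i => f (i - 1)) = zsum f := zsum_shift r01 rp (- 1%:Z) K0 HK.
have E2 : zsum (fun i => f (i + 1)) = zsum f := zsum_shift1 r01 rp K0 HK.
rewrite IH -{2}E1 -{2}E2.
rewrite -(zsumZ r01 _ Kr d2) -(zsumZ r01 _ Kr d1) -(zsumZ r01 _ K0 HK).
rewrite -(zsumD r01 (ge0 _ _ Kr) (ge0 _ _ Kr) (cdom _ _ _ d2) (cdom _ _ _ d1)).
have dd : zdom r (`|- (p ^+ m * x)| * (K / r) + `|- (p ^+ m.+1 / x)| * (K / r))
   (fun i => - (p ^+ m * x) * f (i - 1) + - (p ^+ m.+1 / x) * f (i + 1)).
  move=> i; apply: le_trans (ler_normD _ _) _; rewrite mulrDl.
  by apply: lerD; [apply: (cdom _ _ _ d2) | apply: (cdom _ _ _ d1)].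
have ge2 := addr_ge0 (ge0 (- (p ^+ m * x)) _ Kr) (ge0 (- (p ^+ m.+1 / x)) _ Kr).
rewrite -(zsumD r01 (ge0 (1 + p ^+ m.*2.+1) _ K0) ge2 (cdom (1 + p ^+ m.*2.+1) _ _ HK) dd).
apply: eq_zsum => i; rewrite binom_rec /f !expfzDr // expr1z exprN1.
by field.
Qed.

Lemma inv_qfact_shift_cvg (h : nat -> int) l : tendsto qfact l -> l != 0 ->
  (forall N, exists K, forall m, (K <= m)%N -> 0 <= h m /\ (N <= `|h m|)%N) ->
  tendsto (fun m => inv_qfact (h m)) l^-1.
Proof.
move=> Hl l0 Hh; have [M HM] := Hh 0%N.
apply: (@tendsto_near _ (fun m => (qfact `|h m|)^-1) _ _ M).
  by move=> m /HM [h0 _]; case: (h m) h0.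
apply: tendstoV l0 _; apply: (@tendsto_comp _ (fun m => `|h m|%N) qfact l _ Hl) => N.
by have [K HK] := Hh N; exists K => m /HK [].
Qed.

Lemma leq_double_self N m : (N <= m)%N -> (N <= m.*2)%N.
Proof. by lia. Qed.

Lemma absz_far N (i : int) m : (N + `|i| <= m)%N ->
  (0 <= Posz m - i /\ (N <= absz (Posz m - i)%R)%N) /\
  (0 <= Posz m + i /\ (N <= absz (Posz m + i)%R)%N).
Proof. by lia. Qed.

Definition theta_series (x : C) := zsum (fun i => theta_coef i * x ^ i).

(** In the finite form each [binom m i] tends to the inverse of the limit of [qfact]. The identities
    drawn from this are homogeneous in theta, so a nonzero constant suffices. *)
Lemma triple_product : exists2 k : C, k != 0 & forall x : C, x != 0 -> theta p x = k * theta_series x.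
Proof.
have [l Hl l0] := qfact_cvg; exists l^-1 => [|x x0]; first by rewrite invr_eq0.
have [K K0 HK] := theta_coef_zdom1 x0.
rewrite -(zsumZ r01 _ K0 HK); apply: (tendsto_uniq (theta_cvg hp x)).
apply: (@eq_tendsto _ (fun m => zsum (fun i => theta_coef i * binom m i * x ^ i))).
  by move=> m; rewrite -finite_triple_product.
have B0 : 0 <= `|x| + `|x^-1| by rewrite addr_ge0.
have [K' K'0 HK'] := binom_zdom B0.
apply: (ztannery r01 K'0) => [m|i]; first by apply: HK'; rewrite ?lerDl ?lerDr.
rewrite mulrCA mulrA; apply: tendstoM (tendsto_cst _).
apply: tendstoM (tendsto_cst _) _.
have -> : l^-1 = l * l^-1 * l^-1 by rewrite mulfV ?mul1r.
apply: tendstoM; first apply: tendstoM.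
- by apply: tendsto_comp Hl => N; exists N => m /leq_double_self.
- by apply: inv_qfact_shift_cvg Hl l0 _ => N; exists (N + `|i|)%N => m /absz_far [].
- by apply: inv_qfact_shift_cvg Hl l0 _ => N; exists (N + `|i|)%N => m /absz_far [].
Qed.

End ThetaSeries.

(** * The Weierstrass identity *)

Section ThetaIdentities.
Variable R : realType.
Local Notation C := R[i].
Variable p : C.
Hypothesis hp : `|p| < 1.
Local Notation r := (rad p).
Local Notation coef := (theta_coef p).
Let r01 := rad01 hp.
Let rp := rad_gt0 p.

(** [Negz n] is [-1 - n], so the reflection exchanges the two terms of each pair in [zsum]. *)
Lemma zsum_reflect (f : int -> C) : zsum (fun i => f (-1 - i)) = zsum f.
Proof.
congr csum; apply/funext => n; rewrite addrC; congr (f _ + f _); lia.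
Qed.

Lemma coef_reflect (i : int) : coef (1 - i) = - coef i.
Proof.
rewrite /theta_coef -mulNr; congr (_ * p ^+ _).
  rewrite -signr_odd -[X in _ = - X]signr_odd -signrN; congr (_ ^+ nat_of_bool _).
  by lia.
have := texpE i; have := texpE (1 - i); nia.
Qed.

(** Substitution of [1 - i] for [i] in the series: [i (i - 1) / 2] is invariant and the sign
    changes. *)
Lemma thetaV (x : C) : x != 0 -> theta p x^-1 = - (theta p x / x).
Proof.
move=> x0; have [k _ tk] := triple_product hp; rewrite !tk ?invr_eq0 //.
rewrite -mulrA -mulrN; congr (_ * _).
have [K K0 HK] := theta_coef_zdom1 hp x0.
pose f i := coef i * x ^ i.
have d1 := zdom_shift1 r01 rp K0 HK.
have Kr : 0 <= K / r by rewrite divr_ge0 // ltW.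
have E : zsum (fun i => f (1 - i)) = zsum f.
  rewrite -[RHS](zsum_shift r01 rp 2 K0 HK) -[RHS]zsum_reflect.
  by apply: eq_zsum => i; congr f; lia.
have d2 : zdom r (K / r) (fun i => f (1 - i)).
  by move=> i; have := d1 (- i); rewrite [- i + 1]addrC abszN.
transitivity (zsum (fun i => - x^-1 * f (1 - i))); last first.
  by rewrite (zsumZ r01 _ Kr d2) E mulNr mulrC.
apply: eq_zsum => i; rewrite /f coef_reflect expfzDr // expr1z exprz_inv.
by field.
Qed.

Lemma tendsto_exprz (u : nat -> C) (l : C) (i : int) : l != 0 -> tendsto u l ->
  tendsto (fun k => u k ^ i) (l ^ i).
Proof.
move=> l0 ul; case: i => n; first exact: tendstoX.
by rewrite NegzE -exprnN; apply: tendstoV; rewrite ?expf_neq0 //; apply: tendstoX.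
Qed.

(** Since [u k] and its inverse are bounded, the theta series at all [u k] have a common majorant,
    and dominated convergence applies. *)
Lemma theta_continuous (u : nat -> C) (l : C) : l != 0 -> (forall k, u k != 0) ->
  tendsto u l -> tendsto (fun k => theta p (u k)) (theta p l).
Proof.
move=> l0 u0 ul; have [k _ tk] := triple_product hp; rewrite tk //.
apply: (@eq_tendsto _ (fun m => k * theta_series p (u m))) => [m|]; first by rewrite tk.
apply: tendstoM (tendsto_cst _) _.
have [A A0 HA] := tendsto_bounded ul.
have [B B0 HB] := tendsto_bounded (tendstoV l0 ul).
have [K K0 HK] := theta_coef_zdom hp (addr_ge0 A0 B0).
apply: (ztannery r01 K0) => [m|i].
  apply: HK => //; first by apply: le_trans (HA m) _; rewrite lerDl.
  by apply: le_trans (HB m) _; rewrite lerDr.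
by apply: tendstoM (tendsto_cst _) _; apply: tendsto_exprz.
Qed.

(** The parallelogram law for the quadratic exponents. Two indices of equal parity are written
    [i + j], [i - j]; the next lemma treats different parities, [i + j] and [i + 1 - j]. *)
Lemma coef_mul_even (i j : int) :
  coef (i + j) * coef (i - j) = p ^+ (texp i).*2 * p ^+ (absz j ^ 2).
Proof.
rewrite /theta_coef mulrACA -!exprD -signr_odd.
have -> : odd (absz (i + j)%R + absz (i - j)%R) = false by lia.
rewrite mul1r; congr (p ^+ _).
have := texpE (i + j); have := texpE (i - j); have := texpE i; nia.
Qed.

Lemma coef_mul_odd (i j : int) :
  coef (i + j) * coef (i + 1 - j) = - (p ^+ (absz i ^ 2) * p ^+ (texp j).*2).
Proof.
rewrite /theta_coef mulrACA -!exprD -signr_odd.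
have -> : odd (absz (i + j)%R + absz (i + 1 - j)%R) = true by lia.
rewrite expr1 mulN1r; congr (- p ^+ _).
have := texpE (i + j); have := texpE (i + 1 - j); have := texpE j; nia.
Qed.

Lemma absz_le_double (m s : int) :
  (absz m + absz s <= 2 * absz m + 2 * absz (s - m)%R)%N.
Proof. by lia. Qed.

Definition even_series (x : C) := zsum (fun i => p ^+ (texp i).*2 * x ^ (2 * i)).
Definition even_square_series (y : C) := zsum (fun j => p ^+ (absz j ^ 2) * y ^ (- (2 * j))).
Definition odd_square_series (x : C) := zsum (fun i => p ^+ (absz i ^ 2) * x ^ (2 * i + 1)).
Definition odd_series (y : C) := zsum (fun j => p ^+ (texp j).*2 * y ^ (1 - 2 * j)).

(* Sorting the double series by the parity of the total degree in [x]
   separates the variables. *)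
Lemma theta_series_mul (x y : C) : x != 0 -> y != 0 ->
  theta_series p (x * y) * theta_series p (x / y) =
  even_square_series y * even_series x - odd_series y * odd_square_series x.
Proof.
move=> x0 y0; have xy0 : x * y != 0 by rewrite mulf_neq0.
have xVy0 : x / y != 0 by rewrite mulf_neq0 ?invr_eq0.
pose B := `|x * y| + `|(x * y)^-1| + (`|x / y| + `|(x / y)^-1|).
have B0 : 0 <= B by rewrite !addr_ge0.
have [K K0 HK] := theta_coef_dom hp B0.
have HK1 i : `|coef i * (x * y) ^ i| <= K * (r ^+ 2) ^+ absz i.
  apply: HK => //; rewrite /B; first by rewrite -addrA lerDl !addr_ge0.
  by rewrite addrAC lerDr !addr_ge0.
have HK2 i : `|coef i * (x / y) ^ i| <= K * (r ^+ 2) ^+ absz i.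
  apply: HK => //; rewrite /B; first by rewrite addrCA lerDl !addr_ge0.
  by rewrite addrA lerDr !addr_ge0.
have r1 : r <= 1 by apply: rad_le1.
have r0 : 0 <= r by apply: ltW.
have [K1 K10 D1] := theta_coef_zdom1 hp xy0; have [K2 K20 D2] := theta_coef_zdom1 hp xVy0.
(* [m] is the index in the series of [x / y], and [s] is the total degree in [x]. *)
pose h m s := coef m * (x / y) ^ m * (coef (s - m) * (x * y) ^ (s - m)).
have hb m s : `|h m s| <= K * K * r ^+ absz m * r ^+ absz s.
  rewrite /h normrM; apply: le_trans (ler_pM _ _ (HK2 m) (HK1 (s - m))) _ => //.
  rewrite mulrACA -!mulrA ler_wpM2l // ler_wpM2l // -!exprM -!exprD.
  by apply: ler_wiXn2l (absz_le_double m s).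
have KK : 0 <= K * K by rewrite mulr_ge0.
have hm m : zdom r (K * K * r ^+ absz m) (h m) by move=> s; apply: hb.
have hs s : zdom r (K * K * r ^+ absz s) (fun m => h m s) by move=> m; rewrite mulrAC; apply: hb.
have KKr i : 0 <= K * K * r ^+ absz i by rewrite mulr_ge0 ?exprn_ge0.
have E : theta_series p (x * y) * theta_series p (x / y) = zsum (fun m => zsum (h m)).
  rewrite /theta_series -(zsumZ r01 _ K20 D2); apply: eq_zsum => m.
  rewrite mulrC -(zsumZ r01 _ K10 D1) -(zsum_shift r01 rp m (KKr m) (hm m)).
  by apply: eq_zsum => s; rewrite /h addrK.
rewrite E (zsum_fubini r01 KK hb).
pose G s := zsum (fun m => h m s); rewrite -[LHS]/(zsum G).
have r'0 : 0 <= (1 - r)^-1 by rewrite invr_ge0 subr_ge0.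
have hG : zdom r (2 * (K * K) / (1 - r)) G.
  move=> s; apply: le_trans (csum_le r01 _ (zdom_dominated r01 (KKr s) (hs s))) _.
    by rewrite mulr_ge0.
  by rewrite [2 * (K * K * _)]mulrA mulrAC.
have KK2 : 0 <= 2 * (K * K) / (1 - r) by rewrite !mulr_ge0.
rewrite (zsum_even_odd r01 KK2 hG).
have hev i j : h (i + j) (2 * i) =
    p ^+ (texp i).*2 * x ^ (2 * i) * (p ^+ (absz j ^ 2) * y ^ (- (2 * j))).
  rewrite /h; have -> : 2 * i - (i + j) = i - j by ring.
  rewrite mulrACA coef_mul_even !expfzMl -!exprz_inv -mulrACA.
  have -> : x ^ (2 * i) = x ^ (i + j) * x ^ (i - j) by rewrite -expfzDr //; congr (_ ^ _); ring.
  have -> : y^-1 ^ (2 * j) = y^-1 ^ (i + j) * y ^ (i - j).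
    by rewrite !exprz_inv -expfzDr //; congr (_ ^ _); ring.
  move: (x ^ (i + j)) (x ^ (i - j)) (y^-1 ^ (i + j)) (y ^ (i - j)) (p ^+ _) (p ^+ _).
  by move=> *; ring.
have hod i j : h (i + j) (2 * i + 1) =
    - (p ^+ (absz i ^ 2) * x ^ (2 * i + 1)) * (p ^+ (texp j).*2 * y ^ (1 - 2 * j)).
  rewrite /h; have -> : 2 * i + 1 - (i + j) = i + 1 - j by ring.
  rewrite mulrACA coef_mul_odd !expfzMl.
  have -> : x ^ (2 * i + 1) = x ^ (i + j) * x ^ (i + 1 - j) by rewrite -expfzDr //; congr (_ ^ _); ring.
  have -> : y ^ (1 - 2 * j) = y^-1 ^ (i + j) * y ^ (i + 1 - j).
    by rewrite !exprz_inv -expfzDr //; congr (_ ^ _); ring.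
  move: (x ^ (i + j)) (x ^ (i + 1 - j)) (y^-1 ^ (i + j)) (y ^ (i + 1 - j)) (p ^+ _) (p ^+ _).
  by move=> *; ring.
have cdom (c : C) K' (f : int -> C) : zdom r K' f -> zdom r (`|c| * K') (fun i => c * f i).
  by move=> fK i; rewrite normrM -mulrA ler_wpM2l.
have ge0 (c : C) K' : 0 <= K' -> 0 <= `|c| * K' by move=> ?; rewrite mulr_ge0.
have eqdom K' (f g : int -> C) : f =1 g -> zdom r K' f -> zdom r K' g.
  by move=> e fK i; rewrite -e; apply: fK.
(* The majorants of the four one-variable series are read off from [h]: those in [y] at [s = 0] and
   [s = 1], those in [x] along the lines [j = 0]. *)
have dA : zdom r (K * K * r ^+ 0) (fun j => p ^+ (absz j ^ 2) * y ^ (- (2 * j))).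
  apply: eqdom (hs 0) => j; have := hev 0 j; rewrite mulr0 add0r => ->.
  by rewrite /= expr0z !mul1r.
have dB : zdom r (`|- x^-1| * (K * K * r ^+ 1)) (fun j => p ^+ (texp j).*2 * y ^ (1 - 2 * j)).
  apply: eqdom (cdom _ _ _ (hs 1)) => j; have := hod 0 j; rewrite mulr0 !add0r => ->.
  by rewrite /= mul1r expr1z mulrA mulrNN mulVf ?mul1r.
have diag (s : int -> int) : zdom r (K * K) (fun i => h i (s i)).
  move=> i; apply: le_trans (hb i (s i)) _.
  by rewrite ler_piMr ?exprn_ile1 // mulr_ge0 ?exprn_ge0.
have dF : zdom r (K * K) (fun i => p ^+ (texp i).*2 * x ^ (2 * i)).
  apply: eqdom (diag (fun i => 2 * i)) => i.
  by have := hev i 0; rewrite addr0 => ->; rewrite mulr0 oppr0 expr0z !mulr1.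
have dH : zdom r (`|- y^-1| * (K * K)) (fun i => p ^+ (absz i ^ 2) * x ^ (2 * i + 1)).
  apply: eqdom (cdom _ _ _ (diag (fun i => 2 * i + 1))) => i.
  have := hod i 0; rewrite addr0 => ->.
  by rewrite mulr0 subr0 expr1z /= mul1r; field.
have K'0 i : 0 <= K * K * r ^+ i by rewrite mulr_ge0 ?exprn_ge0.
have Gev i : G (2 * i) = even_square_series y * (p ^+ (texp i).*2 * x ^ (2 * i)).
  rewrite /G /even_square_series -(zsum_shift r01 rp i (KKr _) (hs _)) [RHS]mulrC -(zsumZ r01 _ (K'0 _) dA).
  by apply: eq_zsum => j; rewrite addrC hev.
have God i : G (2 * i + 1) = - odd_series y * (p ^+ (absz i ^ 2) * x ^ (2 * i + 1)).
  rewrite /G /odd_series -(zsum_shift r01 rp i (KKr _) (hs _)) [RHS]mulrC [RHS]mulrN -[RHS]mulNr.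
  rewrite -(zsumZ r01 _ (ge0 _ _ (K'0 _)) dB).
  by apply: eq_zsum => j; rewrite addrC hod.
rewrite (eq_zsum (fun i => congr2 +%R (Gev i) (God i))).
rewrite (zsumD r01 (ge0 _ _ KK) (ge0 _ _ (ge0 _ _ KK)) (cdom _ _ _ dF) (cdom _ _ _ dH)).
by rewrite (zsumZ r01 _ KK dF) (zsumZ r01 _ (ge0 _ _ KK) dH) mulNr.
Qed.

Lemma rank2_pfaffian (a b c d : nat -> C) (g : nat -> nat -> C) :
  (forall i j, g i j = a i * c j + b i * d j) -> (forall i j, g i j = - g j i) ->
  g 0%N 1%N * g 2%N 3%N - g 0%N 2%N * g 1%N 3%N + g 0%N 3%N * g 1%N 2%N = 0.
Proof.
move=> gE gN; have gii i : g i i = 0.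
  by have /eqP := gN i i; rewrite -addr_eq0 -mulr2n mulrn_eq0 => /eqP.
(* The cofactor expansion; for skew-symmetric [g] it is the square of the expression to be
   annihilated. *)
pose det (m : nat -> nat -> C) :=
    m 0%N 0%N * (m 1%N 1%N * (m 2 2 * m 3 3 - m 2 3 * m 3 2) -
                 m 1%N 2 * (m 2 1%N * m 3 3 - m 2 3 * m 3 1%N) +
                 m 1%N 3 * (m 2 1%N * m 3 2 - m 2 2 * m 3 1%N))
  - m 0%N 1%N * (m 1%N 0%N * (m 2 2 * m 3 3 - m 2 3 * m 3 2) -
                 m 1%N 2 * (m 2 0%N * m 3 3 - m 2 3 * m 3 0%N) +
                 m 1%N 3 * (m 2 0%N * m 3 2 - m 2 2 * m 3 0%N))
  + m 0%N 2 * (m 1%N 0%N * (m 2 1%N * m 3 3 - m 2 3 * m 3 1%N) -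
               m 1%N 1%N * (m 2 0%N * m 3 3 - m 2 3 * m 3 0%N) +
               m 1%N 3 * (m 2 0%N * m 3 1%N - m 2 1%N * m 3 0%N))
  - m 0%N 3 * (m 1%N 0%N * (m 2 1%N * m 3 2 - m 2 2 * m 3 1%N) -
               m 1%N 1%N * (m 2 0%N * m 3 2 - m 2 2 * m 3 0%N) +
               m 1%N 2 * (m 2 0%N * m 3 1%N - m 2 1%N * m 3 0%N)).
have d0 : det g = 0 by rewrite /det !gE; ring.
apply/eqP; rewrite -sqrf_eq0 -d0 /det !gii.
rewrite (gN 1%N 0%N) (gN 2 0%N) (gN 2 1%N) (gN 3 0%N) (gN 3 1%N) (gN 3 2).
by apply/eqP; ring.
Qed.

(** Dividing all variables by a square root of [be] removes [be]. Then [phi x y / x] is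
    skew-symmetric by inversion and of rank two by [theta_series_mul]. *)
Lemma theta_weierstrass (be x u v w : C) :
  be != 0 -> x != 0 -> u != 0 -> v != 0 -> w != 0 ->
  u / v * (theta p (x / u) * theta p (x * u / be)) * (theta p (v / w) * theta p (v * w / be)) =
  theta p (x / v) * theta p (x * v / be) * (theta p (u / w) * theta p (u * w / be)) -
  theta p (x / w) * theta p (x * w / be) * (theta p (u / v) * theta p (u * v / be)).
Proof.
move=> be0; pose s := sqrtc be; have sE : be = s ^+ 2 by rewrite /s sqr_sqrtc.
have s0 : s != 0 by move: be0; rewrite sE; apply: contra_neq => ->; rewrite expr0n.
have [k k0 tk] := triple_product hp.
pose phi x y := theta p (x * y) * theta p (x / y).
have phiE x1 y1 : x1 != 0 -> y1 != 0 -> phi x1 y1 =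
    k ^+ 2 * (even_square_series y1 * even_series x1 - odd_series y1 * odd_square_series x1).
  move=> x10 y10; rewrite /phi !tk ?mulf_neq0 ?invr_eq0 //.
  by rewrite -theta_series_mul // expr2 mulrACA.
have phiN x1 y1 : x1 != 0 -> y1 != 0 -> phi x1 y1 / x1 = - (phi y1 x1 / y1).
  move=> x10 y10; rewrite /phi -[x1 / y1]invf_div thetaV ?mulf_neq0 ?invr_eq0 //.
  rewrite [y1 * x1]mulrC; move: (theta p _) (theta p _) => t t'.
  by field; rewrite x10 y10.
move=> x0 u0 v0 w0.
(* The default 1 keeps [z i] nonzero at every natural [i], since [rank2_pfaffian] quantifies over
   all indices. *)
pose z i := nth 1 [:: x / s; u / s; v / s; w / s] i.
have z0 i : z i != 0.
  case: i => [|[|[|[|i]]]]; rewrite /z /= ?mulf_neq0 ?invr_eq0 //.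
  by rewrite nth_nil oner_eq0.
have gE i j : phi (z i) (z j) / z i = even_series (z i) / z i * (k ^+ 2 * even_square_series (z j)) +
   odd_square_series (z i) / z i * - (k ^+ 2 * odd_series (z j)).
  rewrite phiE //; move: (even_series (z i)) (odd_square_series (z i)).
  by move: (even_square_series (z j)) (odd_series (z j)) (z i) => *; ring.
have H := rank2_pfaffian gE (fun i j => phiN _ _ (z0 i) (z0 j)).
have phis a1 b1 : phi (a1 / s) (b1 / s) = theta p (a1 / b1) * theta p (a1 * b1 / be).
  rewrite /phi mulrC; congr (theta p _ * theta p _); last first.
    by rewrite sE expr2 mulf_div.
  by rewrite invf_div mulrA divfK.
move: H; rewrite /z /= !phis => H.
apply/eqP; rewrite -subr_eq0; apply/eqP.
have -> : forall A B D E G H' : C, u / v * A * B - (D * E - G * H') =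
   (x * u / s ^+ 2) * (A / (x / s) * (B / (v / s)) - D / (x / s) * (E / (u / s)) + G / (x / s) * (H' / (u / s))).
  by move=> *; field; rewrite x0 u0 v0 s0.
by rewrite H mulr0.
Qed.

End ThetaIdentities.

(** * Removing the genericity assumptions *)

Section Perturbation.
Variable R : realType.
Local Notation C := R[i].
Variables (p q : C).
Hypotheses (hp : `|p| < 1) (q0 : q != 0).
Local Notation th := (theta p).

Definition for_large (P : nat -> Prop) := exists K, forall k, (K <= k)%N -> P k.

Lemma for_large_and P Q : for_large P -> for_large Q ->
  for_large (fun k => P k /\ Q k).
Proof.
move=> [A HA] [B HB]; exists (maxn A B) => k; rewrite geq_max => /andP [/HA ? /HB ?].
by split.
Qed.

Lemma for_large_all (T : finType) (P : T -> nat -> Prop) :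
  (forall i, for_large (P i)) -> for_large (fun k => forall i, P i k).
Proof.
move=> /choice [K HK]; exists (\max_i K i) => k kK i; apply: HK.
by apply: leq_trans kK; apply: leq_bigmax.
Qed.

(** If [th v] is nonzero, this is continuity. Otherwise a zero at [v * t k] would make [t k] a zero
    as well, by division, whereas [t k] is close to 1 and different from it. *)
Lemma for_large_theta_neq0 (v : C) (t : nat -> C) : v != 0 ->
  (forall k, t k != 0) -> (forall k, t k != 1) -> tendsto t 1 ->
  for_large (fun k => th (v * t k) != 0).
Proof.
move=> v0 t0 t1 tt.
have [tv|tv] := eqVneq (th v) 0; last first.
  have vt0 k : v * t k != 0 by rewrite mulf_neq0.
  have H : tendsto (fun k => v * t k) v by rewrite -[X in tendsto _ X]mulr1; apply: tendstoM tt; apply: tendsto_cst.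
  have [N HN] := tendsto_far tv (theta_continuous hp v0 vt0 H).
  exists N => k /HN; rewrite -normr_gt0; apply: le_lt_trans.
  by rewrite divr_ge0.
(* This distance from 1 keeps [t k] in the annulus of [theta_near1]: its modulus exceeds
   [(1 + |p|) / 2], and its product with [|p|] stays below 1. *)
have e0 : 0 < (1 - `|p|) / 2 by rewrite divr_gt0 // subr_gt0.
have [N HN] := tt _ e0; exists N => k /HN tk; apply/eqP => E.
have v_t0 : v * t k != 0 by rewrite mulf_neq0.
have := theta_div0 hp v_t0 v0 E tv; rewrite mulrAC divff // mul1r => E1.
suff : th (t k) != 0 by rewrite E1 eqxx.
have sp : `|p| < (1 + `|p|) / 2.
  rewrite ltr_pdivlMr // mulrDr mulr1 ltrD2r //.
have h1 : `|p| < `|t k|.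
  have := ler_normD (1 - t k) (t k); rewrite subrK normr1 distrC => h.
  have h' := le_lt_trans h (ltr_leD tk (lexx _)).
  apply: lt_trans sp _; rewrite -subr_gt0; move: h'; rewrite -subr_gt0.
  by congr (0 < _); field.
apply: (theta_near1 hp) => //.
have h2 : `|t k| < 1 + (1 - `|p|) / 2.
  have := ler_normD (t k - 1) 1; rewrite subrK normr1 => h.
  by rewrite addrC; apply: le_lt_trans h (ltr_leD tk (lexx _)).
have [pz|pz] := eqVneq `|p| 0; first by rewrite pz mul0r ltr01.
have p_gt0 : 0 < `|p| by rewrite lt_def pz normr_ge0.
have := h2; rewrite -(ltr_pM2l p_gt0) => h3; apply: lt_trans h3 _.
rewrite -subr_gt0.
have -> : 1 - `|p| * (1 + (1 - `|p|) / 2) = (1 - `|p|) * (1 + (1 - `|p|)) / 2 by field.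
by rewrite divr_gt0 // mulr_gt0 ?subr_gt0 // addr_gt0 ?subr_gt0.
Qed.

Lemma for_large_generic K (u : C) (t : nat -> C) : u != 0 ->
  (forall k, t k != 0) -> (forall k, t k != 1) -> tendsto t 1 ->
  for_large (fun k => generic th q K (u * t k)).
Proof.
move=> u0 t0 t1 tt.
have [N HN] : for_large (fun k => forall ij : 'I_K.+1 * 'I_K.+1,
    th (u * q ^+ ij.1 / q ^+ ij.2 * t k) != 0).
  apply: for_large_all => ij; apply: for_large_theta_neq0 => //.
  by rewrite !mulf_neq0 ?invr_eq0 ?expf_neq0.
exists N => k /HN H i j iK jK.
have := H (Ordinal (iK : (i < K.+1)%N), Ordinal (jK : (j < K.+1)%N)).
by rewrite /= [u * t k * _]mulrAC [_ * t k / _]mulrAC.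
Qed.

Lemma tendsto_poch (u : nat -> C) (l : C) m : l != 0 -> (forall k, u k != 0) ->
  tendsto u l -> tendsto (fun k => poch th q (u k) m) (poch th q l m).
Proof.
move=> l0 u0 ul; apply: tendsto_prod => i _.
apply: theta_continuous => //; first by rewrite mulf_neq0 ?expf_neq0.
  by move=> k; rewrite mulf_neq0 ?expf_neq0.
by apply: tendstoM ul _; apply: tendsto_cst.
Qed.

Lemma tendsto_div (u v : nat -> C) (l l' : C) : l' != 0 -> tendsto u l -> tendsto v l' ->
  tendsto (fun k => u k / v k) (l / l').
Proof. by move=> l0 ul vl; apply: tendstoM ul _; apply: tendstoV. Qed.

Lemma tendsto_ssum n N (z : 'I_n -> C) (b : 'I_n.+2 -> C) (a c d e : C)
    (bk : nat -> 'I_n.+2 -> C) (ak ck dk ek : nat -> C) :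
  (forall l, z l != 0) ->
  (forall j, b j != 0) -> a != 0 -> c != 0 -> d != 0 -> e != 0 ->
  (forall k j, bk k j != 0) -> (forall k, ak k != 0) -> (forall k, ck k != 0) ->
  (forall k, dk k != 0) -> (forall k, ek k != 0) ->
  (forall j, tendsto (bk^~ j) (b j)) ->
  tendsto ak a -> tendsto ck c -> tendsto dk d -> tendsto ek e ->
  (forall k, th (a * z k) != 0) ->
  (forall y : {ffun 'I_n -> 'I_N.+1}, (\sum_k y k <= N)%N ->
    [/\ poch th q (a * q / e) (\sum_k y k) != 0,
        forall j, poch th q (a * q / b j) (\sum_k y k) != 0 &
        forall k, [/\ poch th q (a * q ^+ (1 + N) * z k) (y k) != 0,
        poch th q (a * q * z k / c) (y k) != 0,
        poch th q (a * q * z k / d) (y k) != 0 &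
        forall j, poch th q (q * z k / z j) (y k) != 0]]) ->
  tendsto (fun k => ssum th q N z (bk k) (ak k) (ck k) (dk k) (ek k)) (ssum th q N z b a c d e).
Proof.
move=> z0 b0 a0 c0 d0 e0 bk0 ak0 ck0 dk0 ek0 tb ta tc td te az nz.
have cst (x : C) := tendsto_cst x.
have pc (u : nat -> C) l m : l != 0 -> (forall k, u k != 0) -> tendsto u l ->
  tendsto (fun k => poch th q (u k) m) (poch th q l m) by apply: tendsto_poch.
have Mc (u : nat -> C) l x : tendsto u l -> tendsto (fun k => u k * x) (l * x).
  by move=> h; apply: tendstoM h (cst x).
have m0 (x y : C) : x != 0 -> y != 0 -> x * y != 0 by move=> *; rewrite mulf_neq0.
have v0 (x : C) : x != 0 -> x^-1 != 0 by rewrite invr_eq0.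
have x0 (x : C) m : x != 0 -> x ^+ m != 0 by move=> ?; rewrite expf_neq0.
apply: tendsto_sum => y yN; have [nze nzb nzk] := nz y yN; rewrite /sterm.
set M := (\sum_k y k)%N in nze nzb *.
apply: tendstoM; first apply: tendstoM; first apply: tendstoM.
- apply: tendstoM (cst _) _; apply: tendsto_prod => k _; apply: tendsto_div => //.
    by apply: (theta_continuous hp) => [|i|]; [rewrite !mulf_neq0 ?x0|rewrite !mulf_neq0 ?x0|do 2!apply: (Mc)].
  by apply: (theta_continuous hp) => [|i|]; [rewrite !mulf_neq0|rewrite !mulf_neq0|apply: Mc].
- apply: tendsto_div.
  + by apply: mulf_neq0; [exact: nze|apply/prodf_neq0 => j _; exact: nzb].
  + apply: tendstoM; first apply: tendstoM; first apply: tendstoM; [exact: cst|exact: pc|exact: pc|].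
    by apply: tendsto_prod => j _; apply: pc => [|i|]; [apply: m0|apply: m0|apply: Mc].
  + apply: tendstoM; last apply: tendsto_prod => j _.
      by apply: pc => [|i|]; [rewrite !mulf_neq0 ?v0|rewrite !mulf_neq0 ?v0|apply: tendsto_div => //; apply: Mc].
    by apply: pc => [|i|]; [rewrite !mulf_neq0 ?v0|rewrite !mulf_neq0 ?v0|apply: tendsto_div => //; apply: Mc].
- exact: cst.
apply: tendsto_prod => k _; have [n1 n2 n3 n4] := nzk k; apply: tendsto_div.
- apply: mulf_neq0; first by apply: mulf_neq0; [exact: mulf_neq0 n1 n2|exact: n3].
  by apply/prodf_neq0 => j _; exact: n4.
- apply: tendstoM; last apply: tendsto_prod => j _.
    by apply: pc => [|i|]; [apply: m0|apply: m0|apply: Mc].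
  by apply: pc => [|i|]; [apply: m0|apply: m0|apply: Mc].
apply: tendstoM; last exact: cst.
apply: tendstoM; first apply: tendstoM.
- by apply: pc => [|i|]; [rewrite !mulf_neq0 ?x0|rewrite !mulf_neq0 ?x0|do 2!apply: (Mc)].
- by apply: pc => [|i|]; [rewrite !mulf_neq0 ?v0|rewrite !mulf_neq0 ?v0|apply: tendsto_div => //; do 2!apply: (Mc)].
by apply: pc => [|i|]; [rewrite !mulf_neq0 ?v0|rewrite !mulf_neq0 ?v0|apply: tendsto_div => //; do 2!apply: (Mc)].
Qed.

End Perturbation.

Section Corollary.
Variable R : realType.
Local Notation C := R[i].

Lemma for_large_nil (P : C -> Prop) :
  for_large (fun=> forall u, u \in [::] -> P u).
Proof. by exists 0%N. Qed.

Lemma for_large_cons (P : C -> Prop) (f : nat -> C) (l : nat -> seq C) :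
  for_large (fun k => P (f k)) -> for_large (fun k => forall u, u \in l k -> P u) ->
  for_large (fun k => forall u, u \in f k :: l k -> P u).
Proof.
move=> Hf Hl; have [K HK] := for_large_and Hf Hl; exists K => k /HK [Pf Pl] u.
by rewrite inE => /predU1P [->|/Pl].
Qed.

(** Real and above 1, so that no nonzero power of it equals 1. With integer powers, the relations
    between the parameters hold exactly for each [k]. *)
Definition tilt (k : nat) : C := 1 + 2^-1 ^+ k.

Lemma tilt_gt1 k : 1 < tilt k.
Proof. by rewrite ltrDl exprn_gt0 // invr_gt0. Qed.

Lemma tilt_neq0 k : tilt k != 0.
Proof. by rewrite gt_eqF // (lt_trans ltr01 (tilt_gt1 k)). Qed.

Lemma tilt_expz_neq1 k (m : int) : m != 0 -> tilt k ^ m != 1.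
Proof.
have pos j : tilt k ^+ j.+1 != 1.
  by rewrite gt_eqF // exprn_egt1 ?tilt_gt1 // ltW ?ltr01.
case: m => [[|j]|j] // _; first exact: pos.
by rewrite NegzE -exprnN invr_eq1.
Qed.

Lemma tendsto_tilt_expz (m : int) : tendsto (fun k => tilt k ^ m) 1.
Proof.
have t1 : tendsto tilt 1.
  rewrite -[X in tendsto _ X]addr0; apply: tendstoD (tendsto_cst _) _.
  apply: (eq_tendsto _ (@tendsto_geometric R 1 2^-1 _)) => [k|]; first by rewrite mul1r.
  by rewrite invr_ge0 ler0n invf_lt1 ?ltr0n // ltr1n.
by rewrite -[X in tendsto _ X](exp1rz C m); apply: tendsto_exprz; rewrite ?oner_neq0.
Qed.

Lemma tiltM k (x y : C) (i j : int) :
  (x * tilt k ^ i) * (y * tilt k ^ j) = x * y * tilt k ^ (i + j).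
Proof. by rewrite mulrACA -expfzDr ?tilt_neq0. Qed.

Lemma tiltV k (x : C) (i : int) : (x * tilt k ^ i)^-1 = x^-1 * tilt k ^ (- i).
Proof. by rewrite invfM -invr_expz. Qed.

(* These exponents, together with 1, 2, 3, 0 and -3 for [a], [c], [d], [e] and
   [lam], preserve both relations between the parameters, and give a nonzero
   exponent to every ratio that has to be generic. *)
Definition tilt_exponent n (j : 'I_n.+2) : int :=
  if val j is j'.+1 then if j' is 0 then - 4%:Z else 0 else 2.

Lemma prod_tilt_exponent n k : \prod_(j < n.+2) tilt k ^ tilt_exponent j = tilt k ^ (- 2%:Z).
Proof.
rewrite !big_ord_recl big1 ?mulr1 => [|j _] //; rewrite /tilt_exponent /=.
by rewrite -expfzDr ?tilt_neq0.
Qed.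

Section Limit.
Variables (p q : C) (n N : nat) (a c d e lam : C) (b : 'I_n.+2 -> C) (z : 'I_n -> C).
Hypotheses (hp : `|p| < 1) (hq : q != 0) (ha : a != 0) (hb : forall j, b j != 0).
Hypotheses (hc : c != 0) (hd : d != 0) (he : e != 0) (hz : forall k, z k != 0).
Hypothesis hbal : a ^+ 3 * q ^+ (2 + N) =
  (\prod_(j < n.+2) b j) * (c * d * e) * \prod_(k < n) z k.
Hypothesis hlam : lam = a ^+ 2 * q / (c * d * e).
Local Notation th := (theta p).
Hypothesis Delta_neq0 : vdm th z != 0.
Hypothesis theta_qX_neq0 : forall i, (0 < i <= N)%N -> th (q ^+ i) != 0.
Hypothesis theta_zz_neq0 : forall i l k, (k <= N)%N -> i != l -> th (z i * q ^+ k / z l) != 0.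

Definition perturb (x : C) (m : int) k := x * tilt k ^ m.
Definition perturb_b k j := perturb (b j) (tilt_exponent j) k.

Let lam0 : lam != 0.
Proof. by rewrite hlam !mulf_neq0 ?invr_eq0 ?mulf_neq0 ?expf_neq0. Qed.

Lemma perturb_neq0 x m k : x != 0 -> perturb x m k != 0.
Proof. by move=> x0; rewrite mulf_neq0 // expfz_neq0 // tilt_neq0. Qed.

Lemma for_large_generic_perturb K (f : nat -> C) x (m : int) : x != 0 -> m != 0 ->
  (forall k, f k = perturb x m k) -> for_large (fun k => generic th q K (f k)).
Proof.
move=> x0 m0 E.
have [M HM] := for_large_generic hp hq K x0 (fun k => expfz_neq0 m (tilt_neq0 k))
  (fun k => tilt_expz_neq1 k m0) (tendsto_tilt_expz m).
by exists M => k /HM; rewrite E.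
Qed.

(** Every ratio required to be generic is a constant times a nonzero power of [tilt k], and finitely
    many such conditions hold together for large [k]. *)
Lemma transformation_perturb : for_large (fun k =>
  ssum th q N z (perturb_b k) (perturb a 1 k) (perturb c 2 k) (perturb d 3 k) e =
  (perturb a 1 k / perturb lam (- 3%:Z) k) ^+ N *
  \prod_(l < n) (poch th q (perturb a 1 k * q * z l) N / poch th q (perturb lam (- 3%:Z) k * q * z l) N) *
  \prod_(j < n.+2) (poch th q (perturb lam (- 3%:Z) k * q / perturb_b k j) N / poch th q (perturb a 1 k * q / perturb_b k j) N) *
  ssum th q N z (perturb_b k) (perturb lam (- 3%:Z) k) (perturb (lam * c / a) (- 2%:Z) k)
    (perturb (lam * d / a) (- 1%:Z) k) (perturb (lam * e / a) (- 4%:Z) k)).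
Proof.
have pertM x y i j k : perturb x i k * perturb y j k = perturb (x * y) (i + j) k by apply: tiltM.
have pertV x i k : (perturb x i k)^-1 = perturb x^-1 (- i) k by apply: tiltV.
have pert0 x k : perturb x 0 k = x by rewrite /perturb expr0z mulr1.
have pertc x y i k : perturb x i k * y = perturb (x * y) i k by rewrite /perturb mulrAC.
have lc k : perturb lam (- 3%:Z) k * perturb c 2 k / perturb a 1 k = perturb (lam * c / a) (- 2%:Z) k.
  by rewrite pertM pertV pertM.
have ld k : perturb lam (- 3%:Z) k * perturb d 3 k / perturb a 1 k = perturb (lam * d / a) (- 1%:Z) k.
  by rewrite pertM pertV pertM.
have le k : perturb lam (- 3%:Z) k * e / perturb a 1 k = perturb (lam * e / a) (- 4%:Z) k.
  by rewrite pertc pertV pertM.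
pose K := N.*2.+1.
have E1 : for_large (fun k => forall u, u \in [:: perturb c 2 k; perturb d 3 k;
    perturb lam (- 3%:Z) k * perturb c 2 k / perturb a 1 k; perturb lam (- 3%:Z) k * perturb d 3 k / perturb a 1 k;
    perturb c 2 k / perturb d 3 k; perturb_b k ord0 / perturb a 1 k; perturb_b k ord0 / perturb lam (- 3%:Z) k; perturb a 1 k / e] ->
    generic th q K u).
  apply: for_large_cons; first
    exact: (for_large_generic_perturb K hc (_ : 2 != 0)).
  apply: for_large_cons; first
    exact: (for_large_generic_perturb K hd (_ : 3 != 0)).
  apply: for_large_cons; first
    by apply: (for_large_generic_perturb K _ _ lc); rewrite ?mulf_neq0 ?invr_eq0.
  apply: for_large_cons; first
    by apply: (for_large_generic_perturb K _ _ ld); rewrite ?mulf_neq0 ?invr_eq0.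
  apply: for_large_cons; first
    by apply: (@for_large_generic_perturb _ _ (c / d) (- 1%:Z)) => [||k]; rewrite ?mulf_neq0 ?invr_eq0 // pertV pertM.
  apply: for_large_cons; first
    by apply: (@for_large_generic_perturb _ _ (b ord0 / a) 1) => [||k]; rewrite ?mulf_neq0 ?invr_eq0 // pertV pertM.
  apply: for_large_cons; first
    by apply: (@for_large_generic_perturb _ _ (b ord0 / lam) 5) => [||k]; rewrite ?mulf_neq0 ?invr_eq0 // pertV pertM.
  apply: for_large_cons; first
    by apply: (@for_large_generic_perturb _ _ (a / e) 1) => [||k]; rewrite ?mulf_neq0 ?invr_eq0.
  exact: for_large_nil.
have E2 : for_large (fun k => forall l u, u \in [:: perturb a 1 k; perturb lam (- 3%:Z) k; perturb_b k ord0;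
    perturb a 1 k / perturb c 2 k; perturb a 1 k / perturb d 3 k] -> generic th q K (u * z l)).
  apply: (for_large_all (P := fun l k => forall u, u \in [:: perturb a 1 k; perturb lam (- 3%:Z) k; perturb_b k ord0;
    perturb a 1 k / perturb c 2 k; perturb a 1 k / perturb d 3 k] -> generic th q K (u * z l))) => l.
  apply: (for_large_cons (P := fun u => generic th q K (u * z l))); first
    by apply: (@for_large_generic_perturb _ _ (a * z l) 1) => [||k]; rewrite ?mulf_neq0 ?pertc.
  apply: (for_large_cons (P := fun u => generic th q K (u * z l))); first
    by apply: (@for_large_generic_perturb _ _ (lam * z l) (- 3%:Z)) => [||k]; rewrite ?mulf_neq0 ?pertc.
  apply: (for_large_cons (P := fun u => generic th q K (u * z l))); first
    by apply: (@for_large_generic_perturb _ _ (b ord0 * z l) 2) => [||k]; rewrite ?mulf_neq0 ?pertc.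
  apply: (for_large_cons (P := fun u => generic th q K (u * z l))); first
    by apply: (@for_large_generic_perturb _ _ (a / c * z l) (- 1%:Z)) => [||k]; rewrite ?mulf_neq0 ?invr_eq0 // pertV pertM pertc.
  apply: (for_large_cons (P := fun u => generic th q K (u * z l))); first
    by apply: (@for_large_generic_perturb _ _ (a / d * z l) (- 2%:Z)) => [||k]; rewrite ?mulf_neq0 ?invr_eq0 // pertV pertM pertc.
  exact: (for_large_nil (fun u => generic th q K (u * z l))).
have E3 : for_large (fun k => forall j u, u \in [:: perturb a 1 k; perturb lam (- 3%:Z) k] ->
    generic th q K (u / perturb_b k j)).
  apply: (for_large_all (P := fun j k => forall u, u \in [:: perturb a 1 k; perturb lam (- 3%:Z) k] ->
    generic th q K (u / perturb_b k j))) => j.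
  have A : for_large (fun k => generic th q K (perturb a 1 k / perturb_b k j)).
    apply: (@for_large_generic_perturb _ _ (a / b j) (1 - tilt_exponent j)) => [||k]; rewrite ?mulf_neq0 ?invr_eq0 //.
      by rewrite /tilt_exponent; case: (val j) => [|[]].
    by rewrite pertV pertM.
  have B : for_large (fun k => generic th q K (perturb lam (- 3%:Z) k / perturb_b k j)).
    apply: (@for_large_generic_perturb _ _ (lam / b j) (- 3%:Z - tilt_exponent j)) => [||k]; rewrite ?mulf_neq0 ?invr_eq0 //.
      by rewrite /tilt_exponent; case: (val j) => [|[]].
    by rewrite pertV pertM.
  have [M HM] := for_large_and A B; exists M => k /HM [Ak Bk] u.
  by rewrite !inE => /orP [] /eqP ->.
have [M HM] := for_large_and E1 (for_large_and E2 E3).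
exists M => k /HM [G1 [G2 G3]]; rewrite -lc -ld -le.
apply: generic_transformation => //; try exact: perturb_neq0.
- exact: theta1.
- exact: thetaV.
- exact: theta_div0.
- exact: theta_weierstrass.
- by move=> j; apply: perturb_neq0.
- rewrite /perturb_b /perturb big_split /= prod_tilt_exponent exprMn.
  rewrite mulrAC hbal; move: (tilt_neq0 k) (\prod_j b j) (\prod_k z k) => t0 B Z.
  by rewrite /exprz /=; field.
- by rewrite hlam /perturb /exprz /=; move: (tilt_neq0 k) => t0; field; rewrite hc hd he t0.
Qed.

(** In the limit only the denominators of the two sides have to be nonzero; the theta values by
    which the recursion divides have disappeared. *)
Lemma transformation :
  (forall k, th (a * z k) != 0) -> (forall k, th (lam * z k) != 0) ->
  (forall k, poch th q (lam * q * z k) N != 0) ->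
  (forall j, poch th q (a * q / b j) N != 0) ->
  (forall y : {ffun 'I_n -> 'I_N.+1}, (\sum_k y k <= N)%N ->
    [/\ poch th q (a * q / e) (\sum_k y k) != 0,
        forall j, poch th q (a * q / b j) (\sum_k y k) != 0 &
        forall j, poch th q (lam * q / b j) (\sum_k y k) != 0]) ->
  (forall y : {ffun 'I_n -> 'I_N.+1}, (\sum_k y k <= N)%N -> forall k,
    [/\ poch th q (a * q ^+ (1 + N) * z k) (y k) != 0,
        poch th q (lam * q ^+ (1 + N) * z k) (y k) != 0,
        poch th q (a * q * z k / c) (y k) != 0,
        poch th q (a * q * z k / d) (y k) != 0 &
        forall j, poch th q (q * z k / z j) (y k) != 0]) ->
  ssum th q N z b a c d e =
  (a / lam) ^+ N *
  \prod_(l < n) (poch th q (a * q * z l) N / poch th q (lam * q * z l) N) *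
  \prod_(j < n.+2) (poch th q (lam * q / b j) N / poch th q (a * q / b j) N) *
  ssum th q N z b lam (lam * c / a) (lam * d / a) (lam * e / a).
Proof.
move=> az lz prez preb densize denentry.
have pertx x m : tendsto (perturb x m) x.
  by rewrite -[X in tendsto _ X]mulr1; apply: tendstoM (tendsto_cst _) (tendsto_tilt_expz m).
have perty x m y : tendsto (fun k => perturb x m k * y) (x * y) by apply: tendstoM (pertx _ _) (tendsto_cst _).
have lca : lam * c / a != 0 by rewrite !mulf_neq0 ?invr_eq0.
have lda : lam * d / a != 0 by rewrite !mulf_neq0 ?invr_eq0.
have lea : lam * e / a != 0 by rewrite !mulf_neq0 ?invr_eq0.
have [M HM] := transformation_perturb.
have L : tendsto (fun k => ssum th q N z (perturb_b k) (perturb a 1 k) (perturb c 2 k) (perturb d 3 k) e)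
    (ssum th q N z b a c d e).
  apply: (tendsto_ssum hp hq (ck := perturb c 2) (dk := perturb d 3) (ek := fun=> e)) => //;
    try (by move=> *; apply: perturb_neq0); try exact: tendsto_cst; try exact: pertx.
    by move=> j; apply: pertx.
  move=> y yN; have [h1 h2 _] := densize y yN.
  split; [exact: h1|exact: h2|move=> k].
  by have [g1 _ g3 g4 g5] := denentry y yN k; split; [exact: g1|exact: g3|exact: g4|exact: g5].
apply: (tendsto_uniq (@tendsto_near _ _ _ _ M HM L)).
apply: tendstoM; first apply: tendstoM; first apply: tendstoM.
- by apply: tendstoX; apply: tendsto_div.
- apply: tendsto_prod => l _; apply: tendsto_div => //; apply: (tendsto_poch hp hq) => [|k|].
  + by rewrite !mulf_neq0.
  + by apply: (mulf_neq0 (mulf_neq0 (perturb_neq0 _ _ _) hq) (hz l)).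
  + by apply: tendstoM (tendsto_cst _); apply: perty.
  + by rewrite !mulf_neq0.
  + by apply: (mulf_neq0 (mulf_neq0 (perturb_neq0 _ _ _) hq) (hz l)).
  + by apply: tendstoM (tendsto_cst _); apply: perty.
- apply: tendsto_prod => j _; apply: tendsto_div => //; apply: (tendsto_poch hp hq) => [|k|].
  + by rewrite !mulf_neq0 ?invr_eq0.
  + by apply: (mulf_neq0 (mulf_neq0 (perturb_neq0 _ _ _) hq)); rewrite ?invr_eq0 // /perturb_b perturb_neq0.
  + by apply: tendsto_div; [exact: hb|exact: perty|exact: pertx].
  + by rewrite !mulf_neq0 ?invr_eq0.
  + by apply: (mulf_neq0 (mulf_neq0 (perturb_neq0 _ _ _) hq)); rewrite ?invr_eq0 // /perturb_b perturb_neq0.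
  + by apply: tendsto_div; [exact: hb|exact: perty|exact: pertx].
apply: (tendsto_ssum hp hq (ck := perturb (lam * c / a) _) (dk := perturb (lam * d / a) _)
  (ek := perturb (lam * e / a) _)) => //; try (by move=> *; apply: perturb_neq0); try exact: pertx.
  by move=> j; apply: pertx.
move=> y yN; have [h1 _ h3] := densize y yN; split; [|exact: h3|move=> k].
  suff -> : lam * q / (lam * e / a) = a * q / e by exact: h1.
  by field; rewrite ha he lam0.
have [_ g2 g3 g4 g5] := denentry y yN k; split; [exact: g2| | |exact: g5].
  suff -> : lam * q * z k / (lam * c / a) = a * q * z k / c by exact: g3.
  by field; rewrite ha hc lam0.
suff -> : lam * q * z k / (lam * d / a) = a * q * z k / d by exact: g4.
by field; rewrite ha hd lam0.
Qed.

End Limit.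
End Corollary.

Theorem corollary8p2 (R : realType) (p q : R[i]) (n N : nat)
  (a c d e lam : R[i]) (b : 'I_n.+2 -> R[i]) (z : 'I_n -> R[i])
  (hp : `|p| < 1) (hq : q != 0) (hn : (1 <= n)%N)
  (ha : a != 0) (hb : forall j, b j != 0)
  (hc : c != 0) (hd : d != 0) (he : e != 0) (hz : forall k, z k != 0)
  (hbal : a ^+ 3 * q ^+ (2 + N) =
          (\prod_(j < n.+2) b j) * (c * d * e) * \prod_(k < n) z k)
  (hlam : lam = a ^+ 2 * q / (c * d * e))
  (* no denominator vanishes *)
  (hDelta : eDelta p z != 0)
  (hthl : forall k, theta p (a * z k) != 0)
  (hthr : forall k, theta p (lam * z k) != 0)
  (hpre1 : forall k, epoch p q (lam * q * z k) N != 0)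
  (hpre2 : forall j, epoch p q (a * q / b j) N != 0)
  (hden_size : forall y : multi_index n N, (msize y <= N)%N ->
    [/\ epoch p q (a * q / e) (msize y) != 0,
        forall j, epoch p q (a * q / b j) (msize y) != 0 &
        forall j, epoch p q (lam * q / b j) (msize y) != 0])
  (hden_entry : forall y : multi_index n N, (msize y <= N)%N -> forall k,
    [/\ epoch p q (a * q ^+ (1 + N) * z k) (y k) != 0,
        epoch p q (lam * q ^+ (1 + N) * z k) (y k) != 0,
        epoch p q (a * q * z k / c) (y k) != 0,
        epoch p q (a * q * z k / d) (y k) != 0 &
        forall j, epoch p q (q * z k / z j) (y k) != 0]) :
  \sum_(y : multi_index n N | (msize y <= N)%N)
    (eDelta p (qshift q z y) / eDelta p z *
     (\prod_(k < n) (theta p (a * z k * q ^+ (y k + msize y))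
                     / theta p (a * z k))) *
     ((epoch p q (q ^- N) (msize y) * epoch p q c (msize y)
       * epoch p q d (msize y) * \prod_(j < n) epoch p q (a * z j) (msize y))
      / (epoch p q (a * q / e) (msize y)
         * \prod_(j < n.+2) epoch p q (a * q / b j) (msize y))) *
     q ^+ msize y *
     \prod_(k < n)
       ((epoch p q (e * z k) (y k)
         * \prod_(j < n.+2) epoch p q (b j * z k) (y k))
        / (epoch p q (a * q ^+ (1 + N) * z k) (y k)
           * epoch p q (a * q * z k / c) (y k)
           * epoch p q (a * q * z k / d) (y k)
           * \prod_(j < n) epoch p q (q * z k / z j) (y k))))
  =
  (a / lam) ^+ N *
  (\prod_(k < n) (epoch p q (a * q * z k) N / epoch p q (lam * q * z k) N)) *
  (\prod_(j < n.+2) (epoch p q (lam * q / b j) N / epoch p q (a * q / b j) N)) *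
  \sum_(y : multi_index n N | (msize y <= N)%N)
    (eDelta p (qshift q z y) / eDelta p z *
     (\prod_(k < n) (theta p (lam * z k * q ^+ (y k + msize y))
                     / theta p (lam * z k))) *
     ((epoch p q (q ^- N) (msize y) * epoch p q (lam * c / a) (msize y)
       * epoch p q (lam * d / a) (msize y)
       * \prod_(j < n) epoch p q (lam * z j) (msize y))
      / (epoch p q (a * q / e) (msize y)
         * \prod_(j < n.+2) epoch p q (lam * q / b j) (msize y))) *
     q ^+ msize y *
     \prod_(k < n)
       ((epoch p q (lam * e * z k / a) (y k)
         * \prod_(j < n.+2) epoch p q (b j * z k) (y k))
        / (epoch p q (lam * q ^+ (1 + N) * z k) (y k)
           * epoch p q (a * q * z k / c) (y k)
           * epoch p q (a * q * z k / d) (y k)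
           * \prod_(j < n) epoch p q (q * z k / z j) (y k)))).
Proof.
(* At the index with the single nonzero entry [N] in place [i], the denominators [(q z_i / z_l)_N]
   give all [theta (z_i q^m / z_l)] with [0 < m <= N]. The case [i = l] gives [theta (q^m)], with an
   index supplied by [n >= 1]; the case [m = 0] comes from Delta(z). *)
pose y1 (k : 'I_n) (m : 'I_N.+1) : multi_index n N := [ffun i => if i == k then m else ord0].
have y1N k : msize (y1 k ord_max) = N.
  by rewrite /msize (bigD1 k) //= ffunE eqxx big1 ?addn0 // => i ik; rewrite ffunE (negbTE ik).
have zq i l m : (0 < m <= N)%N -> theta p (z i * q ^+ m / z l) != 0.
  case: m => // m /= mN; have := hden_entry (y1 i ord_max); rewrite y1N => /(_ (leqnn N) i) [_ _ _ _ /(_ l)].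
  rewrite ffunE eqxx /epoch big_mkord => /prodf_neq0 /(_ (Ordinal mN) isT).
  suff -> : z i * q ^+ m.+1 / z l = q * z i / z l * q ^+ m by [].
  by rewrite exprS; ring.
have lamE : lam != 0 by rewrite hlam !mulf_neq0 ?invr_eq0 ?mulf_neq0 ?expf_neq0.
have qX i : (0 < i <= N)%N -> theta p (q ^+ i) != 0.
  by move=> /(zq (Ordinal hn) (Ordinal hn)); rewrite mulrAC divff // mul1r.
have zz0 i l : i != l -> theta p (z i / z l) != 0.
  have D (j k : 'I_n) : (j < k)%N -> theta p (z k / z j) != 0.
    move=> jk; have /prodf_neq0 /(_ j isT) /prodf_neq0 /(_ k jk) := hDelta.
    by rewrite mulf_eq0 (negbTE (hz j)).
  rewrite -val_eqE neq_ltn => /orP [|] /D //; by rewrite (th_div_sym (thetaV hp)).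
have zz i l k : (k <= N)%N -> i != l -> theta p (z i * q ^+ k / z l) != 0.
  by case: k => [|k] kN il; [rewrite mulr1 zz0|apply: zq].
apply: (etrans (transformation hp hq ha hb hc hd he hz hbal hlam hDelta qX zz hthl hthr
  hpre1 hpre2 hden_size hden_entry)).
(* [poch] and [vdm] at [theta p] are convertible to the definitions in the statement. *)
change (epoch p q) with (poch (theta p) q); change (@eDelta R p n) with (@vdm _ (theta p) n).
refine (congr1 ( *%R _) _).
apply: eq_bigr => y _.
have Ee : lam * q / (lam * e / a) = a * q / e by field; rewrite ha he lamE.
have Ec k : lam * q * z k / (lam * c / a) = a * q * z k / c by field; rewrite ha hc lamE.
have Ed k : lam * q * z k / (lam * d / a) = a * q * z k / d by field; rewrite ha hd lamE.
have Ez k : lam * e / a * z k = lam * e * z k / a by rewrite mulrAC.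
rewrite /sterm Ee; congr (_ * _).
by apply: eq_bigr => k _; rewrite Ec Ed Ez.
Qed.
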